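(* Let $\lambda=\sum_{i=1}^n m_i\omega_i$ be a dominant integral weight of $\mathfrak{sp}_{2n}$, and let $I(\lambda)\subset S(\mathfrak n^-)$ be the ideal such that $\mathrm{gr}\,V(\lambda)\simeq S(\mathfrak n^-)/I(\lambda)$, i.e. the annihilator of $v_\lambda$ in $\mathrm{gr}\,V(\lambda)$. Then $I(\lambda)$ is generated as an $S(\mathfrak n^-)$-module by the subspace $$U(\mathfrak n^+)\circ \mathrm{span}\Big\{f_{\alpha_{i,j}}^{(\lambda,\alpha_{i,j})+1},\ 1\le i\le j\le n-1;\quad f_{\alpha_{i,\overline{i}}}^{(\lambda,\alpha_{i,n})+1},\ 1\le i\le n\Big\},$$ where $(\lambda,\alpha_{i,j})=m_i+m_{i+1}+\dots+m_j$ for $1\le i\le j\le n$.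
   Context: Work over $\mathbb C$. Let $\mathfrak g=\mathfrak{sp}_{2n}=\mathfrak n^+\oplus\mathfrak h\oplus\mathfrak n^-$ be a Cartan decomposition, with simple roots $\alpha_1,\dots,\alpha_n$ (standard labelling, $\alpha_n$ the long simple root) and fundamental weights $\omega_1,\dots,\omega_n$. The positive roots are $$\alpha_{i,j}=\alpha_i+\alpha_{i+1}+\dots+\alpha_j,\quad \alpha_{i,\overline{j}}=\alpha_i+\alpha_{i+1}+\dots+\alpha_n+\alpha_{n-1}+\dots+\alpha_j,\qquad 1\le i\le j\le n,$$ where $\alpha_{i,n}=\alpha_{i,\overline n}$. For each positive root $\alpha$ fix a nonzero $f_\alpha\in\mathfrak n^-_{-\alpha}$. PBW filtration: $U(\mathfrak n^-)_s=\mathrm{span}\{x_1\cdots x_l: x_i\in\mathfrak n^-,\ l\le s\}$. For a dominant integral weight $\lambda$, $V(\lambda)$ is the irreducible $\mathfrak g$-module with highest weight $\lambda$ and highest weight vector $v_\lambda$; $V(\lambda)_s=U(\mathfrak n^-)_sv_\lambda$, and $\mathrm{gr}\,V(\lambda)=\bigoplus_{s\ge0}V(\lambda)_s/V(\lambda)_{s-1}$ (with $V(\lambda)_{-1}=0$). It is a cyclic module over the symmetric algebra $S(\mathfrak n^-)=\mathrm{gr}\,U(\mathfrak n^-)$, generated by (the image of) $v_\lambda$. The action $\circ$ of $U(\mathfrak n^+)$ on $S(\mathfrak n^-)$ is the one induced by the adjoint action of $\mathfrak n^+$ on $S(\mathfrak g)$ via the identification $S(\mathfrak n^-)\simeq S(\mathfrak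 g)/S(\mathfrak n^-)S_+(\mathfrak h\oplus\mathfrak n^+)$, where $S_+(\mathfrak h\oplus\mathfrak n^+)$ is the augmentation ideal of $S(\mathfrak h\oplus\mathfrak n^+)$. *)

(* Defs.v *)
From HB Require Import structures.
From mathcomp Require Import all_boot all_order all_algebra.
From mathcomp Require Import boolp functions reals complex mpoly.

Set Implicit Arguments.
Unset Strict Implicit.
Unset Printing Implicit Defensive.

Import GRing.Theory.
Local Open Scope ring_scope.
Local Open Scope quotient_scope.

Section Span.
Variables (F : fieldType) (V : lmodType F).

Definition lin_span (X : V -> Prop) : {pred V} := fun w =>
  `[< exists (k : nat) (c : 'I_k -> F) (u : 'I_k -> V),
        (forall i, X (u i)) /\ w = \sum_i c i *: u i >].

Lemma lin_spanP (X : V -> Prop) w :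
  reflect (exists (k : nat) (c : 'I_k -> F) (u : 'I_k -> V),
             (forall i, X (u i)) /\ w = \sum_i c i *: u i)
          (w \in lin_span X).
Proof. exact: asboolP. Qed.

Lemma sub_lin_span (X : V -> Prop) w : X w -> w \in lin_span X.
Proof.
move=> Xw; apply/lin_spanP; exists 1, (fun=> 1), (fun=> w); split=> //.
by rewrite big_ord1 scale1r.
Qed.

Lemma lin_span_closed (X : V -> Prop) : submod_closed (lin_span X).
Proof.
split=> [|a u w /lin_spanP[k [c [x [Xx ->]]]] /lin_spanP[l [d [y [Xy ->]]]]].
  apply/lin_spanP; exists 0, (fun=> 0), (fun=> 0).
  by split=> [[]|] //; rewrite big_ord0.
apply/lin_spanP; exists (k + l).
exists (fun i => match fintype.split i with inl j => a * c j | inr j => d j end).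
exists (fun i => match fintype.split i with inl j => x j | inr j => y j end).
split=> [i|]; first by case: (fintype.split i).
rewrite big_split_ord /= scaler_sumr; congr (_ + _); apply: eq_bigr => i _.
  by rewrite (unsplitK (inl i)) scalerA.
by rewrite (unsplitK (inr i)).
Qed.

HB.instance Definition _ (X : V -> Prop) :=
  GRing.isSubmodClosed.Build F V (lin_span X) (lin_span_closed X).

Lemma lin_span_min (X : V -> Prop) (W : submodClosed V) w :
  (forall u, X u -> u \in W) -> w \in lin_span X -> w \in W.
Proof.
move=> XW /lin_spanP[k [c [u [Xu ->]]]].
by apply: rpred_sum => i _; apply: rpredZ; exact/XW.
Qed.

End Span.

Section QuotientModule.
Variables (F : fieldType) (V : lmodType F) (X : V -> Prop).
Local Notation W := (lin_span X).

Local Notation Q := (Quotient.quot W).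

Definition quot_scale (a : F) (x : Q) : Q := \pi_Q (a *: repr x).

Lemma pi_quot_scale a (u : V) : quot_scale a (\pi_Q u) = \pi_Q (a *: u).
Proof.
apply/eqP; rewrite -Quotient.idealrBE -scalerBr; apply: rpredZ.
by rewrite Quotient.idealrBE reprK.
Qed.

Fact quot_scaleA a b (x : Q) :
  quot_scale a (quot_scale b x) = quot_scale (a * b) x.
Proof. by rewrite -[x]reprK (pi_quot_scale b) !pi_quot_scale scalerA. Qed.
Fact quot_scale1 : left_id 1 quot_scale.
Proof. by move=> x; rewrite -[x]reprK pi_quot_scale scale1r. Qed.
Fact quot_scaleDr : right_distributive quot_scale +%R.
Proof.
move=> a x y; rewrite -[x]reprK -[y]reprK -raddfD.
rewrite !pi_quot_scale scalerDr raddfD; reflexivity.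
Qed.
Fact quot_scaleDl (x : Q) : {morph quot_scale^~ x : a b / a + b}.
Proof. by move=> a b; rewrite -[x]reprK !pi_quot_scale scalerDl raddfD. Qed.

(* The quotient of V by the linear span of X. *)
Definition quot_mod : Type := Q.
HB.instance Definition _ := GRing.Zmodule.on quot_mod.
HB.instance Definition _ := GRing.Zmodule_isLmodule.Build F quot_mod
  quot_scaleA quot_scale1 quot_scaleDr quot_scaleDl.

Definition quot_pi (u : V) : quot_mod := \pi_Q u.
Definition quot_repr (x : quot_mod) : V := repr (x : Q).

Fact quot_pi_is_linear : linear quot_pi.
Proof.
move=> a u w; rewrite /quot_pi raddfD; congr (_ + _).
by symmetry; exact: pi_quot_scale.
Qed.
HB.instance Definition _ :=
  GRing.isLinear.Build F V quot_mod _ quot_pi quot_pi_is_linear.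

Lemma quot_piP (u w : V) :
  reflect (quot_pi u = quot_pi w) (u - w \in lin_span X).
Proof. rewrite Quotient.idealrBE; exact: eqP. Qed.

Lemma quot_reprK : cancel quot_repr quot_pi.
Proof. by move=> x; rewrite /quot_pi /quot_repr reprK. Qed.

End QuotientModule.

Section AssociatedGraded.
Variables (F : fieldType) (V : lmodType F).
(* Fil s is a set spanning the s-th step V_s of the filtration. *)
Variable (Fil : nat -> V -> Prop).

Definition fil (s : nat) : {pred V} := lin_span (Fil s).

(* V_{s-1}, with V_{-1} = 0 *)
Definition fil_pred (s : nat) : {pred V} :=
  if s is t.+1 then fil t else pred1 0.

Definition rees_pred : {pred nat -> V} := fun u =>
  `[< (forall s, u s \in fil s) /\
      (exists N, forall s, (N <= s)%N -> u s = 0) >].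

Fact rees_closed : submod_closed rees_pred.
Proof.
split=> [|a u w /asboolP[uF [N uN]] /asboolP[wF [M wM]]]; apply/asboolP.
  by split=> [s|]; [exact: rpred0 | exists 0].
split=> [s|]; first by apply: rpredD; [apply: rpredZ; exact: uF | exact: wF].
exists (N + M)%N => s NMs.
rewrite -[LHS]/(a *: u s + w s) uN ?wM ?scaler0 ?addr0 //.
  exact: leq_trans (leq_addl _ _) NMs.
exact: leq_trans (leq_addr _ _) NMs.
Qed.
HB.instance Definition _ :=
  GRing.isSubmodClosed.Build F (nat -> V) rees_pred rees_closed.

(* The direct sum of the V_s, as finitely supported families. *)
Record rees : Type := Rees { rees_val : nat -> V; _ : rees_pred rees_val }.
HB.instance Definition _ := [isSub for rees_val].
HB.instance Definition _ := [Choice of rees by <:].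
HB.instance Definition _ := [SubChoice_isSubLmodule of rees by <:].

(* gr V, the direct sum of the V_s / V_{s-1}, written as the quotient of the
   direct sum of the V_s by the direct sum of the V_{s-1} *)
Definition gr_den (u : rees) : Prop := forall s, val u s \in fil_pred s.
Definition gr_mod : Type := quot_mod gr_den.
HB.instance Definition _ := GRing.Lmodule.on gr_mod.
Definition gr_pi (u : rees) : gr_mod := quot_pi gr_den u.

Lemma gr_piP (u w : rees) : gr_pi u = gr_pi w <-> gr_den (u - w).
Proof.
split=> [/quot_piP|den]; last by apply/quot_piP; exact: sub_lin_span.
case/lin_spanP=> k [c [x [xden ->]]] s.
rewrite raddf_sum /= fct_sumE.
case: s => [|s]; last by apply: rpred_sum => i _; exact: (rpredZ _ (xden i s.+1)).
rewrite inE big1 // => i _; have /eqP x0 := xden i 0%N.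
by rewrite -[LHS]/(c i *: val (x i) 0%N) x0 scaler0.
Qed.

(* For an endomorphism g of V with g(V_s) contained in V_{s+1} for all s, the
   degree-one operator on gr V sending the class of u in V_s / V_{s-1} to the
   class of g u in V_{s+1} / V_s; insubd makes it total in g. *)
Definition shift_fam (g : {linear V -> V}) (u : nat -> V) : nat -> V :=
  fun s => if s is t.+1 then g (u t) else 0.
Definition rees_shift (g : {linear V -> V}) (u : rees) : rees :=
  insubd 0 (shift_fam g (val u)).
Definition gr_shift (g : {linear V -> V}) (x : gr_mod) : gr_mod :=
  gr_pi (rees_shift g (quot_repr x)).

Lemma rees_shiftE (g : {linear V -> V}) (u : rees) :
  (forall s w, w \in fil s -> g w \in fil s.+1) ->
  val (rees_shift g u) = shift_fam g (val u).
Proof.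
move=> gF; apply: insubdK; apply/asboolP.
have /asboolP[uF [N uN]] := valP u; split=> [[|s]|].
- exact: rpred0.
- exact/gF/uF.
exists N.+1 => -[|s] // Ns; rewrite /= uN ?linear0 //.
Qed.

Lemma gr_shiftE (g : {linear V -> V}) (u : rees) :
  (forall s w, w \in fil s -> g w \in fil s.+1) ->
  gr_shift g (gr_pi u) = gr_pi (rees_shift g u).
Proof.
move=> gF; apply/gr_piP => s.
have /gr_piP den : gr_pi (quot_repr (gr_pi u)) = gr_pi u by exact: quot_reprK.
rewrite raddfB /= !rees_shiftE //.
case: s => [|s] /=; first by rewrite inE -[X in X == _]/(0 - 0) subrr.
rewrite -[X in X \in _]/(g _ - g _) -linearB.
have := den s; rewrite raddfB; case: s => [|s]; last exact: gF.
by rewrite inE => /eqP; rewrite -[LHS]/(_ - _) => ->; rewrite linear0 rpred0.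
Qed.

(* The class in V_0 of a vector of V_0. *)
Definition gr_init (v : V) : gr_mod :=
  gr_pi (insubd 0 (fun s : nat => if s is _.+1 then 0 else v)).

End AssociatedGraded.

Section SymmetricAlgebra.
Variables (F : fieldType) (U : vectType F).

(* S(W), as the polynomial algebra on the basis vbasis W of W. *)
Definition Sym (W : {vspace U}) : Type := {mpoly F[\dim W]}.
HB.instance Definition _ W := GRing.ComAlgebra.on (Sym W).

(* the canonical inclusion of W in S(W) (only meaningful on W) *)
Definition sym_gen (W : {vspace U}) (x : U) : Sym W :=
  \sum_(i < \dim W) coord (vbasis W) i x *: 'X_i.

(* the inclusion S(W') -> S(W) for a subspace W' of W *)
Definition sym_incl (W' W : {vspace U}) (p : Sym W') : Sym W :=
  p \mPo [tuple sym_gen W (vbasis W')`_i | i < \dim W'].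

(* the derivation of S(W) extending the endomorphism d of W *)
Definition sym_der (W : {vspace U}) (d : U -> U) (p : Sym W) : Sym W :=
  \sum_(i < \dim W) p^`M(i) * sym_gen W (d (vbasis W)`_i).

(* the augmentation ideal S_+(W) *)
Definition sym_aug (W : {vspace U}) (p : Sym W) : Prop := p@_0%MM = 0.

End SymmetricAlgebra.

Section Symplectic.
Variables (F : fieldType) (n : nat).
Local Notation M := 'M[F]_(n + n).

Definition lie_br (x y : M) : M := x *m y - y *m x.

(* Gram matrix of the symplectic form on F^(2n) with
   <e_i, e_(2n+1-i)> = 1 for i <= n: for this choice the diagonal and the
   triangular matrices of sp_2n give a Cartan decomposition. *)
Definition sp_form : M :=
  \matrix_(i, j) if j == rev_ord i then (if (i < n)%N then 1 else -1) else 0.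

Definition sp_defect (x : M) : M := x^T *m sp_form + sp_form *m x.
Fact sp_defect_is_linear : linear sp_defect.
Proof.
move=> a x y; rewrite /sp_defect linearP mulmxDl mulmxDr -scalemxAl -scalemxAr.
by rewrite scalerDr addrACA.
Qed.
HB.instance Definition _ := GRing.isLinear.Build F M M _ _ sp_defect_is_linear.

Definition sp : {vspace M} := lker (linfun sp_defect).

Lemma spP x : reflect (x^T *m sp_form + sp_form *m x = 0) (x \in sp).
Proof. by rewrite memv_ker lfunE; exact: eqP. Qed.

Definition mask (P : rel 'I_(n + n)) (x : M) : M :=
  \matrix_(i, j) if P i j then 0 else x i j.
Fact mask_is_linear P : linear (mask P).
Proof.
by move=> a x y; apply/matrixP=> i j; rewrite !mxE; case: ifP => // _;
  rewrite mulr0 addr0.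
Qed.
HB.instance Definition _ P := GRing.isLinear.Build F M M _ _ (mask_is_linear P).

Definition sp_supp (P : rel 'I_(n + n)) : {vspace M} :=
  (sp :&: lker (linfun (mask P)))%VS.

Lemma sp_suppP P x :
  x \in sp_supp P <-> x \in sp /\ (forall i j, ~~ P i j -> x i j = 0).
Proof.
have kerE : (x \in lker (linfun (mask P))) = (mask P x == 0).
  by rewrite memv_ker lfunE.
rewrite memv_cap kerE; split.
  case/andP=> xsp /eqP/matrixP x0; split=> // i j /negPf Pij.
  by have := x0 i j; rewrite !mxE Pij.
case=> -> x0; apply/eqP/matrixP=> i j; rewrite !mxE.
by case: ifPn => // /x0.
Qed.

Definition nplus := sp_supp (fun i j => (i < j)%N).
Definition cartan := sp_supp (fun i j => i == j).
Definition nminus := sp_supp (fun i j => (j < i)%N).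

(* Integral weights are written in the basis epsilon_1, ..., epsilon_n, where
   epsilon_i (diag (t_1, ..., t_n, - t_n, ..., - t_1)) = t_i. Indices start at
   0 here: i : 'I_n stands for i + 1. *)
Definition wt (a : 'rV[int]_n) (h : M) : F :=
  \sum_(i < n) (a 0 i)%:~R * h (lshift n i) (lshift n i).

Definition fund_weight (i : 'I_n) : 'rV[int]_n :=
  \row_j (j <= i)%N%:R.

Definition simple_root (i : 'I_n) : 'rV[int]_n :=
  \row_j if i.+1 == n then (j == i)%:R *+ 2
         else (j == i)%:R - (j == i.+1 :> nat)%:R.

(* alpha_{i,j} and alpha_{i,bar j} *)
Definition alpha (i j : nat) : 'rV[int]_n :=
  \sum_(k < n | (i <= k <= j)%N) simple_root k.
Definition alpha_bar (i j : nat) : 'rV[int]_n :=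
  \sum_(k < n | (i <= k)%N) simple_root k +
  \sum_(k < n | (j <= k)%N && (k.+1 < n)%N) simple_root k.

Definition pos_root (a : 'rV[int]_n) : Prop :=
  exists i j : 'I_n, (i <= j)%N /\ (a = alpha i j \/ a = alpha_bar i j).

Definition neg_root_vector (a : 'rV[int]_n) (x : M) : Prop :=
  x \in nminus /\ forall h, h \in cartan -> lie_br h x = - wt a h *: x.

Section Modules.
Variables (V : lmodType F) (act : M -> {linear V -> V}).

(* act is only meaningful on sp. *)
Definition is_sp_module : Prop :=
  (forall a x y u, x \in sp -> y \in sp ->
     act (a *: x + y) u = a *: act x u + act y u) /\
  (forall x y u, x \in sp -> y \in sp ->
     act (lie_br x y) u = act x (act y u) - act y (act x u)).

Definition irreducible_module : Prop :=
  (exists u : V, u <> 0) /\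
  forall W : V -> Prop,
    W 0 -> (forall a u w, W u -> W w -> W (a *: u + w)) ->
    (forall x u, x \in sp -> W u -> W (act x u)) ->
    (forall u, W u -> u = 0) \/ (forall u, W u).

Definition highest_weight_vector (lam : 'rV[int]_n) (v : V) : Prop :=
  [/\ v <> 0, forall x, x \in nplus -> act x v = 0
    & forall h, h \in cartan -> act h v = wt lam h *: v].

(* V_s = U(n^-)_s v is the span of the following vectors. *)
Definition pbw (v : V) (s : nat) (u : V) : Prop :=
  exists xs : seq M, [/\ forall x, x \in xs -> x \in nminus, (size xs <= s)%N
    & u = foldr (fun x w => act x w) v xs].

Lemma act_fil v x s w :
  x \in nminus -> w \in fil (pbw v) s -> act x w \in fil (pbw v) s.+1.
Proof.
move=> xn /lin_spanP[k [c [u [Xu ->]]]]; rewrite linear_sum.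
apply: rpred_sum => i _; rewrite linearZ; apply: rpredZ; apply: sub_lin_span.
have [xs [xsn xss ->]] := Xu i; exists (x :: xs); split=> // y.
by rewrite inE => /predU1P[->|/xsn].
Qed.

Definition grV (v : V) : Type := gr_mod (pbw v).
HB.instance Definition _ v := GRing.Lmodule.on (grV v).

(* The operators gr_shift (act x) on gr V commute for x in n^-, so the order
   of the product below is immaterial. *)
Definition gr_act (v : V) (p : Sym nminus) (g : grV v) : grV v :=
  \sum_(m <- msupp p) p@_m *:
    foldr (fun i => iter (m i) (gr_shift (act (vbasis nminus)`_i))) g
      (enum 'I_(\dim nminus)).

Definition annihilator (v : V) (p : Sym nminus) : Prop :=
  gr_act p (gr_init (pbw v) v) = 0.

End Modules.

(* b = h + n^+, and the subspace S(n^-) S_+(b) of S(g) *)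
Definition borel : {vspace M} := (cartan + nplus)%VS.
Definition SnSb_prod (q : Sym sp) : Prop :=
  exists (a : Sym nminus) (b : Sym borel),
    sym_aug b /\ q = sym_incl sp a * sym_incl sp b.

(* circ e p q: q is the element e o p of S(n^-), for e in n^+; it exists and is
   unique since S(g) is the direct sum of S(n^-) and S(n^-) S_+(b). *)
Definition circ (e : M) (p q : Sym nminus) : Prop :=
  sym_der (lie_br e) (sym_incl sp p) - sym_incl sp q \in lin_span SnSb_prod.

(* elements e_1 o (... o (e_l o p)) with p in G and e_i in n^+ *)
Inductive circ_word (G : Sym nminus -> Prop) : Sym nminus -> Prop :=
| CircNil p : G p -> circ_word G p
| CircCons e p q : e \in nplus -> circ_word G p -> circ e p q -> circ_word G q.

(* U(n^+) o G *)
Definition U_circ (G : Sym nminus -> Prop) : Sym nminus -> Prop :=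
  fun q => q \in lin_span (circ_word G).

Definition ideal_gen (G : Sym nminus -> Prop) (p : Sym nminus) : Prop :=
  exists (k : nat) (a g : 'I_k -> Sym nminus),
    (forall i, G (g i)) /\ p = \sum_(i < k) a i * g i.

(* (lambda, alpha_{i,j}) = m_i + ... + m_j *)
Definition pairing (m : 'I_n -> nat) (i j : nat) : nat :=
  \sum_(k < n | (i <= k <= j)%N) m k.

End Symplectic.

(* Main.v *)
(* In sp_2n = Sym^2(C^2n) let Z_ab be the image of e_a e_b, so that n^- has the
   basis Z_ab with a <= b and a + b >= 2n (indices from 0), and consider the
   quadratic form Q = sum_ab Z_ab x_a x_b. Since Q is equivariant, n^+ acts on
   the coefficients of Q^N by vector fields in x; starting from the powers of
   the root vectors, which are extremal coefficients, this puts in the ideal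
   every coefficient whose degree violates one of the bounds (lambda, alpha).
   In such a coefficient the term with the smallest value of the sum of the
   a * b is a product of nested pairs. Eliminating these terms shows that,
   modulo the ideal, S(n^-) is spanned by the monomials all of whose nested
   submonomials satisfy the bounds.

   These monomials are linearly independent in gr V(lambda). V(lambda) is
   identified with the submodule generated by the highest weight vector of a
   tensor product of exterior powers of C^2n, and the exponent of an admissible
   monomial is a sum of antichains, one for each factor. The antichains select
   a coordinate of the tensor product which vanishes on all the monomials of
   the same degree with a larger sum of the a * b. The same embedding, with the
   contravariant hermitian form, shows that the powers of the root vectors
   annihilate the highest weight vector. *)
From HB Require Import structures.
From mathcomp Require Import all_boot all_order all_fingroup all_algebra.
From mathcomp Require Import zify ring.
From mathcomp Require Import boolp functions reals complex mpoly.
From mathcomp.multinomials Require Import ssrcomplements.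
Require Import Defs.

Set Implicit Arguments.
Unset Strict Implicit.
Unset Printing Implicit Defensive.

Import Order.TTheory GRing.Theory Num.Theory.
Local Open Scope ring_scope.

(** * Symmetric algebras *)

(** The weight a * b is chosen for one identity: reconnecting pairs (a, u), (b, w) as (a, b), (u, w)
    lowers the sum by (w - a)(b - u), so nested pairings are strict minima. Read as a rearrangement
    inequality, the same identity makes a tensor coordinate select a maximum; hence one statistic
    [qval] serves both spanning and independence. An element of n^+ used on Q^N has two nonzero
    entries, so it yields the wanted coefficient and a spurious one. The starting contents are
    extremal enough that in the spurious one some index has no partner with a + b >= 2n, so it is
    zero. A relation in gr V holds only modulo V_{s-1}. The chosen coordinate has s slots outside
    their initial range, and a word with fewer than s letters cannot reach it; it vanishes on the
    tensor counterpart of V_{s-1}, and the relation becomes an exact equation. Since V(lambda) is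
    abstract, it is compared with the tensor model inside the submodule of V x T generated by the
    pair of highest weight vectors. Positivity of the hermitian form shows that V determines the
    tensor component, and irreducibility gives the converse. *)

Lemma mpoly_indX (n : nat) (R : comNzRingType) (P : {mpoly R[n]} -> Prop) :
    P 1 -> (forall c p q, P p -> P q -> P (c *: p + q)) ->
    (forall i p, P p -> P ('X_i * p)) -> forall p, P p.
Proof.
move=> P1 PD PX; have P0 : P 0 by rewrite -[0](addNr 1) -scaleN1r; apply: PD.
elim/mpolyind => // c m p _ _ Pp; apply: PD Pp.
have [d le_md] := ubnP (mdeg m); elim: d m le_md => // d IH m le_md.
have [m0|m_neq0] := eqVneq (mdeg m) 0%N.
  by move/eqP: m0; rewrite mdeg_eq0 => /eqP ->; rewrite mpolyX0.
have [i mi] : exists i, (0 < m i)%N.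
  apply/existsP; apply: contraNT m_neq0 => /existsPn no.
  by rewrite mdegE big1 // => i _; have := no i; rewrite lt0n negbK => /eqP.
have mE : m = (U_(i) + (m - U_(i)))%MM.
  by rewrite addmC submK //; apply/mnm_lepP => j; rewrite mnm1E; case: eqP => // <-.
rewrite mE mpolyXD; apply: PX; apply: IH.
by move: le_md; rewrite {1}mE mdegD mdeg1.
Qed.

Section SymTheory.
Variables (F : fieldType) (U : vectType F).
Implicit Types W : {vspace U}.

Lemma vbasis_nth_mem W (i : 'I_(\dim W)) : (vbasis W)`_i \in W.
Proof. by apply: vbasis_mem; apply: mem_nth; rewrite size_tuple. Qed.

Lemma eq_lin_vbasis (V : lmodType F) W (f g : {linear U -> V}) x : x \in W ->
  (forall i : 'I_(\dim W), f (vbasis W)`_i = g (vbasis W)`_i) -> f x = g x.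
Proof.
move=> xW fg; rewrite (coord_vbasis xW) (linear_sum f) (linear_sum g).
by apply: eq_bigr => i _; rewrite !linearZ fg.
Qed.

Fact sym_gen_is_linear W : linear (sym_gen W).
Proof.
move=> a x y; rewrite /sym_gen scaler_sumr -big_split /=.
by apply: eq_bigr => i _; rewrite linearP scalerDl scalerA.
Qed.
HB.instance Definition _ W :=
  GRing.isLinear.Build F U (Sym W) _ (sym_gen W) (sym_gen_is_linear W).

Lemma sym_genZ W a x : sym_gen W (a *: x) = a *: sym_gen W x.
Proof. exact: linearZ. Qed.

Lemma sym_gen_basis W (i : 'I_(\dim W)) :
  sym_gen W (vbasis W)`_i = 'X_i.
Proof.
rewrite /sym_gen (bigD1 i) //= coord_free ?(basis_free (vbasisP W)) // eqxx.
rewrite scale1r big1 ?addr0 // => j ji.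
by rewrite coord_free ?(basis_free (vbasisP W)) // eq_sym (negPf ji) scale0r.
Qed.

Lemma sym_indX W (P : Sym W -> Prop) :
    P 1 -> (forall c p q, P p -> P q -> P (c *: p + q)) ->
    (forall (i : 'I_(\dim W)) p, P p -> P (sym_gen W (vbasis W)`_i * p)) -> forall p, P p.
Proof.
by move=> P1 PD PX; apply: mpoly_indX => // i p; rewrite -sym_gen_basis; apply: PX.
Qed.

Section Der.
Variables (W : {vspace U}) (d : U -> U).

Fact sym_der_is_linear : linear (sym_der (W:=W) d).
Proof.
move=> a p q; rewrite /sym_der scaler_sumr -big_split /=.
apply: eq_bigr => i _; rewrite mderivD mderivZ mulrDl -scalerAl //.
Qed.
HB.instance Definition _ :=
  GRing.isLinear.Build F (Sym W) (Sym W) _ (sym_der d) sym_der_is_linear.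

Lemma sym_derP a (p q : Sym W) : sym_der d (a *: p + q) = a *: sym_der d p + sym_der d q.
Proof. exact: linearP. Qed.
Lemma sym_derM (p q : Sym W) : sym_der d (p * q) = sym_der d p * q + p * sym_der d q.
Proof.
rewrite /sym_der mulr_suml mulr_sumr -big_split /=; apply: eq_bigr => i _.
by rewrite mderivM mulrDl mulrA mulrAC.
Qed.

Lemma sym_der1 : sym_der d (1 : Sym W) = 0.
Proof. by rewrite /sym_der big1 // => i _; rewrite -mpolyC1 mderivC mul0r. Qed.

Lemma sym_der_basis (i : 'I_(\dim W)) :
  sym_der d (sym_gen W (vbasis W)`_i) = sym_gen W (d (vbasis W)`_i).
Proof.
rewrite sym_gen_basis /sym_der (bigD1 i) //= big1 => [|j ji].
  rewrite mderivX mnm1E eqxx scale1r -[X in (X - _)%MM]add0m addmK.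
  by rewrite mpolyX0 mul1r addr0.
by rewrite mderivX mnm1E eq_sym (negPf ji) scale0r mul0r.
Qed.
End Der.

Lemma sym_der_gen W (d : {linear U -> U}) x : x \in W ->
  sym_der d (sym_gen W x) = sym_gen W (d x).
Proof.
move=> xW; apply: (eq_lin_vbasis (f := sym_der d \o sym_gen W)
  (g := sym_gen W \o d) xW) => i; exact: sym_der_basis.
Qed.

Section Eval.
Variables (W W' : {vspace U}) (d : U -> U).

(** One construction covers both maps needed below: d = [idfun] gives the inclusions into S(g), and
    d = [low] the projection S(g) -> S(n^-). *)
Definition sym_map (p : Sym W) : Sym W' :=
  p \mPo [tuple sym_gen W' (d (vbasis W)`_i) | i < \dim W].

Fact sym_map_is_linear : linear sym_map.
Proof. by move=> a p q; rewrite /sym_map comp_mpolyD comp_mpolyZ. Qed.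
HB.instance Definition _ :=
  GRing.isLinear.Build F (Sym W) (Sym W') _ sym_map sym_map_is_linear.

Lemma sym_mapP a (p q : Sym W) : sym_map (a *: p + q) = a *: sym_map p + sym_map q.
Proof. exact: linearP. Qed.
Lemma sym_mapD (p q : Sym W) : sym_map (p + q) = sym_map p + sym_map q.
Proof. exact: linearD. Qed.
Lemma sym_mapM (p q : Sym W) : sym_map (p * q) = sym_map p * sym_map q.
Proof. exact: rmorphM. Qed.
Lemma sym_map1 : sym_map 1 = 1.
Proof. exact: rmorph1. Qed.

Lemma sym_map_basis (i : 'I_(\dim W)) :
  sym_map (sym_gen W (vbasis W)`_i) = sym_gen W' (d (vbasis W)`_i).
Proof. by rewrite sym_gen_basis /sym_map comp_mpolyXU -tnth_nth tnth_mktuple. Qed.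
End Eval.

Lemma sym_map_gen W W' (d : {linear U -> U}) x : x \in W ->
  sym_map W' d (sym_gen W x) = sym_gen W' (d x).
Proof.
move=> xW; apply: (eq_lin_vbasis (f := sym_map W' d \o sym_gen W)
  (g := sym_gen W' \o d) xW) => i; exact: sym_map_basis.
Qed.

Lemma sym_inclE W W' : @sym_incl F U W' W = @sym_map W' W idfun.
Proof. by []. Qed.

End SymTheory.

(** * Symplectic matrices *)

Section SpMatrices.
Variables (F : numFieldType) (n : nat).
Local Notation M := 'M[F]_(n + n).
Local Notation J := (sp_form F n).

(* Under sp_2n = Sym^2 (F^2n), the element zm a b is, up to sign, e_a e_b;
   it lies in n^- exactly when a + b >= 2n. *)
Definition zm (a b : 'I_(n + n)) : M := - ((delta_mx a b + delta_mx b a) *m J).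

Lemma zmC a b : zm a b = zm b a.
Proof. by rewrite /zm addrC. Qed.

Lemma delta_sp_form (a b r c : 'I_(n + n)) :
  (delta_mx a b *m J) r c = (r == a)%:R * J b c.
Proof.
rewrite mxE (bigD1 b) //= big1 => [|k kb]; last by rewrite mxE (negPf kb) andbF mul0r.
by rewrite mxE eqxx andbT addr0.
Qed.

Lemma zmE a b r c : zm a b r c = - ((r == a)%:R * J b c + (r == b)%:R * J a c).
Proof. by rewrite /zm mulmxDl mxE [X in - X]mxE !delta_sp_form. Qed.

Lemma sp_formN (a b : 'I_(n + n)) : b != rev_ord a -> J a b = 0.
Proof. by move=> ab; rewrite mxE (negPf ab). Qed.

Lemma sp_form_tr : J^T = - J.
Proof.
apply/matrixP => i j; rewrite !mxE.
have -> : (i == rev_ord j) = (j == rev_ord i) by rewrite -(inj_eq rev_ord_inj) rev_ordK eq_sym.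
case: eqP => [->|_]; last by rewrite oppr0.
have := ltn_ord i; rewrite /=; case: ifP; case: ifP; rewrite ?opprK //; lia.
Qed.

Lemma sp_form_sqr : J *m J = - 1%:M.
Proof.
apply/matrixP => i j; rewrite mxE (bigD1 (rev_ord i)) //= big1 ?addr0; last first.
  by move=> k ki; rewrite sp_formN ?mul0r.
rewrite !mxE eqxx rev_ordK eq_sym; case: eqP => _; rewrite ?mulr0 ?oppr0 //=.
have := ltn_ord i; case: ifP; case: ifP; rewrite ?mulr1 ?mul1r ?mulrNN //; lia.
Qed.

Lemma sp_mulJ (e : M) : e \in sp F n -> J *m e = - (e^T *m J).
Proof. by move=> /spP /eqP; rewrite addrC addr_eq0 => /eqP. Qed.

Lemma zm_sp a b : zm a b \in sp F n.
Proof.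
apply/spP; rewrite /zm linearN /= trmx_mul sp_form_tr linearD /= !trmx_delta.
by rewrite !mulNmx opprK mulmxN mulmxA [delta_mx b a + _]addrC subrr.
Qed.

(** As J e = - e^T J on sp, bracketing S J with e replaces the symmetric matrix S by e S + S e^T.
    This is the action on Sym^2, hence the Leibniz rule in the two indices. *)
Lemma lie_br_zm e a b : e \in sp F n ->
  lie_br e (zm a b) = \sum_c e c a *: zm c b + \sum_c e c b *: zm a c.
Proof.
move=> esp; rewrite /lie_br /zm mulmxN mulNmx -mulmxA (sp_mulJ esp) mulmxN opprK.
rewrite !mulmxA -opprD -mulmxDl.
have El (x y : 'I_(n + n)) : e *m delta_mx x y = \sum_c e c x *: delta_mx c y.
  apply/matrixP => r s; rewrite mxE summxE (bigD1 x) //= big1 => [|k kx]; last first.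
    by rewrite mxE (negPf kx) mulr0.
  rewrite (bigD1 r) //= big1 => [|k kr]; last by rewrite !mxE eq_sym (negPf kr) mulr0.
  by rewrite !mxE !eqxx /= !addr0.
have Er (x y : 'I_(n + n)) : delta_mx x y *m e^T = \sum_c e c y *: delta_mx x c.
  rewrite -[LHS]trmxK trmx_mul trmxK trmx_delta El linear_sum /=.
  by apply: eq_bigr => c _; rewrite linearZ /= trmx_delta.
rewrite mulmxDr [(_ + _) *m e^T]mulmxDl !El !Er.
have -> : \sum_c e c a *: - ((delta_mx c b + delta_mx b c) *m J) =
   - ((\sum_c e c a *: delta_mx c b + \sum_c e c a *: delta_mx b c) *m J).
  rewrite -big_split /= mulmx_suml -sumrN; apply: eq_bigr => c _.
  by rewrite scalerN -scalerDr scalemxAl.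
have -> : \sum_c e c b *: - ((delta_mx a c + delta_mx c a) *m J) =
   - ((\sum_c e c b *: delta_mx a c + \sum_c e c b *: delta_mx c a) *m J).
  rewrite -big_split /= mulmx_suml -sumrN; apply: eq_bigr => c _.
  by rewrite scalerN -scalerDr scalemxAl.
rewrite -[in RHS]opprD -[in RHS]mulmxDl.
set A1 := \sum_(c < _) _; set A2 := \sum_(c < _) _.
set A3 := \sum_(c < _) _; set A4 := \sum_(c < _) _.
by rewrite [A3 + A4]addrC addrACA [A2 + A3]addrC.
Qed.

Lemma lie_br_sp e x : e \in sp F n -> x \in sp F n -> lie_br e x \in sp F n.
Proof.
move=> /spP/eqP; rewrite addr_eq0 => /eqP Ee /spP/eqP; rewrite addr_eq0 => /eqP Ex.
apply/spP; rewrite /lie_br linearB /= !trmx_mul mulmxBl mulmxBr -!mulmxA Ee Ex.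
by rewrite !mulmxN !mulmxA Ee Ex !mulNmx !opprK addrC subrKA subrr.
Qed.

Fact lie_br_is_linear (e : M) : linear (lie_br e).
Proof.
move=> a x y; rewrite /lie_br mulmxDr mulmxDl -scalemxAl -scalemxAr.
by rewrite scalerBr addrACA -opprD.
Qed.
HB.instance Definition _ e :=
  GRing.isLinear.Build F M M _ (lie_br e) (lie_br_is_linear e).

(** For x in sp the matrix x J is symmetric and x = - (x J) J. The factor 1/2 appears because the
    double sum meets each unordered pair twice. *)
Lemma sp_expand (x : M) : x \in sp F n ->
  x = \sum_a \sum_b (2^-1 * (x a (rev_ord b) * J (rev_ord b) b)) *: zm a b.
Proof.
move=> xsp; set y := x *m J.
have yE a b : y a b = x a (rev_ord b) * J (rev_ord b) b.
  rewrite mxE (bigD1 (rev_ord b)) //= big1 ?addr0 // => k kb.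
  by rewrite sp_formN ?mulr0 //; apply: contraNneq kb => ->; rewrite rev_ordK.
have ysym : y^T = y.
  rewrite trmx_mul sp_form_tr mulNmx; have := sp_mulJ xsp.
  move=> /(congr1 (fun w => J *m w *m J)); rewrite !mulmxN mulmxA sp_form_sqr.
  rewrite !mulNmx mul1mx !mulmxA -(mulmxA _ J J) sp_form_sqr mulmxN mulmx1 opprK.
  by move=> <-; rewrite opprK.
under eq_bigr => a _ do under eq_bigr => b _ do rewrite -yE.
have -> : x = - (y *m J) by rewrite /y -mulmxA sp_form_sqr mulmxN mulmx1 opprK.
apply/matrixP => r c; rewrite !mxE summxE.
under [RHS]eq_bigr => a _.
  rewrite summxE; under eq_bigr => b _ do rewrite mxE zmE mulrN mulrDr.
  rewrite sumrN big_split /=; over.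
rewrite sumrN big_split /=; congr (- _).
have -> : \sum_a \sum_b 2^-1 * y a b * ((r == a)%:R * J b c) = 2^-1 * \sum_b y r b * J b c.
  rewrite (bigD1 r) //= [X in _ + X]big1 => [|a ar]; last first.
    by rewrite big1 // => b _; rewrite eq_sym (negPf ar) mul0r mulr0.
  by rewrite addr0 mulr_sumr; apply: eq_bigr => b _; rewrite eqxx mul1r mulrA.
have -> : \sum_a \sum_b 2^-1 * y a b * ((r == b)%:R * J a c) = 2^-1 * \sum_b y r b * J b c.
  rewrite exchange_big /= (bigD1 r) //= [X in _ + X]big1 => [|a ar]; last first.
    by rewrite big1 // => b _; rewrite eq_sym (negPf ar) mul0r mulr0.
  rewrite addr0 mulr_sumr; apply: eq_bigr => b _; rewrite eqxx mul1r mulrA.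
  by rewrite -{1}ysym mxE.
by rewrite -mulrDl -div1r -splitr mul1r.
Qed.

Lemma sp_supp_expand P (x : M) : x \in sp_supp F P ->
  exists c : 'I_(n + n) -> 'I_(n + n) -> F,
    x = \sum_a \sum_(b | P a (rev_ord b)) c a b *: zm a b.
Proof.
case/sp_suppP => xsp x0; eexists; rewrite {1}(sp_expand xsp).
apply: eq_bigr => a _; rewrite [RHS]big_mkcond; apply: eq_bigr => b _.
by case: ifPn => [_|/x0 ->]; rewrite ?mul0r ?mulr0 ?scale0r.
Qed.

Lemma zm_neq0 a b r c : zm a b r c != 0 ->
  (r == a) && (c == rev_ord b) || (r == b) && (c == rev_ord a).
Proof.
rewrite zmE; apply: contraR; rewrite negb_or !negb_and.
case: (eqVneq r a) => _; case: (eqVneq r b) => _ /=; rewrite ?mul0r ?addr0 ?add0r ?oppr0 //.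
- by case/andP=> ? ?; rewrite !sp_formN // !mulr0 addr0 oppr0.
- by rewrite andbT => ?; rewrite sp_formN // mulr0 oppr0.
- by move=> ?; rewrite sp_formN // mulr0 oppr0.
Qed.

Lemma zm_supp (P : rel 'I_(n + n)) a b : P a (rev_ord b) -> P b (rev_ord a) ->
  zm a b \in sp_supp F P.
Proof.
move=> Pab Pba; apply/sp_suppP; split=> [|r c Prc]; first exact: zm_sp.
apply/eqP; apply: contraNT Prc => /zm_neq0.
by case/orP => /andP[/eqP-> /eqP->].
Qed.

Lemma zm_nminus (a b : 'I_(n + n)) : (n + n <= a + b)%N -> zm a b \in nminus F n.
Proof. by have := ltn_ord a; have := ltn_ord b; move=> ? ? ab; apply: zm_supp => /=; lia. Qed.

Lemma zm_nplus (a b : 'I_(n + n)) : (a + b < (n + n).-1)%N -> zm a b \in nplus F n.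
Proof. by have := ltn_ord a; have := ltn_ord b; move=> ? ? ab; apply: zm_supp => /=; lia. Qed.

Lemma zm_borel (a b : 'I_(n + n)) : (a + b < n + n)%N -> zm a b \in borel F n.
Proof.
have := ltn_ord a; have := ltn_ord b; move=> ? ? ab.
have [ab1|ab1] := ltnP (a + b) (n + n).-1.
  by apply: (subvP (addvSr _ _)); apply: zm_nplus.
apply: (subvP (addvSl _ _)); apply: zm_supp; apply/eqP/val_inj => /=; lia.
Qed.

Lemma nminus_sp x : x \in nminus F n -> x \in sp F n.
Proof. by case/sp_suppP. Qed.
Lemma nplus_sp x : x \in nplus F n -> x \in sp F n.
Proof. by case/sp_suppP. Qed.
Lemma borel_sp x : x \in borel F n -> x \in sp F n.
Proof. by apply/subvP; rewrite subv_add !capvSl. Qed.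

(** On [sp] this is the projection onto n^- with kernel b. It makes the action of n^+ on S(n^-)
    explicit: take the adjoint bracket, then drop its component in b. *)
Definition low : M -> M := mask (fun i j => ~~ (j < i)%N).
HB.instance Definition _ := GRing.Linear.on low.

Lemma lowE (x : M) r c : low x r c = if (c < r)%N then x r c else 0.
Proof. by rewrite mxE if_neg. Qed.

Lemma low_id x : x \in nminus F n -> low x = x.
Proof.
case/sp_suppP => _ x0; apply/matrixP => r c; rewrite lowE.
by case: ifPn => // /x0.
Qed.

Lemma low_zm (a b : 'I_(n + n)) :
  low (zm a b) = if (n + n <= a + b)%N then zm a b else 0.
Proof.
case: ifPn => [ab|]; first exact/low_id/zm_nminus.
rewrite -ltnNge => ab; apply/matrixP => r c; rewrite lowE [RHS]mxE; case: ifP => // rc.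
apply/eqP; apply: contraT => /zm_neq0 nz.
 have := ltn_ord a; have := ltn_ord b; move: rc ab.
by case/orP: nz => /andP[/eqP-> /eqP->] /=; lia.
Qed.

Lemma low_nminus x : x \in sp F n -> low x \in nminus F n.
Proof.
move=> /sp_expand ->; rewrite linear_sum; apply: rpred_sum => a _.
rewrite linear_sum; apply: rpred_sum => b _; rewrite linearZ; apply: rpredZ.
by rewrite /= low_zm; case: ifP => [/zm_nminus|_] //; apply: rpred0.
Qed.

Lemma sub_low_borel x : x \in sp F n -> x - low x \in borel F n.
Proof.
move=> /sp_expand ->; rewrite linear_sum -sumrB; apply: rpred_sum => a _.
rewrite linear_sum -sumrB; apply: rpred_sum => b _; rewrite linearZ -scalerBr.
apply: rpredZ; rewrite /= low_zm; case: ifPn => [_|]; first by rewrite subrr rpred0.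
by rewrite -ltnNge subr0 => /zm_borel.
Qed.

Lemma low_borel x : x \in borel F n -> low x = 0.
Proof.
case/memv_addP => y /sp_suppP[_ y0] [w /sp_suppP[_ w0] ->].
rewrite linearD /=; apply/matrixP => r c; rewrite mxE !lowE [RHS]mxE.
case: ifP => rc; rewrite ?addr0 // y0 -?val_eqE ?(gtn_eqF rc) //.
by rewrite w0 ?addr0 // -leqNgt ltnW.
Qed.

Local Notation Snm := (Sym (nminus F n)).
Local Notation Ssp := (Sym (sp F n)).
Local Notation Sb := (Sym (borel F n)).

Definition circ_der (e : M) : Snm -> Snm := sym_der (low \o lie_br e).
HB.instance Definition _ e := GRing.Linear.on (circ_der e).

Local Notation incl W := (sym_map (W:=W) (sp F n) idfun).
Local Notation pi := (sym_map (W:=sp F n) (nminus F n) low).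

Lemma sym_proj_incl (p : Snm) : pi (incl _ p) = p.
Proof.
elim/sym_indX: p => [|c p q Ep Eq|i p Ep]; first by rewrite !sym_map1.
  by rewrite !sym_mapP Ep Eq.
have bi := vbasis_nth_mem i.
by rewrite !sym_mapM Ep !sym_map_gen ?nminus_sp //= low_id.
Qed.

Lemma sym_proj_borel (p : Sb) : pi (incl _ p) = (p@_0%MM)%:MP.
Proof.
elim/sym_indX: p => [|c p q Ep Eq|i p Ep]; first by rewrite !sym_map1 mcoeff1 eqxx.
  by rewrite !sym_mapP Ep Eq mcoeffD mcoeffZ mpolyCD mpolyCM mul_mpolyC.
have bi := vbasis_nth_mem i.
rewrite !sym_mapM Ep !sym_map_gen ?borel_sp //= low_borel // linear0 mul0r.
by rewrite rmorphM /= sym_gen_basis mcoeffX mnm1_eq0 mul0r.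
Qed.

(** The projection is an algebra morphism that is the identity on S(n^-), so both sides obey the
    same Leibniz rule and can be compared on generators. *)
Lemma sym_proj_der e (p : Snm) : e \in sp F n ->
  pi (sym_der (lie_br e) (incl _ p)) = circ_der e p.
Proof.
move=> esp; elim/sym_indX: p => [|c p q Ep Eq|i p Ep].
- by rewrite sym_map1 sym_der1 linear0 /circ_der sym_der1.
- rewrite [incl _ (_ + _)]sym_mapP [sym_der _ (_ + _)]sym_derP [pi (_ + _)]sym_mapP.
  by rewrite [in RHS]/circ_der sym_derP; congr (_ *: _ + _); [exact: Ep | exact: Eq].
have bi := vbasis_nth_mem i; have spi := nminus_sp bi.
rewrite [incl _ (_ * _)]sym_mapM [sym_der _ (_ * _)]sym_derM [pi (_ + _)]sym_mapD.
rewrite ![pi (_ * _)]sym_mapM [in RHS]/circ_der sym_derM; congr (_ * _ + _ * _).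
- by rewrite sym_der_basis sym_map_gen //= sym_der_gen // sym_map_gen // lie_br_sp.
- exact: sym_proj_incl.
- exact: sym_proj_incl.
- exact: Ep.
Qed.

Local Notation K := (lin_span (@SnSb_prod F n)).

Lemma sym_proj_SnSb y : y \in K -> pi y = 0.
Proof.
case/lin_spanP => k [c [u [Xu ->]]]; rewrite linear_sum big1 // => i _.
have [a [b [b0 ->]]] := Xu i; rewrite linearZ /=.
have -> : sym_incl (sp F n) b = incl _ b by [].
by rewrite sym_mapM sym_proj_borel b0 mpolyC0 mulr0 scaler0.
Qed.

Lemma SnSb_mull (a : Snm) y : y \in K -> incl _ a * y \in K.
Proof.
case/lin_spanP => k [c [u [Xu ->]]]; rewrite mulr_sumr; apply: rpred_sum => i _.
have [a' [b [b0 ->]]] := Xu i; rewrite -scalerAr; apply: rpredZ.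
apply: sub_lin_span; exists (a * a'), b; split => //.
by rewrite -[sym_incl _ (_ * _)]/(incl _ (a * a')) sym_mapM mulrA.
Qed.

Lemma SnSb_mulr (b : Sb) y : y \in K -> incl _ b * y \in K.
Proof.
case/lin_spanP => k [c [u [Xu ->]]]; rewrite mulr_sumr; apply: rpred_sum => i _.
have [a [b' [b0 ->]]] := Xu i; rewrite -scalerAr; apply: rpredZ.
apply: sub_lin_span; exists a, (b * b'); split.
  by rewrite /sym_aug rmorphM /= [b'@_0%MM]b0 mulr0.
by rewrite -[sym_incl _ (_ * _)]/(incl _ (b * b')) sym_mapM mulrCA.
Qed.

(** For a product x p, split x into [low x] and its part in b. The part in b times the
    representative of p lies in S(n^-)S_+(b) by definition; all other terms are multiples of p minus
    its representative, and the subspace is stable under S(n^-) and S(b). *)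
Lemma sub_sym_proj (y : Ssp) : y - incl _ (pi y) \in K.
Proof.
elim/sym_indX: y => [|c p q Ep Eq|i p Ep].
- by rewrite !sym_map1 subrr rpred0.
- rewrite [pi (_ + _)]sym_mapP [incl _ (_ + _)]sym_mapP opprD addrACA -scalerBr.
  exact: rpredD (rpredZ c Ep) Eq.
have bi := vbasis_nth_mem i.
set x := _`_i in bi *; have lx := low_nminus bi; have bx := sub_low_borel bi.
rewrite !sym_mapM sym_map_gen // [incl _ (sym_gen _ _)]sym_map_gen //=.
rewrite -[x in sym_gen _ x * p](subrK (low x)) linearD /= mulrDl -addrA -mulrBr.
have -> : sym_gen (sp F n) (low x) = incl _ (sym_gen (nminus F n) (low x)) by rewrite sym_map_gen.
have -> : sym_gen (sp F n) (x - low x) = incl _ (sym_gen (borel F n) (x - low x)) by rewrite sym_map_gen.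
rewrite rpredD ?SnSb_mull // -[p](subrK (incl _ (pi p))) mulrDr rpredD //.
  exact: SnSb_mulr.
apply: sub_lin_span; exists (pi p), (sym_gen (borel F n) (x - low x)).
split; last by rewrite mulrC.
rewrite /sym_aug /sym_gen linear_sum /= big1 // => j _.
by rewrite mcoeffZ mcoeffX mnm1_eq0 mulr0.
Qed.

(* Modulo S(n^-)S_+(b) every element of S(g) has a unique representative in
   S(n^-), so that the relation circ is the graph of a derivation. *)
Lemma circE e p q : e \in nplus F n -> circ e p q <-> q = circ_der e p.
Proof.
move=> /nplus_sp esp; rewrite /circ !sym_inclE -(sym_proj_der p esp); split=> [|->].
  by move=> /sym_proj_SnSb /eqP; rewrite linearB subr_eq0 /= sym_proj_incl => /eqP.
exact: sub_sym_proj.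
Qed.

End SpMatrices.

(** * Coefficients of powers of the quadratic form *)

Lemma mcoeffXM (k : nat) (R : comNzRingType) (a : 'I_k) (p : {mpoly R[k]}) d :
  ('X_a * p)@_d = if (0 < d a)%N then p@_(d - U_(a)) else 0.
Proof.
rewrite mulrC; case: ifP => da.
  have dE : d = (U_(a) + (d - U_(a)))%MM.
    rewrite addmC submK //; apply/mnm_lepP => j.
    by rewrite mnm1E; case: eqP => // <-.
  by rewrite [in LHS]dE mcoeffMX.
rewrite mcoeffM big1 // => -[k1 k2] /= /eqP dE.
rewrite mcoeffX; case: eqP => [k2E|_]; last by rewrite mulr0.
have /eqP := congr1 (fun m : 'X_{1..k} => m a) dE.
by rewrite mnmDE -k2E mnm1E eqxx addn1 => /eqP da0; rewrite da0 in da.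
Qed.

Section QuadraticForm.
Variables (F : fieldType) (k : nat) (S : comAlgType F).
Variable Z : 'I_k -> 'I_k -> S.
Local Notation I := 'I_k.
Local Notation SX := {mpoly S[k]}.

Definition quad : SX := \sum_a \sum_b Z a b *: ('X_a * 'X_b).

(* The vector field on F^2n given by e acts on S[x_1, ..., x_2n]. *)
Definition fieldE (e : 'M[F]_k) (p : SX) : SX :=
  \sum_c \sum_a (e c a)%:A *: ('X_a * p^`M(c)).

Lemma fieldED e p q : fieldE e (p + q) = fieldE e p + fieldE e q.
Proof.
rewrite /fieldE -big_split; apply: eq_bigr => c _; rewrite -big_split.
by apply: eq_bigr => a _; rewrite /= mderivD mulrDr scalerDr.
Qed.

Lemma fieldEZ e (s : S) p : fieldE e (s *: p) = s *: fieldE e p.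
Proof.
rewrite /fieldE scaler_sumr; apply: eq_bigr => c _; rewrite scaler_sumr.
by apply: eq_bigr => a _; rewrite /= mderivZ -scalerAr !scalerA mulrC.
Qed.

Lemma fieldE0 e : fieldE e 0 = 0.
Proof. by rewrite -[0](scale0r 0) fieldEZ !scale0r. Qed.

Lemma fieldE_sum e (T : Type) (r : seq T) P (f : T -> SX) :
  fieldE e (\sum_(i <- r | P i) f i) = \sum_(i <- r | P i) fieldE e (f i).
Proof. exact: (big_morph _ (fieldED e) (fieldE0 e)). Qed.

Lemma fieldEM e p q : fieldE e (p * q) = fieldE e p * q + p * fieldE e q.
Proof.
rewrite /fieldE mulr_suml mulr_sumr -big_split; apply: eq_bigr => c _.
rewrite mulr_suml mulr_sumr -big_split; apply: eq_bigr => a _ /=.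
rewrite mderivM mulrDr scalerDr -!scalerAl -!scalerAr; congr (_ *: _ + _ *: _).
  by rewrite mulrA.
by rewrite mulrCA.
Qed.

Lemma fieldEX e (a : I) : fieldE e 'X_a = \sum_b (e a b)%:A *: 'X_b.
Proof.
rewrite /fieldE (bigD1 a) //= [X in _ + X]big1 ?addr0 => [|c ca].
  apply: eq_bigr => b _; rewrite mderivX mnm1E eqxx scale1r.
  by rewrite -[X in (X - _)%MM]add0m addmK mpolyX0 mulr1.
by rewrite big1 // => b _; rewrite mderivX mnm1E eq_sym (negPf ca) scale0r mulr0 scaler0.
Qed.

Section Derivation.
Variables (e : 'M[F]_k) (D : {linear S -> S}).
Hypothesis D1 : D 1 = 0.
Hypothesis DM : forall p q, D (p * q) = D p * q + p * D q.
Hypothesis DZ : forall a b,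
  D (Z a b) = \sum_c e c a *: Z c b + \sum_c e c b *: Z a c.

Definition equivariant (p : SX) := forall d, D p@_d = (fieldE e p)@_d.

Lemma equivariantM p q : equivariant p -> equivariant q -> equivariant (p * q).
Proof.
move=> Ep Eq d; rewrite fieldEM mcoeffD !mcoeffM linear_sum -big_split /=.
by apply: eq_bigr => m _; rewrite DM Ep Eq.
Qed.

Lemma equivariant1 : equivariant 1.
Proof.
move=> d; rewrite mcoeff1 /fieldE !big1 ?mcoeff0 => [|c _]; last first.
  by rewrite big1 // => a _; rewrite -mpolyC1 mderivC mulr0 scaler0.
by case: (d == _); rewrite ?linear0 // D1.
Qed.

(** Q is a pairing between the Z's and the quadratic monomials in x. Exchanging the names of
    summation indices carries the matrix e from the Z side to the x side. *)
Lemma equivariant_quad : equivariant quad.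
Proof.
move=> d; rewrite /quad fieldE_sum.
have -> : \sum_a fieldE e (\sum_b Z a b *: ('X_a * 'X_b)) =
  \sum_a \sum_b (D (Z a b)) *: ('X_a * 'X_b).
  under eq_bigr => a _.
    rewrite fieldE_sum; under eq_bigr => b _ do
      rewrite fieldEZ fieldEM !fieldEX mulr_suml mulr_sumr scalerDr !scaler_sumr.
    rewrite big_split /=; over.
  under [RHS]eq_bigr => a _.
    under eq_bigr => b _ do rewrite DZ scalerDl !scaler_suml.
    rewrite big_split /=; over.
  rewrite !big_split /=; congr (_ + _).
    under [LHS]eq_bigr => a _ do rewrite exchange_big /=.
    rewrite exchange_big /=; under [RHS]eq_bigr => a _ do rewrite exchange_big /=.
    apply: eq_bigr => a _; apply: eq_bigr => b _; apply: eq_bigr => c _.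
    by rewrite -scalerAl scalerA -scalerAr mulr1.
  apply: eq_bigr => a _; rewrite exchange_big /=.
  apply: eq_bigr => b _; apply: eq_bigr => c _.
  by rewrite -scalerAr scalerA -scalerAr mulr1.
rewrite !raddf_sum; apply: eq_bigr => a _; rewrite !raddf_sum; apply: eq_bigr => b _.
rewrite /= !mcoeffZ -mpolyXD mcoeffX; case: (_ == d); rewrite ?mulr1 ?mulr0 //.
exact: linear0.
Qed.

Lemma equivariant_quadX N : equivariant (quad ^+ N).
Proof.
elim: N => [|N IH]; first by rewrite expr0; apply: equivariant1.
by rewrite exprS; apply: equivariantM => //; apply: equivariant_quad.
Qed.

(** The term x_a d/dx_c of the vector field, read on coefficients, removes one unit of the exponent
    at a and adds one at c; the multiplicity is the factor produced by d/dx_c. *)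
Lemma der_move N d :
  D ((quad ^+ N)@_d) = \sum_c \sum_a (e c a) *:
    (if (0 < d a)%N then (quad ^+ N)@_(d - U_(a) + U_(c)) *+ ((d - U_(a))%MM c).+1 else 0).
Proof.
rewrite equivariant_quadX /fieldE raddf_sum; apply: eq_bigr => c _.
rewrite raddf_sum; apply: eq_bigr => a _; rewrite /= mcoeffZ -scalerAl mul1r.
by rewrite mcoeffXM mcoeff_deriv.
Qed.

End Derivation.

Definition mono (s : seq (I * I)) : S := \prod_(x <- s) Z x.1 x.2.
Definition content (s : seq (I * I)) : 'X_{1..k} :=
  (\sum_(x <- s) (U_(x.1) + U_(x.2)))%MM.

Lemma quadX_coef N d :
  (quad ^+ N)@_d = \sum_(t : N.-tuple (I * I) | content t == d) mono t.
Proof.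
have -> : quad ^+ N = \sum_(t : N.-tuple (I * I)) mono t *: 'X_[content t].
  have qE : quad = \sum_(x : I * I) Z x.1 x.2 *: 'X_[U_(x.1) + U_(x.2)].
    by rewrite /quad pair_big; apply: eq_bigr => -[a b] _; rewrite /= mpolyXD.
  rewrite -{1}(card_ord N) -prodr_const qE bigA_distr_bigA /=.
  rewrite (reindex (fun t : N.-tuple (I * I) => [ffun i => tnth t i])) /=; last first.
    exists (fun f => [tuple f i | i < N]) => [t _|f _].
      by apply: eq_from_tnth => i; rewrite tnth_mktuple ffunE.
    by apply/ffunP => i; rewrite ffunE tnth_mktuple.
  apply: eq_bigr => t _; rewrite /mono /content !big_tuple.
  rewrite (big_morph (fun m => 'X_[S, m]) (@mpolyXD _ _) (mpolyX0 _ _)).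
  under eq_bigr => i _ do rewrite ffunE.
  by rewrite scaler_prod.
rewrite raddf_sum [RHS]big_mkcond; apply: eq_bigr => t _ /=.
by rewrite mcoeffZ mcoeffX; case: (_ == d); rewrite ?mulr1 ?mulr0.
Qed.

End QuadraticForm.

Section SpQuadratic.
Variables (F : numFieldType) (n : nat).
Local Notation I := 'I_(n + n).
Local Notation Snm := (Sym (nminus F n)).

Definition Zg (a b : I) : Snm :=
  if (n + n <= a + b)%N then sym_gen (nminus F n) (zm F a b) else 0.

Lemma ZgC a b : Zg a b = Zg b a.
Proof. by rewrite /Zg addnC zmC. Qed.

Lemma sym_gen_low_zm a b : sym_gen (nminus F n) (low (zm F a b)) = Zg a b.
Proof. by rewrite low_zm /Zg; case: ifP => // _; rewrite linear0. Qed.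

(** The convention that [Zg] is 0 outside n^- is compatible with n^+: e is strictly upper
    triangular, so it only lowers indices, and a pair with a + b < 2n stays below 2n. *)
Lemma circ_der_Zg e a b : e \in nplus F n ->
  circ_der e (Zg a b) = \sum_c e c a *: Zg c b + \sum_c e c b *: Zg a c.
Proof.
move=> en; have esp := nplus_sp en.
have /sp_suppP[_ e0] := en.
rewrite {1}/Zg; case: ifPn => [ab|].
  rewrite /circ_der sym_der_gen ?zm_nminus //= lie_br_zm // linearD !linear_sum /=.
  rewrite linearD !linear_sum; congr (_ + _); apply: eq_bigr => c _;
  by rewrite !linearZ /= sym_gen_low_zm.
rewrite -ltnNge => ab; rewrite linear0 !big1 ?addr0 // => c _.
  have [cb|cb] := ltnP c b; last by rewrite e0 -?leqNgt ?scale0r.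
  by rewrite /Zg leqNgt (leq_trans _ ab) ?scaler0 // ltnS leq_add2l ltnW.
have [cb|cb] := ltnP c a; last by rewrite e0 -?leqNgt ?scale0r.
by rewrite /Zg leqNgt (leq_trans _ ab) ?scaler0 // ltnS leq_add2r ltnW.
Qed.

Lemma circ_derM e p q : circ_der e (p * q) = circ_der e p * q + p * circ_der e q :> Snm.
Proof. exact: sym_derM. Qed.

End SpQuadratic.

Local Close Scope ring_scope.

(** * Nested pairings *)

Lemma perm_swap2 (T : eqType) (a b : T) r : perm_eq [:: a, b & r] [:: b, a & r].
Proof. exact/permPl/(perm_catCA [:: a] [:: b]). Qed.

(** Uncrossing inequality: a u + b w - a b - u w = (w - a)(b - u), which is positive under these
    hypotheses. *)
Lemma uncross (a b u w X Y : nat) : u != b -> w != a ->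
  a <= u <= b -> a <= w <= b -> X <= u * w + Y -> a * b + X < a * u + (b * w + Y).
Proof. nia. Qed.

Section Pairings.
Variable K : nat.
Local Notation I := 'I_K.
Implicit Types (x y : I * I) (s t : seq (I * I)).

Definition nrm x : I * I := if (x.1 <= x.2)%N then x else (x.2, x.1).
Definition flat s : seq I := flatten [seq [:: x.1; x.2] | x <- s].
Definition qval s : nat := \sum_(x <- s) x.1 * x.2.
Definition nest x y := (x.1 <= y.1) && (y.2 <= x.2).
Definition nested x y := nest x y || nest y x.

Lemma nrmC a b : nrm (b, a) = nrm (a, b).
Proof. by rewrite /nrm /=; case: (ltngtP a b) => // /ord_inj ->. Qed.

Lemma perm_flat s t : perm_eq s t -> perm_eq (flat s) (flat t).
Proof. by move=> st; apply: perm_flatten; apply: perm_map. Qed.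

Lemma qval_perm s t : perm_eq s t -> qval s = qval t.
Proof. exact: perm_big. Qed.

Lemma qval_nrm s : qval (map nrm s) = qval s.
Proof.
rewrite /qval big_map; apply: eq_bigr => x _.
by rewrite /nrm; case: ifP => // _; rewrite mulnC.
Qed.

Lemma mem_flatP a s : reflect (exists2 x : I * I, x \in s & (a == x.1) || (a == x.2)) (a \in flat s).
Proof.
apply: (iffP flatten_mapP) => -[x xs ax]; exists x => //.
  by move: ax; rewrite !inE.
by rewrite !inE.
Qed.

(** Any minimiser of x.1 + (K - x.2) works: a pair that strictly encloses it would have a smaller
    value, and nestedness makes all pairs comparable. *)
Lemma nested_outermost s : s != [::] -> all2rel nested s ->
  exists2 x : I * I, x \in s & forall y : I * I, y \in s -> nest x y.
Proof.
case: s => // x0 s _ /allrelP nes; pose f x := x.1 + (K - x.2).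
have /= [x xs xmin] : exists2 x : I * I, x \in x0 :: s & forall y : I * I, y \in x0 :: s -> f x <= f y.
  elim: s x0 {nes} => [|y s IH] x0.
    by exists x0 => [|y]; rewrite ?inE // => /eqP->.
  have [x xs xmin] := IH y; case: (leqP (f x) (f x0)) => le.
    by exists x => [|z]; rewrite inE ?xs ?orbT // => /predU1P[->|/xmin].
  exists x0 => [|z]; rewrite inE ?eqxx // => /predU1P[->|/xmin] //.
  by apply: leq_trans; apply: ltnW.
exists x => // y ys; have := nes _ _ xs ys; have := xmin _ ys.
rewrite /nested /nest /f; have := ltn_ord x.2; have := ltn_ord y.2.
by move: (nat_of_ord x.1) (nat_of_ord x.2) (nat_of_ord y.1) (nat_of_ord y.2); lia.
Qed.

(** Induction on s by removing its outermost pair x, whose ends are the least and the greatest index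
    present. If t contains x, it is removed from both sides. Otherwise x.1 and x.2 have other
    partners u and w in t, and reconnecting them strictly lowers [qval], so equality is excluded. *)
Lemma nested_min s t : all (fun x => x.1 <= x.2) s -> all2rel nested s ->
  perm_eq (flat s) (flat t) ->
  qval s <= qval t /\ (qval t <= qval s -> perm_eq (map nrm t) s).
Proof.
have [k le_sk] := ubnP (size s); elim: k s t le_sk => // k IH s t le_sk sn snest st.
have [s0|s_neq0] := eqVneq s [::].
  move: st; rewrite s0; case: t => [|x t] /perm_size //=.
have [x xs xout] := nested_outermost s_neq0 snest.
have bnd (a : I) : a \in flat s -> x.1 <= a <= x.2.
  case/mem_flatP => y ys ay; have /andP[] := xout y ys.
  have := allP sn y ys => /=; have := allP sn x xs => /=.
  by case/orP: ay => /eqP ->; lia.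
have sE := perm_to_rem xs; set s' := rem x s in sE.
have sz : size s' < k by have := perm_size sE; move=> /= E; rewrite E in le_sk.
have ss' : {subset s' <= s} by move=> y; apply: mem_rem.
have sn' : all (fun x => x.1 <= x.2) s' by apply/allP => y /ss' /(allP sn).
have snest' : all2rel nested s'.
  by apply/allrelP => y z /ss' ys /ss' zs; apply: (allrelP snest).
have x12 := allP sn x xs.
have QsE : qval s = x.1 * x.2 + qval s' by rewrite (qval_perm sE) /qval big_cons.
have fsE := perm_flat sE.
have nrmx : nrm x = x by rewrite /nrm x12.
have [/hasP[y yt /eqP yx]|/hasPn no] := boolP (has (fun y => nrm y == x) t).
  have tE := perm_to_rem yt; set t' := rem y t in tE.
  have st' : perm_eq (flat s') (flat t').
    have fyx : perm_eq (flat (x :: t')) (flat (y :: t')).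
      by rewrite -yx /flat /= /nrm; case: ifP => // _; apply: perm_swap2.
    have := perm_trans (perm_trans _ st) (perm_flat tE).
    move=> /(_ (flat (x :: s'))); rewrite perm_sym fsE => /(_ isT).
    rewrite -(permPr fyx) /flat /= -/(flat s') -/(flat t').
    by rewrite !perm_cons.
  have [le eq] := IH s' t' sz sn' snest' st'.
  have QtE : qval t = x.1 * x.2 + qval t'.
    by rewrite (qval_perm tE) -qval_nrm /= /qval big_cons yx -/(qval _) qval_nrm.
  rewrite QsE QtE !leq_add2l; split=> // /eq tE'.
  rewrite (permPl (perm_map nrm tE)) (permPr sE) /= yx perm_cons //.
have x1t : x.1 \in flat t by rewrite -(perm_mem st); apply/mem_flatP; exists x; rewrite ?eqxx.
have x2t : x.2 \in flat t by rewrite -(perm_mem st); apply/mem_flatP; exists x; rewrite ?eqxx ?orbT.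
have flat1 (y : I * I) u r : (u == y.1) || (u == y.2) ->
    exists w, [/\ perm_eq (flat (y :: r)) (u :: w :: flat r), (y.1 * y.2 = u * w)%N & nrm (u, w) = nrm y].
  case: y => c d /orP[] /= /eqP->; first by exists d.
  exists c; split; [exact: perm_swap2 | by rewrite mulnC |].
  exact: nrmC.
case/mem_flatP: (x1t) => p pt xp.
have tE := perm_to_rem pt; set t' := rem p t in tE.
have [u [fu pu nu]] := flat1 p x.1 t' xp.
have ux2 : u != x.2.
  have := no p pt; rewrite -nu; apply: contraNneq => ->.
  by rewrite -surjective_pairing nrmx.
(* The delicate case is x.1 = x.2: all indices then coincide because of [bnd], which would force u =
   x.2. *)
have x2t' : x.2 \in flat t'.
  move: x2t; rewrite (perm_mem (perm_trans (perm_flat tE) fu)) !inE [x.2 == u]eq_sym (negPf ux2).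
  case/predU1P => // x21; case/eqP: ux2; apply/val_inj => /=.
  have := bnd u; rewrite (perm_mem st) (perm_mem (perm_trans (perm_flat tE) fu)) !inE eqxx orbT.
  by move=> /(_ isT); rewrite x21 -eqn_leq eq_sym => /eqP.
case/mem_flatP: x2t' => q qt' xq.
have tE' := perm_to_rem qt'; set t'' := rem q t' in tE'.
have [w [fw qw nw]] := flat1 q x.2 t'' xq.
have wx1 : w != x.1.
  have /no : q \in t by apply: mem_rem qt'.
  by rewrite -nw; apply: contraNneq => ->; rewrite nrmC -surjective_pairing nrmx.
have ft : perm_eq (flat t) [:: x.1, u, x.2, w & flat t''].
  apply: (perm_trans (perm_flat tE)); apply: (perm_trans fu).
  rewrite 2!perm_cons; apply: (perm_trans (perm_flat tE')) fw.
(* The two pairs of t through x.1 and x.2 are reconnected as x and (u, w). After cancelling x, the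
   induction hypothesis compares s' with the remainder. *)
have st'' : perm_eq (flat s') (flat ((u, w) :: t'')).
  have := perm_trans _ (perm_trans st ft); move=> /(_ (flat (x :: s'))).
  rewrite perm_sym fsE => /(_ isT).
  rewrite /flat /= -/(flat s') -/(flat t'') perm_cons.
  by rewrite (permPr (perm_swap2 u x.2 _)) perm_cons.
have [le _] := IH s' _ sz sn' snest' st''.
have lt : qval s < qval t.
  have -> : qval t = x.1 * u + (x.2 * w + qval t'').
    rewrite (qval_perm tE) /qval big_cons pu -/(qval t').
    by rewrite (qval_perm tE') /qval big_cons qw.
  move: le; rewrite QsE /qval big_cons /= -/(qval t'') -/(qval s').
  have : x.1 <= w <= x.2 by apply: bnd; rewrite (perm_mem st) (perm_mem ft) !inE eqxx !orbT.
  have : x.1 <= u <= x.2 by apply: bnd; rewrite (perm_mem st) (perm_mem ft) !inE eqxx !orbT.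
  by move: ux2 wx1; rewrite -!val_eqE /=; apply: uncross.
by split; [apply: ltnW | rewrite leqNgt lt].
Qed.

End Pairings.

Local Open Scope ring_scope.

Section Content.
Variable K : nat.
Local Notation I := 'I_K.
Implicit Types s t : seq (I * I).

Lemma content_cons x s : content (x :: s) = (U_(x.1) + U_(x.2) + content s)%MM.
Proof. by rewrite /content big_cons. Qed.

Lemma contentE s a : content s a = count_mem a (flat s).
Proof.
elim: s => [|x s IH]; first by rewrite /content big_nil mnm0E.
by rewrite content_cons !mnmDE !mnm1E IH /= addnA.
Qed.

Lemma content_perm s t : content s = content t -> perm_eq (flat s) (flat t).
Proof.
by move=> E; apply/allP => a _; apply/eqP; rewrite /= -!contentE E.
Qed.

Lemma content_gt0 s a : (0 < content s a)%N = (a \in flat s).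
Proof. by rewrite contentE -has_count has_pred1. Qed.

Lemma content_mem1 s (x : I * I) : x \in s -> (0 < content s x.1)%N.
Proof. by move=> xs; rewrite content_gt0; apply/mem_flatP; exists x; rewrite ?eqxx. Qed.
Lemma content_mem2 s (x : I * I) : x \in s -> (0 < content s x.2)%N.
Proof. by move=> xs; rewrite content_gt0; apply/mem_flatP; exists x; rewrite ?eqxx ?orbT. Qed.

Definition partial_deg (P : pred I) (d : 'X_{1..K}) : nat := \sum_(a | P a) d a.

Lemma partial_degD (P : pred I) d1 d2 : partial_deg P (d1 + d2)%MM = (partial_deg P d1 + partial_deg P d2)%N.
Proof. by rewrite -big_split; apply: eq_bigr => a _; rewrite mnmDE. Qed.

Lemma partial_deg1 (P : pred I) a : partial_deg P U_(a)%MM = P a :> nat.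
Proof.
rewrite /partial_deg; case: (boolP (P a)) => Pa.
  rewrite (bigD1 a) //= mnm1E eqxx big1 ?addn0 // => b /andP[_ ba].
  by rewrite mnm1E eq_sym (negPf ba).
by rewrite big1 // => b Pb; rewrite mnm1E; case: eqP => // ab; rewrite ab Pb in Pa.
Qed.

Lemma partial_deg_content (P : pred I) s :
  partial_deg P (content s) = (\sum_(x <- s) (P x.1 + P x.2))%N.
Proof.
elim: s => [|x s IH]; first by rewrite /content !big_nil /partial_deg big1 // => a; rewrite mnm0E.
by rewrite content_cons !partial_degD !partial_deg1 big_cons IH.
Qed.

End Content.

Lemma sum_ge_size_eq1 (T : eqType) (s : seq T) (f : T -> nat) :
  (forall x, x \in s -> 0 < f x)%N -> (\sum_(x <- s) f x = size s)%N ->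
  forall x, x \in s -> f x = 1%N.
Proof.
elim: s => // y s IH f0; rewrite big_cons /= => E.
have s0 x : x \in s -> (0 < f x)%N by move=> xs; apply: f0; rewrite inE xs orbT.
have le : (size s <= \sum_(x <- s) f x)%N.
  elim: s s0 {IH f0 E} => // z s IH s0; rewrite big_cons /= -add1n leq_add ?s0 ?mem_head //.
  by apply: IH => x xs; apply: s0; rewrite inE xs orbT.
have y1 := f0 y (mem_head _ _).
by move=> x; rewrite inE => /predU1P[->|]; [|apply: IH => //]; lia.
Qed.

(** * Moving indices of coefficients of Q^N by n^+ *)

Section Ucirc.
Variables (F : numFieldType) (n : nat).
Local Notation I := 'I_(n + n).
Local Notation Snm := (Sym (nminus F n)).
Variable G : Snm -> Prop.
Local Notation Z := (@Zg F n).
Local Notation PP N d := ((quad Z ^+ N)@_d).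
Local Notation U := (lin_span (circ_word G)).
Implicit Types d : 'X_{1..n + n}.

Lemma U_circ_der e p : e \in nplus F n -> p \in U -> circ_der e p \in U.
Proof.
move=> en /lin_spanP[k [c [u [Xu ->]]]]; rewrite linear_sum.
apply: rpred_sum => i _; rewrite linearZ; apply: rpredZ; apply: sub_lin_span.
by apply: (CircCons en (Xu i)); apply/circE.
Qed.

Lemma mono_disallowed (s : seq (I * I)) (x : I * I) : x \in s -> (x.1 + x.2 < n + n)%N -> mono Z s = 0.
Proof. by move=> xs lt; rewrite /mono (big_rem x) //= /Zg leqNgt lt mul0r. Qed.

Lemma quadX_coef0 N d :
  (forall s : seq (I * I), size s = N -> content s = d ->
     (forall x : I * I, x \in s -> n + n <= x.1 + x.2)%N -> False) -> PP N d = 0.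
Proof.
move=> no; rewrite quadX_coef big1 // => t /eqP td.
have [/allP al|/allPn[x xt]] := boolP (all (fun x : I * I => n + n <= x.1 + x.2)%N t).
  by case: (no t); rewrite ?size_tuple.
by rewrite -ltnNge; apply: mono_disallowed.
Qed.

Lemma quadX_coefU N d :
  (forall s : seq (I * I), size s = N -> content s = d ->
     (forall x : I * I, x \in s -> n + n <= x.1 + x.2)%N -> mono Z s \in U) -> PP N d \in U.
Proof.
move=> no; rewrite quadX_coef; apply: rpred_sum => t /eqP td.
have [/allP al|/allPn[x xt]] := boolP (all (fun x : I * I => n + n <= x.1 + x.2)%N t).
  by apply: no; rewrite ?size_tuple.
by rewrite -ltnNge => lt; rewrite (mono_disallowed xt lt) rpred0.
Qed.

(** The element e = [zm F a (rev_ord t)] has exactly the entries (a, t) and (rev t, rev a). The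
    first moves t to a with the nonzero factor d a + 1, giving the wanted coefficient; the second
    moves rev a to rev t, and the last hypothesis disposes of it. *)
Lemma quadX_coef_move N d (a t : I) : (a < t)%N -> a != rev_ord t ->
  PP N (d + U_(t))%MM \in U ->
  (forall d', (d + U_(t))%MM = (d' + U_(rev_ord a))%MM -> PP N (d' + U_(rev_ord t))%MM = 0) ->
  PP N (d + U_(a))%MM \in U.
Proof.
move=> at_ art PU PV; pose e := zm F a (rev_ord t).
have en : e \in nplus F n by apply: zm_nplus => /=; have := ltn_ord t; lia.
have {PU} := U_circ_der en PU.
rewrite (@der_move _ _ _ Z e (circ_der e)) //; last 3 first.
- exact: sym_der1.
- exact: circ_derM.
- by move=> x y; apply: circ_der_Zg.
rewrite pair_big (bigD1 (a, t)) //= big1 => [|[c b] cb /=].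
  rewrite addr0 mnmDE mnm1E eqxx addn1 ltnS leq0n addmK.
  have nz : e a t * ((d a).+1)%:R != 0.
    rewrite mulf_neq0 ?pnatr_eq0 // zmE eqxx (negPf art) mul0r mul1r addr0 oppr_eq0.
    by rewrite mxE rev_ordK eqxx; case: ifP; rewrite ?oppr_eq0 oner_eq0.
  rewrite -scaler_nat scalerA => /(rpredZ (e a t * ((d a).+1)%:R)^-1).
  by rewrite scalerA (mulVf nz) scale1r.
have [->|nz] := eqVneq (e c b) 0; first by rewrite scale0r.
case/zm_neq0/orP: nz => /andP[/eqP cE /eqP bE]; first by rewrite cE bE rev_ordK eqxx in cb.
rewrite {}cE {}bE; case: ifP; rewrite ?scaler0 // => d0.
rewrite PV ?mul0rn ?scaler0 // submK //; apply/mnm_lepP => j.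
by rewrite mnm1E; case: eqP => // <-.
Qed.

(** A partner of i would have to be at least 2n - i, hence above [rev_ord i], and the content
    contains no such index. *)
Lemma quadX_coef_low N d (i : I) : (0 < d i)%N ->
  (forall a, 0 < d a -> a <= rev_ord i)%N -> PP N d = 0.
Proof.
move=> di bnd; apply: quadX_coef0 => s _ sd al.
move: di; rewrite -sd content_gt0 => /mem_flatP[x xs].
have := bnd x.1; have := bnd x.2; rewrite -sd content_mem1 // content_mem2 //.
have := al _ xs; have := ltn_ord i => /= ? ? /(_ isT) ? /(_ isT) ?.
by case/orP => /eqP /(congr1 val) /=; lia.
Qed.

Local Notation hi := (partial_deg (fun a : I => n <= a)%N).

(** A pair with a + b >= 2n has at least one index >= n. A total of only one such index per pair on
    average forces exactly one in each. *)
Lemma one_high (s : seq (I * I)) : (forall x : I * I, x \in s -> n + n <= x.1 + x.2)%N ->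
  hi (content s) = size s ->
  forall x : I * I, x \in s -> ((n <= x.1) + (n <= x.2) = 1)%N.
Proof.
move=> al; rewrite partial_deg_content => E; apply: (sum_ge_size_eq1 _ E) => x /al.
by rewrite addn_gt0 !lt0b; case: (leqP n x.1); case: (leqP n x.2) => //=; lia.
Qed.

(** Having N high indices forces every pair to join a high index to a low one, and no low index
    present is large enough to be the partner of b. *)
Lemma quadX_coef_high N d (b : I) : (0 < d b)%N -> (n <= b)%N -> hi d = N ->
  (forall a, 0 < d a -> a < n -> a + b < n + n)%N -> PP N d = 0.
Proof.
move=> db nb hid bnd; apply: quadX_coef0 => s sN sd al.
move: db; rewrite -sd content_gt0 => /mem_flatP[x xs].
have := bnd x.1; have := bnd x.2; rewrite -sd content_mem1 // content_mem2 //.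
have := one_high al _ xs; rewrite sd hid sN => /(_ erefl).
have := al _ xs.
case: (ltnP x.1 n) => h1; case: (ltnP x.2 n) => h2 a12 // _ /(_ isT) b2 /(_ isT) b1.
  by case/orP => /eqP /(congr1 val) /= bE; have := b1 isT; lia.
by case/orP => /eqP /(congr1 val) /= bE; have := b2 isT; lia.
Qed.

Lemma mono_const (s : seq (I * I)) z : (forall x : I * I, x \in s -> Z x.1 x.2 = z) ->
  mono Z s = z ^+ size s.
Proof.
move=> E; rewrite /mono big_seq; under eq_bigr => x xs do rewrite E //.
by rewrite -big_seq big_const_seq count_predT iter_mulr_1.
Qed.

Lemma mnm_sub1 d a : (0 < d a)%N -> exists d', d = (d' + U_(a))%MM.
Proof.
move=> da; exists (d - U_(a))%MM; rewrite submK //; apply/mnm_lepP => j.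
by rewrite mnm1E; case: eqP => // <-.
Qed.

(** Induction on the number of units of d away from t = rev i. Moving one unit from t to a reaches
    d; the spurious term creates the index rev t = i, which has no partner because all indices are
    at most t. When d is concentrated at t, the only possible monomial is a power of Z_tt. *)
Lemma quadX_coef_long N (i : I) : (i < n)%N ->
  Z (rev_ord i) (rev_ord i) ^+ N \in U ->
  forall d, (forall a, 0 < d a -> i < a <= rev_ord i)%N -> PP N d \in U.
Proof.
move=> ltin ZU d; set t := rev_ord i in ZU *.
have [k] := ubnP (partial_deg (predC1 t) d); elim: k d => // k IH d le_dk bnd.
have [/existsP[a /andP[at_ da]]|/existsPn no] := boolP [exists a, (a != t) && (0 < d a)%N].
  have /andP[ia ati] := bnd a da.
  have [d' dE] := mnm_sub1 da; rewrite dE.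
  have lt : (a < t)%N by move: at_; rewrite -val_eqE /=; move: ati => /=; lia.
  have bnd' c : (0 < (d' + U_(t))%MM c)%N -> (i < c <= t)%N.
    rewrite mnmDE mnm1E; case: (eqVneq t c) => [<- _|_]; first by lia.
    by rewrite addn0 => dc; apply: bnd; rewrite dE mnmDE addn_gt0 dc.
  apply: (quadX_coef_move lt); first by rewrite /t rev_ordK -val_eqE /=; lia.
    apply: IH => //; move: le_dk; rewrite dE !partial_degD !partial_deg1 /= at_ eqxx; lia.
  move=> d'' E; apply: (@quadX_coef_low _ _ i).
    by rewrite mnmDE /t rev_ordK mnm1E eqxx addn1.
  move=> c; rewrite mnmDE /t rev_ordK mnm1E; case: (eqVneq i c) => [<- _|_] /=; first by lia.
  rewrite addn0 => dc; have := bnd' c; rewrite E mnmDE addn_gt0 dc => /(_ isT) /andP[_].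
  by [].
apply: quadX_coefU => s sN sd al; rewrite (@mono_const _ (Z t t)) ?sN // => x xs.
have := no x.1; rewrite -sd content_mem1 // andbT negbK => /eqP ->.
by have := no x.2; rewrite -sd content_mem2 // andbT negbK => /eqP ->.
Qed.

(** Units move one at a time away from the extremal indices t = rev i and l. For a high unit the
    spurious term contains i and vanishes as in the long case. For a low unit it contains rev l; the
    low indices are at most l, so rev l has no low partner, and [hi d = N] leaves no other. *)
Lemma quadX_coef_short N (i l : I) : (i < l < n)%N ->
  Z l (rev_ord i) ^+ N \in U ->
  forall d, (forall a, 0 < d a -> (i < a <= l) || (rev_ord l < a <= rev_ord i))%N ->
  hi d = N -> PP N d \in U.
Proof.
move=> /andP[il ltln] ZU d; set t := rev_ord i in ZU *.
have tE : t = (n + n - i.+1)%N :> nat by [].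
have rlE : rev_ord l = (n + n - l.+1)%N :> nat by [].
have [k] := ubnP (partial_deg [pred a | (a != t) && (a != l)] d).
elim: k d => // k IH d le_dk bnd hid.
have [/existsP[a /and3P[at_ da al]]|/existsPn no1] := boolP [exists a, [&& a != t, (0 < d a)%N & (n <= a)%N]].
  have [d' dE] := mnm_sub1 da; have := bnd a da => ba; rewrite dE.
  have lt : (a < t)%N by move: at_; rewrite -val_eqE /=; lia.
  have bnd' c : (0 < (d' + U_(t))%MM c)%N -> ((i < c <= l) || (rev_ord l < c <= t))%N.
    rewrite mnmDE mnm1E; case: (eqVneq t c) => [<- _|_]; first by lia.
    by rewrite addn0 => dc; apply: bnd; rewrite dE mnmDE addn_gt0 dc.
  apply: (quadX_coef_move lt); first by rewrite /t rev_ordK -val_eqE /=; lia.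
    apply: IH => //.
      by move: le_dk; rewrite dE !partial_degD !partial_deg1 /= at_ eqxx -val_eqE /=; lia.
    by move: hid; rewrite dE !partial_degD !partial_deg1; lia.
  move=> d'' E; apply: (@quadX_coef_low _ _ i).
    by rewrite mnmDE /t rev_ordK mnm1E eqxx addn1.
  move=> c; rewrite mnmDE /t rev_ordK mnm1E; case: (eqVneq i c) => [<- _|_]; first by move=> /=; lia.
  by rewrite addn0 => dc; have := bnd' c; rewrite E mnmDE addn_gt0 dc => /(_ isT) /=; lia.
have [/existsP[a /and3P[al da an]]|/existsPn no2] := boolP [exists a, [&& a != l, (0 < d a)%N & (a < n)%N]].
  have [d' dE] := mnm_sub1 da; have := bnd a da => ba; rewrite dE.
  have lt : (a < l)%N by move: al; rewrite -val_eqE /=; lia.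
  have bnd' c : (0 < (d' + U_(l))%MM c)%N -> ((i < c <= l) || (rev_ord l < c <= t))%N.
    rewrite mnmDE mnm1E; case: (eqVneq l c) => [<- _|_]; first by lia.
    by rewrite addn0 => dc; apply: bnd; rewrite dE mnmDE addn_gt0 dc.
  have hi' : hi (d' + U_(l))%MM = N.
    by move: hid; rewrite dE !partial_degD !partial_deg1; lia.
  apply: (quadX_coef_move lt); first by rewrite -val_eqE /=; lia.
    apply: IH => //.
    by move: le_dk; rewrite dE !partial_degD !partial_deg1 /= al eqxx andbF -val_eqE /=; lia.
  move=> d'' E; apply: (@quadX_coef_high _ _ (rev_ord l)).
  - by rewrite mnmDE mnm1E eqxx addn1.
  - by lia.
  - move: hi'; rewrite E !partial_degD !partial_deg1.
    have -> : (n <= rev_ord a)%N by move=> /=; lia.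
    by have -> : (n <= rev_ord l)%N by lia.
  move=> c; rewrite mnmDE mnm1E; case: (eqVneq (rev_ord l) c) => [<- _|_]; first by lia.
  by rewrite addn0 => dc; have := bnd' c; rewrite E mnmDE addn_gt0 dc => /(_ isT) /=; lia.
apply: quadX_coefU => s sN sd al; rewrite (@mono_const _ (Z l t)) ?sN // => x xs.
have := one_high al _ xs; rewrite sd hid sN => /(_ erefl).
have H (a : I) : (0 < d a)%N -> a = if (n <= a)%N then t else l.
  move=> da; have := no1 a; have := no2 a; rewrite da /= ltnNge.
  by case: leqP => _; rewrite ?andbT ?andbF /= ?negbK; [move=> _ /eqP | move=> /eqP].
have := H x.1; rewrite -sd content_mem1 // => /(_ isT).
have := H x.2; rewrite -sd content_mem2 // => /(_ isT).
by case: leqP => _ E2; case: leqP => _ E1 //= _; rewrite E1 E2 // ZgC.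
Qed.

End Ucirc.

(** * Straightening *)

Lemma subn_descent (b x y z : nat) :
  (b - x < z.+1 -> x < y -> y <= b -> b - y < z)%N.
Proof. lia. Qed.

Section Admissible.
Variables (n : nat) (m : 'I_n -> nat).
Local Notation I := 'I_(n + n).

Definition allowed (x : I * I) := (x.1 <= x.2)%N && (n + n <= x.1 + x.2)%N.

(** With indices from 0, alpha_{i,j} for j < n - 1 is the pair (j + 1, 2n - 1 - i), and alpha_{i,
    bar j} is (2n - 1 - j, 2n - 1 - i). The condition selects the roots met by Dyck paths that start
    at k and stop at j, the last value of j leaving the first entry free. *)
Definition within (k j : 'I_n) (c : seq (I * I)) :=
  all (fun x : I * I => k + x.2 < n + n)%N c && ((j.+1 < n)%N ==> all (fun x : I * I => x.1 <= j.+1)%N c).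

(* The exponents of the basis monomials: the sum of the exponents along a
   Dyck path is replaced by the size of a nested sub-multiset. *)
Definition adm (s : seq (I * I)) : Prop :=
  all allowed s /\
  forall c r (k j : 'I_n), perm_eq s (c ++ r) -> all2rel (@nested _) c ->
    (k <= j)%N -> within k j c -> (size c <= pairing m k j)%N.

Lemma allowed_nrm (x : I * I) : allowed (nrm x) = (n + n <= x.1 + x.2)%N.
Proof. by rewrite /allowed /nrm; case: (leqP x.1 x.2) => /= [->|lt] //; rewrite ltnW //= addnC. Qed.

End Admissible.

Section Straightening.
Variables (F : numFieldType) (n : nat) (m : 'I_n -> nat).
Local Notation I := 'I_(n + n).
Local Notation Snm := (Sym (nminus F n)).
Variable G : Snm -> Prop.
Local Notation Z := (@Zg F n).
Local Notation PP N d := ((quad Z ^+ N)@_d).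
Local Notation U := (lin_span (circ_word G)).
Local Notation Id := (ideal_gen (U_circ G)).
Implicit Types s t c r : seq (I * I).

Lemma ideal_genD p q : Id p -> Id q -> Id (p + q).
Proof.
move=> [k [a [g [Ug ->]]]] [l [b [h [Uh ->]]]]; exists (k + l)%N.
exists (fun i => match fintype.split i with inl j => a j | inr j => b j end).
exists (fun i => match fintype.split i with inl j => g j | inr j => h j end).
split=> [i|]; first by case: (fintype.split i).
rewrite big_split_ord /=; congr (_ + _); apply: eq_bigr => i _.
  by rewrite (unsplitK (inl i)).
by rewrite (unsplitK (inr i)).
Qed.

Lemma ideal_genM a p : Id p -> Id (a * p).
Proof.
move=> [k [b [g [Ug ->]]]]; exists k, (fun i => a * b i), g; split=> //.
by rewrite mulr_sumr; apply: eq_bigr => i _; rewrite mulrA.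
Qed.

Lemma ideal_gen0 : Id 0.
Proof. by exists 0%N, (fun=> 0), (fun=> 0); split=> [[]|] //; rewrite big_ord0. Qed.

Lemma ideal_gen_mem p : p \in U -> Id p.
Proof. by move=> Up; exists 1%N, (fun=> 1), (fun=> p); split=> //; rewrite big_ord1 mul1r. Qed.

Lemma mono_perm s t : perm_eq s t -> mono Z s = mono Z t.
Proof. exact: perm_big. Qed.

Lemma mono_cat s t : mono Z (s ++ t) = mono Z s * mono Z t.
Proof. by rewrite /mono big_cat. Qed.

Lemma mono_nrm s : mono Z (map (@nrm _) s) = mono Z s.
Proof.
by rewrite /mono big_map; apply: eq_bigr => x _; rewrite /nrm; case: ifP => // _; rewrite ZgC.
Qed.

(** By [nested_min] every tuple of this content whose [qval] does not exceed that of s is a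
    reordering of s. The multiplicity k counts these tuples and is invertible in characteristic
    zero. *)
Lemma quadX_coef_leading s : all (fun x : I * I => x.1 <= x.2)%N s -> all2rel (@nested _) s ->
  exists2 k, (0 < k)%N & PP (size s) (content s) = mono Z s *+ k +
    \sum_(t : (size s).-tuple (I * I) | (content t == content s) && (qval s < qval t)%N) mono Z t.
Proof.
move=> sn snest.
exists #|[pred t : (size s).-tuple (I * I) | (content t == content s) && ~~ (qval s < qval t)%N]|.
  by apply/card_gt0P; exists (in_tuple s); rewrite inE /= eqxx ltnn.
rewrite quadX_coef (bigID (fun t : (size s).-tuple _ => (qval s < qval t)%N)) /= addrC; congr (_ + _).
rewrite -sumr_const; apply: eq_bigr => t /andP[/eqP E]; rewrite -leqNgt => le.
have [_ /(_ le) /mono_perm <-] := nested_min sn snest (content_perm (esym E)).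
by rewrite mono_nrm.
Qed.

Lemma qval_bound s : (qval s <= size s * ((n + n) * (n + n)))%N.
Proof.
elim: s => [|x s IH]; first by rewrite /qval big_nil.
by rewrite /qval big_cons -/(qval s) /= mulSn leq_add // leq_mul // ltnW.
Qed.

Hypothesis Zshort : forall (i j : 'I_n) (l t : I), (i <= j)%N -> (j.+1 < n)%N ->
  l = j.+1 :> nat -> t = (n + n - i.+1)%N :> nat ->
  Z l t ^+ (pairing m i j).+1 \in U.
Hypothesis Zlong : forall (i : 'I_n) (t : I), t = (n + n - i.+1)%N :> nat ->
  Z t t ^+ (pairing m i n.-1).+1 \in U.

(** For j + 1 < n all first entries are low and all second entries high, so the content fits the
    short-root case; for j = n - 1 only the interval bounds of the long-root case remain. *)
Lemma quadX_coef_within c (k j : 'I_n) : all (@allowed n) c -> (k <= j)%N ->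
  within k j c -> size c = (pairing m k j).+1 -> PP (size c) (content c) \in U.
Proof.
move=> call kj /andP[/allP ck cj] sz; pose i : I := lshift n k.
have iE : i = k :> nat by [].
have bnd (a : I) : (0 < content c a)%N -> exists2 x : I * I,
    [/\ x.1 <= x.2, n + n <= x.1 + x.2 & k + x.2 < n + n]%N & x \in c /\ (a = x.1 \/ a = x.2).
  rewrite content_gt0 => /mem_flatP[x xc ax]; exists x.
    by have /andP[? ?] := allP call x xc; split=> //; apply: ck.
  by split=> //; case/orP: ax => /eqP; [left | right].
have [jn|jn] := ltnP j.+1 n.
  have ltj : (j.+1 < n + n)%N by lia.
  rewrite sz; apply: (@quadX_coef_short _ _ _ _ i (Ordinal ltj)) => /=.
  - by rewrite jn andbT; lia.
  - exact: Zshort.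
  - move=> a /bnd[x [x1 x2 x3] [xc ax]]; have := allP (implyP cj jn) x xc => /= x4.
    by have := ltn_ord k; case: ax => ->; lia.
  - have hi1 (x : I * I) : x \in c -> ((n <= x.1) + (n <= x.2) = 1)%N.
      move=> xc; have /andP[_ al] := allP call x xc; have /= x1 := allP (implyP cj jn) x xc.
      have -> : (n <= x.1)%N = false by apply/negbTE; rewrite -ltnNge; apply: leq_ltn_trans jn.
      by have -> : (n <= x.2)%N by lia.
    by rewrite partial_deg_content -sz -sum1_size big_seq [RHS]big_seq; apply: eq_bigr => x /hi1.
have jE : nat_of_ord j = n.-1 by have := ltn_ord j; lia.
rewrite sz jE; apply: (@quadX_coef_long _ _ _ _ i) => //=.
  exact: Zlong.
by move=> a /bnd[x [x1 x2 x3] [xc ax]]; case: ax => ->; lia.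
Qed.

Definition spanned (p : Snm) : Prop := exists2 i, Id i &
  p - i \in lin_span (fun q : Snm => exists2 s, adm m s & q = mono Z s).

Lemma spannedP a p q : spanned p -> spanned q -> spanned (a *: p + q).
Proof.
move=> [i Ii pi] [j Ij qj]; exists (a *: i + j).
  by apply: ideal_genD => //; rewrite -[(i)]mul1r scalerAl; apply: ideal_genM.
by rewrite opprD addrACA -scalerBr rpredD // rpredZ.
Qed.

Lemma spanned0 : spanned 0.
Proof. by exists 0; [apply: ideal_gen0 | rewrite subrr rpred0]. Qed.

Lemma spannedZ a p : spanned p -> spanned (a *: p).
Proof. by move=> sp; rewrite -[a *: p]addr0; apply: spannedP => //; apply: spanned0. Qed.

Lemma spanned_ideal p : Id p -> spanned p.
Proof. by exists p => //; rewrite subrr rpred0. Qed.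

Lemma spanned_sum (T : Type) (r : seq T) (P : pred T) (f : T -> Snm) :
  (forall i, P i -> spanned (f i)) -> spanned (\sum_(i <- r | P i) f i).
Proof.
move=> fs; elim/big_ind: _ => //; first exact: spanned0.
by move=> x y sx sy; rewrite -[x]scale1r; apply: spannedP.
Qed.

Lemma spanned_mono s : spanned (mono Z s).
Proof.
(* Straightening keeps the size and raises [qval], which is bounded by the size times (2n)^2; this
   difference is the termination measure. *)
have [L le_sL] := ubnP (size s * ((n + n) * (n + n)) - qval s).
elim: L s le_sL => // L IH s le_sL.
have [/allP al|/allPn[x xs]] := boolP (all (fun x : I * I => n + n <= x.1 + x.2)%N s); last first.
  by rewrite -ltnNge => /(mono_disallowed _ xs) ->; apply: spanned0.
rewrite -mono_nrm; have al' : all (@allowed n) (map (@nrm _) s).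
  by apply/allP => _ /mapP[x xs ->]; rewrite allowed_nrm; apply: al.
rewrite -(qval_nrm s) -(size_map (@nrm _) s) in le_sL.
move: {al} (map _ s) le_sL al' => {}s le_sL al.
have [sadm|nadm] := pselect (adm m s).
  by exists 0; [apply: ideal_gen0 | rewrite subr0; apply: sub_lin_span; exists s].
have [c [r [k [j [sE cn kj wc sz]]]]] : exists c r (k j : 'I_n),
   [/\ perm_eq s (c ++ r), all2rel (@nested _) c, (k <= j)%N, within k j c &
       (pairing m k j < size c)%N].
  apply: contrapT => no; apply: nadm; split=> // c r k j sE cn kj wc.
  by rewrite leqNgt; apply/negP => sz; apply: no; exists c, r, k, j.
(* The ideal is given the power one above the bound, so the violating nested part is cut down to
   exactly that size; a part of a nested family is still nested. *)
set N := (pairing m k j).+1 in sz; pose c0 := take N c; pose r0 := drop N c ++ r.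
have sc0 : size c0 = N by rewrite size_take_min; apply/minn_idPl.
have sub0 : {subset c0 <= c} by move=> x; apply: mem_take.
have sE0 : perm_eq s (c0 ++ r0) by rewrite catA cat_take_drop.
have cn0 : all2rel (@nested _) c0.
  by apply/allrelP => x y /sub0 xc /sub0 yc; apply: (allrelP cn).
have al0 : all (@allowed n) c0.
  by apply/allP => x xc; apply: (allP al); rewrite (perm_mem sE0) mem_cat xc.
have wc0 : within k j c0.
  case/andP: wc => w1 /implyP w2; apply/andP; split.
    by apply/allP => x /sub0; apply: (allP w1).
  by apply/implyP => /w2 w3; apply/allP => x /sub0; apply: (allP w3).
have PU := quadX_coef_within al0 kj wc0 sc0.
have le0 : all (fun x : I * I => x.1 <= x.2)%N c0 by apply/allP => x /(allP al0) /andP[].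
have [l l0 PE] := quadX_coef_leading le0 cn0.
rewrite (mono_perm sE0) mono_cat.
have -> : mono Z c0 = (l%:R)^-1 *: (PP (size c0) (content c0) -
    \sum_(t : (size c0).-tuple (I * I) | (content t == content c0) && (qval c0 < qval t)%N) mono Z t).
  by rewrite PE addrK -scaler_nat scalerA mulVf ?scale1r // pnatr_eq0 -lt0n.
rewrite -scalerAl; apply: spannedZ; rewrite mulrBl addrC -scaleN1r; apply: spannedP; last first.
  by apply: spanned_ideal; rewrite mulrC; apply: ideal_genM; apply: ideal_gen_mem.
rewrite mulr_suml; apply: spanned_sum => t /andP[_ lt]; rewrite -mono_cat; apply: IH.
have ss : size (t ++ r0) = size s by rewrite (perm_size sE0) !size_cat size_tuple.
have qq : (qval s < qval (t ++ r0))%N.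
  by rewrite (qval_perm sE0) /qval !big_cat /= ltn_add2r.
have := qval_bound (t ++ r0); rewrite ss => le.
exact: subn_descent le_sL qq le.
Qed.

Lemma spanned_all p : spanned p.
Proof.
elim/sym_indX: p => [|a p q|i p [j Ij pj]].
- have -> : 1 = mono Z [::] by rewrite /mono big_nil.
  exact: spanned_mono.
- exact: spannedP.
set x := sym_gen _ _; rewrite -[p](subrK j) mulrDr -[_ * (p - j)]scale1r.
apply: spannedP; last by apply/spanned_ideal/ideal_genM.
have [c xE] := sp_supp_expand (vbasis_nth_mem i).
have {}xE : x = \sum_(a : I) \sum_(b : I | (rev_ord b < a)%N) c a b *: Z a b.
  rewrite /x xE (linear_sum (sym_gen _)); apply: eq_bigr => a _.
  rewrite (linear_sum (sym_gen _)); apply: eq_bigr => b ab.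
  rewrite /Zg ifT; first exact: sym_genZ.
  by move: ab => /=; have := ltn_ord b; lia.
case/lin_spanP: pj => k [e [u [Xu ->]]]; rewrite mulr_sumr; apply: spanned_sum => y _.
rewrite -scalerAr; apply: spannedZ; have [s _ ->] := Xu y.
rewrite xE mulr_suml; apply: spanned_sum => a _.
rewrite mulr_suml; apply: spanned_sum => b ab; rewrite -scalerAl; apply: spannedZ.
have -> : Z a b * mono Z s = mono Z ((a, b) :: s) by rewrite /mono big_cons.
exact: spanned_mono.
Qed.

End Straightening.

(** * The associated graded module *)

Section Graded.
Variables (F : fieldType) (V : lmodType F) (Fil : nat -> V -> Prop).
Local Notation rees := (rees Fil).
Local Notation gr := (gr_mod Fil).
Implicit Types (u w : rees) (g : {linear V -> V}).

Lemma rees_valP a u w s : val (a *: u + w) s = a *: val u s + val w s.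
Proof. by rewrite linearP. Qed.

Lemma rees_valD u w s : val (u + w) s = val u s + val w s.
Proof. by rewrite raddfD. Qed.

Lemma rees_valB u w s : val (u - w) s = val u s - val w s.
Proof. by rewrite raddfB. Qed.

Lemma rees_val_sum k (c : 'I_k -> F) (u : 'I_k -> rees) s :
  val (\sum_j c j *: u j) s = \sum_j c j *: val (u j) s.
Proof. by elim/big_rec2: _ => [|j x y _ <-]; rewrite ?rees_valP. Qed.

Lemma rees_mem u s : val u s \in fil Fil s.
Proof. by have /asboolP[] := valP u. Qed.

Fact gr_pi_is_linear : linear (@gr_pi F V Fil).
Proof. by move=> a u w; rewrite /gr_pi; apply: linearP. Qed.
HB.instance Definition _ := GRing.isLinear.Build F rees gr _ (@gr_pi F V Fil) gr_pi_is_linear.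

Lemma gr_pi_surj (x : gr) : exists u, x = gr_pi u.
Proof. by exists (quot_repr x); rewrite /gr_pi quot_reprK. Qed.

Lemma gr_pi_eq0 u : gr_pi u = 0 <-> forall s, val u s \in fil_pred Fil s.
Proof.
rewrite -[0](linear0 (@gr_pi F V Fil)); split=> [/gr_piP|den]; first by rewrite subr0.
by apply/gr_piP; rewrite subr0.
Qed.

Lemma gr_pi_ext u w : (forall s, val u s = val w s) -> gr_pi u = gr_pi w.
Proof. by move=> uw; congr gr_pi; apply/val_inj/funext. Qed.

Section Operators.
Variable g : {linear V -> V}.

Section Shift.
Hypothesis gF : forall s (w : V), w \in fil Fil s -> g w \in fil Fil s.+1.

Lemma gr_shift_linear : linear (gr_shift (Fil:=Fil) g).
Proof.
move=> a x y; have [u ->] := gr_pi_surj x; have [w ->] := gr_pi_surj y.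
rewrite -linearP !gr_shiftE // -linearP; apply: gr_pi_ext => s.
rewrite rees_valP !rees_shiftE //; case: s => [|s] /=; first by rewrite scaler0 addr0.
exact: linearP.
Qed.
End Shift.

Hypothesis gF : forall s (w : V), w \in fil Fil s -> g w \in fil Fil s.

(** Degree-zero counterpart of [rees_shift], for an operator that preserves each V_s; it carries the
    action of n^+ to gr V. *)
Definition rees_lift u : rees := insubd 0 (fun s => g (val u s)).
Definition gr_lift (x : gr) : gr := gr_pi (rees_lift (quot_repr x)).

Lemma rees_liftE u s : val (rees_lift u) s = g (val u s).
Proof.
rewrite insubdK //; apply/asboolP; have /asboolP[uF [N uN]] := valP u.
split=> [t|]; first exact/gF/uF.
by exists N => t Nt; rewrite uN ?linear0.
Qed.

Lemma gr_liftE u : gr_lift (gr_pi u) = gr_pi (rees_lift u).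
Proof.
apply/gr_piP => s.
have /gr_piP den : gr_pi (quot_repr (gr_pi u)) = gr_pi u by exact: quot_reprK.
have := den s; rewrite -!scaleN1r ![_ + -1 *: _]addrC !rees_valP !rees_liftE.
rewrite -linearP; case: s => [|s] /=; last exact: gF.
by rewrite inE => /eqP ->; rewrite inE linear0.
Qed.

Lemma gr_lift_linear : linear gr_lift.
Proof.
move=> a x y; have [u ->] := gr_pi_surj x; have [w ->] := gr_pi_surj y.
rewrite -linearP !gr_liftE // -linearP; apply: gr_pi_ext => s.
by rewrite rees_valP !rees_liftE rees_valP linearP.
Qed.

End Operators.

Definition gr_hom (d : nat) (x : V) : gr :=
  gr_pi (insubd 0 (fun s => if s == d then x else 0)).

Lemma rees_homE d x s : x \in fil Fil d ->
  val (insubd (0 : rees) (fun s => if s == d then x else 0)) s = if s == d then x else 0.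
Proof.
move=> xd; rewrite insubdK //; apply/asboolP; split=> [t|].
  by case: eqP => [->|_] //; apply: rpred0.
by exists d.+1 => t; case: eqP => // ->; rewrite ltnn.
Qed.

Lemma gr_init_hom v : v \in fil Fil 0 -> gr_init Fil v = gr_hom 0 v.
Proof. by move=> v0; rewrite /gr_init /gr_hom; congr gr_pi; congr insubd; apply/funext => -[|s]. Qed.

Lemma gr_shift_hom g d x : (forall s (w : V), w \in fil Fil s -> g w \in fil Fil s.+1) ->
  x \in fil Fil d -> gr_shift g (gr_hom d x) = gr_hom d.+1 (g x).
Proof.
move=> gF xd; rewrite gr_shiftE //; apply: gr_pi_ext => s.
rewrite rees_shiftE // rees_homE; last exact: gF.
by case: s => //= s; rewrite rees_homE // eqSS; case: eqP; rewrite ?linear0.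
Qed.

Lemma gr_hom0 d : gr_hom d 0 = 0.
Proof.
apply/gr_pi_eq0 => s; rewrite rees_homE ?rpred0 // if_same.
by case: s => [|s] /=; rewrite ?rpred0 ?inE.
Qed.

(** Degrees in gr V are independent, so a relation can be read in the single degree d, where it
    holds modulo V_{d-1}. *)
Lemma gr_hom_sum_eq0 k (c : 'I_k -> F) (e : 'I_k -> nat) (x : 'I_k -> V) d :
  (forall j, x j \in fil Fil (e j)) ->
  \sum_j c j *: gr_hom (e j) (x j) = 0 ->
  \sum_(j | e j == d) c j *: x j \in fil_pred Fil d.
Proof.
move=> xF; rewrite /gr_hom; under eq_bigr => j _ do rewrite -linearZ.
rewrite -linear_sum => /gr_pi_eq0 /(_ d); set S := val _ d.
suff -> : S = \sum_(j | e j == d) c j *: x j by [].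
rewrite /S rees_val_sum [RHS]big_mkcond; apply: eq_bigr => j _.
by rewrite rees_homE // eq_sym; case: eqP => //; rewrite scaler0.
Qed.

End Graded.

(** * Actions of n^- and n^+ on gr V *)

Section Modules.
Variables (F : numFieldType) (n : nat) (V : lmodType F).
Local Notation M := 'M[F]_(n + n).
Variable act : M -> {linear V -> V}.
Hypothesis mV : is_sp_module act.
Variables (v : V) (chi : M -> F).
Hypothesis v_nplus : forall x, x \in nplus F n -> act x v = 0.
Hypothesis v_cartan : forall h, h \in cartan F n -> act h v = chi h *: v.

Lemma actP a x y u : x \in sp F n -> y \in sp F n ->
  act (a *: x + y) u = a *: act x u + act y u.
Proof. by case: mV => H _; apply: H. Qed.

Lemma act_br x y u : x \in sp F n -> y \in sp F n ->
  act (lie_br x y) u = act x (act y u) - act y (act x u).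
Proof. by case: mV => _; apply. Qed.

Lemma act0 u : act 0 u = 0.
Proof. by rewrite -[0](addNr 0) -scaleN1r actP ?rpred0 // scaleN1r addNr. Qed.

Lemma actD x y u : x \in sp F n -> y \in sp F n -> act (x + y) u = act x u + act y u.
Proof. by move=> xs ys; rewrite -[x]scale1r actP // !scale1r. Qed.

Lemma actZ a x u : x \in sp F n -> act (a *: x) u = a *: act x u.
Proof. by move=> xs; rewrite -[a *: x]addr0 actP ?rpred0 // act0 addr0. Qed.

Lemma act_sum (T : Type) (r : seq T) (P : pred T) (f : T -> M) u :
  (forall i, P i -> f i \in sp F n) ->
  act (\sum_(i <- r | P i) f i) u = \sum_(i <- r | P i) act (f i) u.
Proof.
move=> fsp; suff [] : act (\sum_(i <- r | P i) f i) u = \sum_(i <- r | P i) act (f i) u /\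
  \sum_(i <- r | P i) f i \in sp F n by [].
elim/big_rec2: _ => [|i y x Pi [E xs]]; first by rewrite act0 rpred0.
by rewrite actD ?fsp // E rpredD // fsp.
Qed.

Local Notation word xs := (foldr (fun x w => act x w) v xs).
Local Notation fl := (fil (pbw act v)).

Lemma word_fil xs : {subset xs <= nminus F n} -> word xs \in fl (size xs).
Proof. by move=> xsn; apply: sub_lin_span; exists xs. Qed.

Lemma fil_le s t u : (s <= t)%N -> u \in fl s -> u \in fl t.
Proof.
move=> st /lin_spanP[k [c [x [Xx ->]]]]; apply: rpred_sum => i _; apply: rpredZ.
apply: sub_lin_span; have [xs [xsn sz ->]] := Xx i; exists xs; split=> //.
exact: leq_trans st.
Qed.

Lemma act_nminus_fil x s u : x \in nminus F n -> u \in fl s -> act x u \in fl s.+1.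
Proof. exact: act_fil. Qed.

(** Commute x past the first letter y. The part of [x, y] in b acts on a shorter word, while its
    part in n^- merely replaces y, so the number of letters never grows. *)
Lemma act_borel_word xs x : {subset xs <= nminus F n} -> x \in borel F n ->
  act x (word xs) \in fl (size xs).
Proof.
elim: xs x => [|y xs IH] x xsn xb.
  case/memv_addP: xb => h hc [e en ->]; rewrite actD /=; first last.
  - exact: nplus_sp.
  - by case/sp_suppP: hc.
  by rewrite v_cartan // v_nplus // addr0 rpredZ //; apply: (@word_fil [::]).
have yn : y \in nminus F n by apply: xsn; rewrite inE eqxx.
have {}xsn : {subset xs <= nminus F n} by move=> z zs; apply: xsn; rewrite inE zs orbT.
have xsp := borel_sp xb; have ysp := nminus_sp yn.
have bsp := lie_br_sp xsp ysp; rewrite /=; set w := foldr _ _ xs.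
rewrite -[act x _](subrK (act y (act x w))) -act_br //.
rewrite -[lie_br x y](subrK (low (lie_br x y))) actD; first last.
- exact/nminus_sp/low_nminus.
- exact/borel_sp/sub_low_borel.
apply: rpredD; [apply: rpredD|].
- by apply: (@fil_le (size xs)) => //; apply: IH => //; apply: sub_low_borel.
- by apply: act_nminus_fil; [apply: low_nminus | apply: word_fil].
- by apply: act_nminus_fil => //; apply: IH.
Qed.

Lemma act_borel_fil x s u : x \in borel F n -> u \in fl s -> act x u \in fl s.
Proof.
move=> xb /lin_spanP[k [c [w [Xw ->]]]]; rewrite linear_sum.
apply: rpred_sum => i _; rewrite linearZ; apply: rpredZ.
have [xs [xsn sz ->]] := Xw i; apply: (fil_le sz); exact: act_borel_word.
Qed.

Lemma act_sp_fil x s u : x \in sp F n -> u \in fl s -> act x u \in fl s.+1.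
Proof.
move=> xs us; rewrite -[x](subrK (low x)) actD; first last.
- exact/nminus_sp/low_nminus.
- exact/borel_sp/sub_low_borel.
apply: rpredD; last by apply: act_nminus_fil => //; apply: low_nminus.
by apply: (@fil_le s) => //; apply: act_borel_fil => //; apply: sub_low_borel.
Qed.

Local Notation Snm := (Sym (nminus F n)).
Local Notation gr := (gr_mod (pbw act v)).
Local Notation GS x := (gr_shift (Fil:=pbw act v) (act x)).

Lemma GS_linear x a (y z : gr) : x \in nminus F n -> GS x (a *: y + z) = a *: GS x y + GS x z.
Proof. by move=> xn; apply: gr_shift_linear => s w; apply: act_fil. Qed.

Lemma GS_pi x u : x \in nminus F n -> GS x (gr_pi u) = gr_pi (rees_shift (act x) u).
Proof. by move=> xn; apply: gr_shiftE => s w; apply: act_fil. Qed.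

Lemma rees_actE x (u : rees (pbw act v)) s : x \in nminus F n ->
  val (rees_shift (act x) u) s = shift_fam (act x) (val u) s.
Proof. by move=> xn; rewrite rees_shiftE // => t w; apply: act_fil. Qed.

Lemma GS0 x : x \in nminus F n -> GS x 0 = 0.
Proof. by move=> xn; have := GS_linear (-1) 0 0 xn; rewrite scaler0 addr0 scaleN1r addNr. Qed.

Lemma GSP a x y g : x \in nminus F n -> y \in nminus F n ->
  GS (a *: x + y) g = a *: GS x g + GS y g.
Proof.
move=> xn yn; have [u ->] := gr_pi_surj g.
have xyn : a *: x + y \in nminus F n by rewrite rpredD // rpredZ.
rewrite !GS_pi // -linearP; apply: gr_pi_ext => s.
rewrite rees_valP !rees_actE //; case: s => [|s] /=; first by rewrite scaler0 addr0.
by rewrite actP // nminus_sp.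
Qed.

(** The commutator xy - yx acts as one element of sp, which raises the filtration by at most one,
    whereas the product is considered in degree two. *)
Lemma GSC x y g : x \in nminus F n -> y \in nminus F n -> GS x (GS y g) = GS y (GS x g).
Proof.
move=> xn yn; have [u ->] := gr_pi_surj g; rewrite !GS_pi //; apply/gr_piP => s.
have xs := nminus_sp xn; have ys := nminus_sp yn.
rewrite -scaleN1r addrC rees_valP !rees_actE // scaleN1r addrC.
case: s => [|[|s]] /=; rewrite ?rees_actE //= ?linear0.
- by rewrite inE addr0.
- by rewrite addr0 rpred0.
by rewrite -act_br //; apply: act_sp_fil; [apply: lie_br_sp | apply: rees_mem].
Qed.

Local Notation mop m g := (foldr (fun i => iter (m i) (GS (vbasis (nminus F n))`_i)) g
      (enum 'I_(\dim (nminus F n)))).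
Local Notation b i := ((vbasis (nminus F n))`_i).

Lemma basis_nminus (i : 'I_(\dim (nminus F n))) : b i \in nminus F n.
Proof. exact: vbasis_nth_mem. Qed.

Lemma gr_actwE k (p : Snm) g : (msize p <= k)%N ->
  gr_act p g = \sum_(m : 'X_{1..(\dim (nminus F n)) < k}) p@_m *: mop m g.
Proof.
move=> le_pk; set I : subFinType _ := 'X_{1..(\dim (nminus F n)) < k}.
rewrite /gr_act (big_mksub I) ?msupp_uniq //=; first last.
  by move=> x /msize_mdeg_lt /leq_trans; apply.
rewrite big_rmcond //= => j /memN_msupp_eq0 ->.
by rewrite scale0r.
Qed.

Lemma gr_actP a (p q : Snm) g : gr_act (a *: p + q) g = a *: gr_act p g + gr_act q g :> gr.
Proof.
pose k := maxn (msize (a *: p + q)) (maxn (msize p) (msize q)).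
rewrite !(@gr_actwE k) /k ?leq_max ?leqnn ?orbT // scaler_sumr -big_split /=.
by apply: eq_bigr => m _; rewrite mcoeffD mcoeffZ scalerDl scalerA.
Qed.

Lemma gr_actD (p q : Snm) g : gr_act (p + q) g = gr_act p g + gr_act q g :> gr.
Proof. by rewrite -[p in LHS]scale1r gr_actP scale1r. Qed.

Lemma gr_act0 g : gr_act (0 : Snm) g = 0 :> gr.
Proof. by rewrite /gr_act msupp0 big_nil. Qed.

Lemma gr_act1 g : gr_act (1 : Snm) g = g :> gr.
Proof.
rewrite /gr_act msupp1 big_seq1 mcoeff1 eqxx scale1r.
by elim: (enum _) => //= i s ->; rewrite mnm0E.
Qed.

Lemma mop_U m (i : 'I_(\dim (nminus F n))) g : mop (U_(i) + m)%MM g = GS (b i) (mop m g).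
Proof.
have cm (j : 'I_(\dim (nminus F n))) h N : iter N (GS (b j)) (GS (b i) h) = GS (b i) (iter N (GS (b j)) h).
  by elim: N => //= N ->; apply: GSC; apply: basis_nminus.
have notin (s : seq 'I_(\dim (nminus F n))) : i \notin s ->
    foldr (fun j => iter ((U_(i) + m)%MM j) (GS (b j))) g s =
    foldr (fun j => iter (m j) (GS (b j))) g s.
  elim: s => //= j s IH; rewrite inE negb_or => /andP[ij /IH ->].
  by rewrite mnmDE mnm1E (negPf ij).
have : uniq (enum 'I_(\dim (nminus F n))) by exact: enum_uniq.
have : i \in enum 'I_(\dim (nminus F n)) by rewrite mem_enum.
elim: (enum _) => //= j s IH; rewrite inE => /predU1P[ij|ins] /andP[js us].
  rewrite -ij in js *; rewrite notin // mnmDE mnm1E eqxx add1n.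
  by [].
rewrite mnmDE mnm1E IH //; case: eqP => [ij|_].
  by rewrite -ij ins in js.
by rewrite cm.
Qed.

Lemma gr_actXm (m : 'X_{1..\dim (nminus F n)}) g : gr_act ('X_[m] : Snm) g = mop m g :> gr.
Proof. by rewrite /gr_act msuppX big_seq1 mcoeffX eqxx scale1r. Qed.

Lemma gr_act_basis (i : 'I_(\dim (nminus F n))) (p : Snm) g :
  gr_act (sym_gen (nminus F n) (b i) * p) g = GS (b i) (gr_act p g).
Proof.
have bn := basis_nminus i; rewrite sym_gen_basis.
elim/mpolyind: p => [|c m p _ _ IH]; first by rewrite mulr0 gr_act0 GS0.
by rewrite mulrDr -scalerAr !gr_actP IH -mpolyXD !gr_actXm mop_U GS_linear.
Qed.

Lemma gr_act_gen x (p : Snm) g : x \in nminus F n ->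
  gr_act (sym_gen (nminus F n) x * p) g = GS x (gr_act p g).
Proof.
move=> xn; have bn := basis_nminus.
have [c xE] : exists c : 'I_(\dim (nminus F n)) -> F, x = \sum_i c i *: b i.
  by exists ((coord (vbasis (nminus F n)))^~ x); apply: coord_vbasis.
have [sx [-> ->]] : exists s : seq 'I_(\dim (nminus F n)), x = \sum_(i <- s) c i *: b i /\
   sym_gen (nminus F n) x = \sum_(i <- s) c i *: sym_gen (nminus F n) (b i).
  exists (index_enum _); split=> //; rewrite xE (linear_sum (sym_gen _)).
  by apply: eq_bigr => i _; apply: sym_genZ.
elim: sx => [|i s IH].
  rewrite !big_nil mul0r gr_act0; have [u ->] := gr_pi_surj (gr_act p g).
  rewrite GS_pi ?rpred0 //; apply/esym/gr_pi_eq0 => t.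
  by rewrite rees_actE ?rpred0 //; case: t => [|t] /=; rewrite ?act0 ?rpred0 ?inE.
rewrite !big_cons mulrDl -scalerAl gr_actP IH gr_act_basis GSP //.
by apply: rpred_sum => j _; apply/rpredZ/bn.
Qed.

Local Notation Ann p := (annihilator act v p).

Lemma annihilatorP a (p q : Snm) : Ann p -> Ann q -> Ann (a *: p + q).
Proof. by rewrite /annihilator gr_actP => -> ->; rewrite scaler0 addr0. Qed.

Lemma annihilatorM (q p : Snm) : Ann p -> Ann (q * p).
Proof.
move=> Ap; elim/sym_indX: q => [|a q1 q2 A1 A2|i q A1]; first by rewrite mul1r.
  by rewrite mulrDl -scalerAl; apply: annihilatorP.
by rewrite /annihilator -mulrA gr_act_basis A1 GS0 // basis_nminus.
Qed.

Lemma annihilator_sum (T : Type) (r : seq T) (P : pred T) (h : T -> Snm) :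
  (forall i, P i -> Ann (h i)) -> Ann (\sum_(i <- r | P i) h i).
Proof.
move=> Ah; elim/big_ind: _ => [|p q Ap Aq|//]; first by rewrite /annihilator gr_act0.
by rewrite -[p]scale1r; apply: annihilatorP.
Qed.

Local Notation GE e := (gr_lift (Fil:=pbw act v) (act e)).

Lemma GE_pi e u : e \in nplus F n -> GE e (gr_pi u) = gr_pi (rees_lift (act e) u).
Proof.
by move=> en; apply: gr_liftE => s w; apply: act_borel_fil; apply: (subvP (addvSr _ _)).
Qed.

Lemma rees_liftP e (u : rees (pbw act v)) s : e \in nplus F n ->
  val (rees_lift (act e) u) s = act e (val u s).
Proof.
by move=> en; apply: rees_liftE => t w; apply: act_borel_fil; apply: (subvP (addvSr _ _)).
Qed.

Lemma GE_linear e a (y z : gr) : e \in nplus F n -> GE e (a *: y + z) = a *: GE e y + GE e z.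
Proof.
by move=> en; apply: gr_lift_linear => s w; apply: act_borel_fil; apply: (subvP (addvSr _ _)).
Qed.

(** In e x = x e + [e, x], the part of [e, x] in b preserves the filtration and therefore dies in a
    degree-one operator; only its n^- part remains. *)
Lemma GE_shift e x g : e \in nplus F n -> x \in nminus F n ->
  GE e (GS x g) = GS x (GE e g) + GS (low (lie_br e x)) g.
Proof.
move=> en xn; have es := nplus_sp en; have xs := nminus_sp xn.
have bs := lie_br_sp es xs; have ln := low_nminus bs.
have [u ->] := gr_pi_surj g.
rewrite !(GS_pi, GE_pi) // -(linearD (@gr_pi _ _ _)); apply/gr_piP => s.
rewrite rees_valB rees_valD rees_liftP // !rees_actE //.
case: s => [|s]; first by rewrite /= linear0 addr0 subrr inE.
rewrite /shift_fam rees_liftP // opprD addrA -act_br //.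
rewrite -{1}[lie_br e x](subrK (low (lie_br e x))) actD; first last.
- exact: nminus_sp.
- exact/borel_sp/sub_low_borel.
rewrite addrK; apply: act_borel_fil; last exact: rees_mem.
exact: sub_low_borel.
Qed.

Lemma v_fil0 : v \in fl 0.
Proof. exact: (@word_fil [::]). Qed.

Lemma GE_init e : e \in nplus F n -> GE e (gr_init (pbw act v) v) = 0.
Proof.
move=> en; rewrite gr_init_hom ?v_fil0 // /gr_hom GE_pi //; apply/gr_pi_eq0 => s.
rewrite rees_liftP // rees_homE ?v_fil0 //; case: eqP => [->|_].
  by rewrite v_nplus //= inE.
by rewrite linear0; case: s => [|s] /=; rewrite ?inE ?rpred0.
Qed.

(* e (p . v) = (e o p) . v in gr V, since e v = 0. *)
Lemma GE_act e (p : Snm) : e \in nplus F n ->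
  GE e (gr_act p (gr_init (pbw act v) v)) = gr_act (circ_der e p) (gr_init (pbw act v) v).
Proof.
move=> en; have bn := basis_nminus.
elim/sym_indX: p => [|a q1 q2 A1 A2|i q A1].
- by rewrite gr_act1 GE_init // /circ_der sym_der1 gr_act0.
- by rewrite gr_actP GE_linear // A1 A2 /circ_der sym_derP gr_actP.
rewrite gr_act_basis GE_shift // A1 /circ_der sym_derM sym_der_basis.
rewrite gr_actD gr_act_gen; last first.
  exact/low_nminus/lie_br_sp/nminus_sp/bn/nplus_sp.
by rewrite gr_act_basis addrC.
Qed.

Lemma annihilator_circ e (p : Snm) : e \in nplus F n -> Ann p -> Ann (circ_der e p).
Proof.
move=> en Ap; rewrite /annihilator -GE_act // Ap.
by have := GE_linear (-1) 0 0 en; rewrite scaler0 addr0 scaleN1r addNr.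
Qed.

Lemma annihilator_ideal (G : Snm -> Prop) : (forall q, G q -> Ann q) ->
  forall p, ideal_gen (U_circ G) p -> Ann p.
Proof.
move=> AG p [k [a [g [Ug ->]]]]; apply: annihilator_sum => i _; apply: annihilatorM.
have /lin_spanP[l [c [w [Xw ->]]]] := Ug i; apply: annihilator_sum => j _.
rewrite -[_ *: _]addr0; apply: annihilatorP; last by rewrite /annihilator gr_act0.
elim: (Xw j) => [q|e p1 q en _ A1]; first exact: AG.
by move/(circE _ _ en) => ->; apply: annihilator_circ.
Qed.

Lemma gr_act_word xs : {subset xs <= nminus F n} ->
  gr_act (\prod_(x <- xs) sym_gen (nminus F n) x) (gr_init (pbw act v) v) =
  gr_hom (pbw act v) (size xs) (word xs).
Proof.
elim: xs => [|x xs IH] xsn; first by rewrite big_nil gr_act1 gr_init_hom ?v_fil0.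
have xn : x \in nminus F n by apply: xsn; rewrite inE eqxx.
have {}xsn : {subset xs <= nminus F n} by move=> z zs; apply: xsn; rewrite inE zs orbT.
rewrite big_cons gr_act_gen // IH // gr_shift_hom ?word_fil //.
by move=> s w; apply: act_fil.
Qed.

Lemma annihilator_relation k (c : 'I_k -> F) (xs : 'I_k -> seq M) d :
  (forall j, {subset xs j <= nminus F n}) ->
  Ann (\sum_j c j *: \prod_(x <- xs j) sym_gen (nminus F n) x) ->
  \sum_(j | size (xs j) == d) c j *: word (xs j) \in fil_pred (pbw act v) d.
Proof.
move=> xsn; rewrite /annihilator => A; apply: gr_hom_sum_eq0 => [j|]; first exact: word_fil.
rewrite -[RHS]A; elim/big_rec2: _ => [|j p g _ ->]; first by rewrite gr_act0.
by rewrite gr_actP gr_act_word.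
Qed.

End Modules.

(** * Tensor powers and highest weight vectors *)

Section Tensor.
Variables (C : numClosedFieldType) (n : nat) (Sl : finType).
Local Notation I := 'I_(n + n).
Local Notation M := 'M[C]_(n + n).
Local Notation ind := {ffun Sl -> I}.

(* The tensor power of C^2n over the set Sl, in coordinates. *)
Definition tens : Type := {ffun {ffun Sl -> 'I_(n + n)} -> C^o}.
HB.instance Definition _ := GRing.Lmodule.on tens.
Implicit Types (x y : M) (phi psi : tens) (J : ind) (l : Sl).

Definition upd J l (c : I) : ind := [ffun l' => if l' == l then c else J l'].

Lemma updE J l c : upd J l c l = c. Proof. by rewrite ffunE eqxx. Qed.
Lemma updN J l c l' : l' != l -> upd J l c l' = J l'.
Proof. by rewrite ffunE => /negPf->. Qed.
Lemma upd_upd J l c d : upd (upd J l c) l d = upd J l d.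
Proof. by apply/ffunP => l'; rewrite !ffunE; case: eqP. Qed.
Lemma upd_id J l : upd J l (J l) = J.
Proof. by apply/ffunP => l'; rewrite !ffunE; case: eqP => [->|]. Qed.
Lemma updC J l l' c d : l != l' -> upd (upd J l c) l' d = upd (upd J l' d) l c.
Proof.
move=> ll'; apply/ffunP => k; rewrite !ffunE.
by have [->|//] := eqVneq k l'; rewrite eq_sym (negPf ll').
Qed.

Definition slot_act l x phi : tens := [ffun J : ind => \sum_c x (J l) c * phi (upd J l c)].

Lemma slot_actE l x phi J : slot_act l x phi J = \sum_c x (J l) c * phi (upd J l c).
Proof. by rewrite ffunE. Qed.

Lemma slot_act_linear l x : linear (slot_act l x).
Proof.
move=> a phi psi; apply/ffunP => J; rewrite !ffunE scaler_sumr -big_split /=.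
by apply: eq_bigr => c _; rewrite !ffunE mulrDr scalerAr.
Qed.
HB.instance Definition _ l x := GRing.isLinear.Build C tens tens _ (slot_act l x) (slot_act_linear l x).

Lemma slot_act_linearl l a x y phi : slot_act l (a *: x + y) phi = a *: slot_act l x phi + slot_act l y phi.
Proof.
apply/ffunP => J; rewrite !ffunE scaler_sumr -big_split /=.
by apply: eq_bigr => c _; rewrite !mxE mulrDl scalerAl.
Qed.

Lemma slot_actM l x y phi : slot_act l x (slot_act l y phi) = slot_act l (x *m y) phi.
Proof.
apply/ffunP => J; rewrite !slot_actE.
under eq_bigr => c _ do rewrite slot_actE updE mulr_sumr.
rewrite exchange_big /=; apply: eq_bigr => d _; rewrite mxE mulr_suml.
by apply: eq_bigr => c _; rewrite upd_upd mulrA.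
Qed.

Lemma slot_actC l l' x y phi : l != l' ->
  slot_act l x (slot_act l' y phi) = slot_act l' y (slot_act l x phi).
Proof.
move=> ll'; apply/ffunP => J; rewrite !slot_actE.
under eq_bigr => c _ do rewrite slot_actE updN 1?eq_sym // mulr_sumr.
under [RHS]eq_bigr => c _ do rewrite slot_actE updN // mulr_sumr.
rewrite exchange_big /=; apply: eq_bigr => c _; apply: eq_bigr => d _.
by rewrite updC // mulrCA.
Qed.

Definition tens_act_fun x phi : tens := \sum_l slot_act l x phi.
Lemma tens_act_linear x : linear (tens_act_fun x).
Proof.
move=> a phi psi; rewrite /tens_act_fun scaler_sumr -big_split /=.
by apply: eq_bigr => l _; rewrite linearP.
Qed.
HB.instance Definition _ x := GRing.isLinear.Build C tens tens _ (tens_act_fun x) (tens_act_linear x).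

Definition tens_act x : {linear tens -> tens} := tens_act_fun x.

Lemma tens_actE x phi J : tens_act x phi J = \sum_l \sum_c x (J l) c * phi (upd J l c).
Proof. by rewrite /= /tens_act_fun sum_ffunE; apply: eq_bigr => l _; rewrite ffunE. Qed.

Lemma tens_is_sp_module : is_sp_module tens_act.
Proof.
split=> [a x y phi _ _|x y phi _ _].
  rewrite /= /tens_act_fun scaler_sumr -big_split /=.
  by apply: eq_bigr => l _; rewrite slot_act_linearl.
rewrite /= /tens_act_fun.
under [in RHS]eq_bigr => l _ do rewrite linear_sum.
under [X in _ = _ - X]eq_bigr => l _ do rewrite linear_sum.
rewrite [X in _ = _ - X]exchange_big -sumrB; apply: eq_bigr => l _ /=.
rewrite -sumrB (bigD1 l) //= big1 ?addr0 => [|l' ll'].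
  rewrite !slot_actM /lie_br addrC -scaleN1r slot_act_linearl scaleN1r addrC.
  by [].
by rewrite slot_actC ?subrr // eq_sym.
Qed.

Definition herm phi psi : C := \sum_J phi J * (psi J)^*.

Lemma herm_linear a phi phi' psi : herm (a *: phi + phi') psi = a * herm phi psi + herm phi' psi.
Proof.
rewrite /herm mulr_sumr -big_split; apply: eq_bigr => J _.
by rewrite !ffunE mulrDl mulrA.
Qed.

Lemma herm_sum (T : Type) (r : seq T) (P : pred T) (c : T -> C) (f : T -> tens) psi :
  herm (\sum_(i <- r | P i) c i *: f i) psi = \sum_(i <- r | P i) c i * herm (f i) psi.
Proof.
elim/big_rec2: _ => [|i y z _ <-]; last by rewrite herm_linear.
by rewrite /herm big1 // => J _; rewrite ffunE mul0r.
Qed.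

Lemma hermC phi psi : herm psi phi = (herm phi psi)^*.
Proof.
rewrite /herm rmorph_sum; apply: eq_bigr => J _.
by rewrite rmorphM /= conjCK mulrC.
Qed.

Lemma herm_eq0 phi : herm phi phi = 0 -> phi = 0.
Proof.
move=> /eqP; rewrite /herm psumr_eq0 => [/allP z|J _]; last exact: mul_conjC_ge0.
by apply/ffunP => J; rewrite ffunE; apply/eqP; have := z J (mem_index_enum J); rewrite /= mul_conjC_eq0.
Qed.

Definition dag x : M := map_mx (@Num.conj C) x^T.

Lemma dagK : involutive dag.
Proof. by move=> x; apply/matrixP => i j; rewrite !mxE conjCK. Qed.

Lemma herm_act x phi psi : herm (tens_act x phi) psi = herm phi (tens_act (dag x) psi).
Proof.
rewrite /herm; under eq_bigr => J _ do rewrite tens_actE mulr_suml.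
under [RHS]eq_bigr => J _ do rewrite tens_actE rmorph_sum mulr_sumr.
rewrite exchange_big [RHS]exchange_big; apply: eq_bigr => l _ /=.
under eq_bigr => J _ do rewrite mulr_suml.
under [RHS]eq_bigr => J _ do rewrite rmorph_sum mulr_sumr.
(* Exchanging the value of the multi-index at slot l with the summed index is an involution, and it
   turns one double sum into the other. *)
rewrite !pair_big /= (reindex (fun p : ind * I => (upd p.1 l p.2, p.1 l))) /=; last first.
  by apply: onW_bij; apply: inv_bij => -[J c]; rewrite /= upd_upd upd_id updE.
apply: eq_bigr => -[J c] _ /=; rewrite upd_upd upd_id updE !mxE rmorphM /= conjCK.
by rewrite mulrAC mulrC mulrA.
Qed.

Section Dag.

Lemma dag_sp x : x \in sp C n -> dag x \in sp C n.
Proof.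
move=> xsp; have tsp : x^T \in sp C n.
  apply/spP; rewrite trmxK; have := sp_mulJ xsp.
  move=> /(congr1 (fun w => sp_form C n *m w *m sp_form C n)); rewrite !mulmxN mulmxA sp_form_sqr.
  rewrite !mulNmx mul1mx !mulmxA -(mulmxA _ (sp_form C n) (sp_form C n)) sp_form_sqr mulmxN mulmx1 opprK.
  by move=> <-; rewrite subrr.
apply/spP; have Jc : map_mx (@Num.conj C) (sp_form C n) = sp_form C n.
  apply/matrixP => i j; rewrite !mxE; case: ifP => _; last by rewrite rmorph0.
  by case: ifP => _; rewrite ?rmorphN rmorph1.
have /spP/(congr1 (map_mx (@Num.conj C))) := tsp.
by rewrite map_mxD !map_mxM map_mx0 Jc /dag map_trmx.
Qed.

Lemma dag_supp (P P' : rel I) x : (forall i j, P i j -> P' j i) ->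
  x \in sp_supp C P -> dag x \in sp_supp C P'.
Proof.
move=> PP' /sp_suppP[xsp x0]; apply/sp_suppP; split=> [|i j Pij]; first exact: dag_sp.
by rewrite !mxE x0 ?rmorph0 //; apply: contraNN Pij; apply: PP'.
Qed.

Lemma dag_nminus x : x \in nminus C n -> dag x \in nplus C n.
Proof. exact: dag_supp. Qed.
End Dag.

End Tensor.

(** * Highest weight vector of a product of exterior powers and rank-one nilpotency *)

Section HighestWeightTensor.
Variables (C : numClosedFieldType) (n : nat) (Sl : finType) (B : eqType).
Local Notation I := 'I_(n + n).
Local Notation M := 'M[C]_(n + n).
Local Notation ind := {ffun Sl -> I}.
Local Notation T := (tens C n Sl).
Local Notation actT := (@tens_act C n Sl).
Variables (blk : Sl -> B) (pos : Sl -> I).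
Hypothesis pos_inj : forall l l', blk l = blk l' -> pos l = pos l' -> l = l'.
Hypothesis pos_init : forall l (p : I), (p < pos l)%N ->
  exists2 l', blk l' = blk l & pos l' = p.

Definition blk_perm (s : {perm Sl}) := [forall l, blk (s l) == blk l].
Definition perm_pos (s : {perm Sl}) : ind := [ffun l => pos (s l)].

(* The tensor product over the blocks of the vectors e_1 /\ ... /\ e_i. *)
Definition tens_hw : T :=
  [ffun J : ind => \sum_(s | blk_perm s) (-1) ^+ odd_perm s * (J == perm_pos s)%:R].

Lemma blk_permP s l : blk_perm s -> blk (s l) = blk l.
Proof. by move=> /forallP/(_ l)/eqP. Qed.

Lemma tens_hw_supp J : tens_hw J != 0 -> exists2 s, blk_perm s & J = perm_pos s.
Proof.
rewrite ffunE => nz; suff /existsP[s /andP[bs /eqP E]] : [exists s, blk_perm s && (J == perm_pos s)].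
  by exists s.
apply: contraNT nz => /existsPn no; rewrite big1 // => s bs.
by have := no s; rewrite bs /= => /negPf ->; rewrite mulr0.
Qed.

Lemma tens_hw_pos : tens_hw (perm_pos 1%g) = 1.
Proof.
rewrite ffunE (bigD1 1%g) /=; last by apply/forallP => l; rewrite perm1.
rewrite odd_perm1 eqxx mulr1 big1 ?addr0 // => s /andP[bs s1].
case: eqP => [E|_]; last by rewrite mulr0.
case/eqP: s1; apply/permP => l; rewrite perm1.
have := congr1 (fun J : ind => J l) E; rewrite !ffunE perm1 => E'.
by apply: pos_inj; rewrite ?blk_permP.
Qed.

Lemma tens_hw_neq0 : tens_hw <> 0.
Proof. by move=> E; have := tens_hw_pos; rewrite E ffunE => /esym/eqP; rewrite oner_eq0. Qed.

Definition swap (l l' : Sl) (J : ind) : ind := [ffun k => J (tperm l l' k)].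

Lemma tens_hw_alt l l' J : blk l = blk l' -> l != l' -> tens_hw (swap l l' J) = - tens_hw J.
Proof.
move=> bl ll'; rewrite !ffunE -sumrN (reindex_inj (mulgI (tperm l l'))) /=.
have bt k : blk (tperm l l' k) = blk k by case: tpermP => [->|->|].
apply: eq_big => [s|s _].
  apply/forallP/forallP => H k; last by rewrite permM; apply/eqP; rewrite (eqP (H _)).
  by have := H (tperm l l' k); rewrite permM tpermK bt.
rewrite odd_permM odd_tperm ll' /= signrN mulNr; congr (- (_ * _%:R)).
congr (nat_of_bool _); apply/eqP/eqP => [E|->]; apply/ffunP => k; last by rewrite !ffunE permM.
by have := congr1 (fun J : ind => J (tperm l l' k)) E; rewrite !ffunE permM tpermK.
Qed.

Lemma tens_act_alt l l' x (phi : T) : (forall J, phi (swap l l' J) = - phi J) ->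
  forall J, actT x phi (swap l l' J) = - actT x phi J.
Proof.
move=> alt J; rewrite !tens_actE -sumrN (reindex_inj (@perm_inj _ (tperm l l'))) /=.
apply: eq_bigr => k _; rewrite -sumrN; apply: eq_bigr => c _.
rewrite ffunE tpermK -mulrN; congr (_ * _); rewrite -alt; congr (phi _).
apply/ffunP => k'; rewrite !ffunE; congr (if _ then _ else _).
by rewrite -(inj_eq (@perm_inj _ (tperm l l'))) tpermK.
Qed.

(** Suppose the coordinate J of x vT is nonzero. Then x lowered the value c of some slot l to J l <
    c, and since positions in a block form an initial segment, another slot of the block already
    holds the value J l. Swapping the two slots fixes J, so antisymmetry makes the coordinate
    zero. *)
Lemma tens_hw_nplus x : x \in nplus C n -> actT x tens_hw = 0.
Proof.
case/sp_suppP => _ x0; apply/ffunP => J; rewrite [RHS]ffunE; apply/eqP; apply: contraT => nz.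
have [l [c [xl vl]]] : exists l c, x (J l) c != 0 /\ tens_hw (upd J l c) != 0.
  apply: contrapT => no; case/eqP: nz; rewrite tens_actE big1 // => l _.
  rewrite big1 // => c _; apply/eqP; rewrite mulf_eq0; apply: contraT.
  by rewrite negb_or => /andP[h1 h2]; case: no; exists l, c.
have lt : (J l < c)%N by apply: contraT => /x0 E; rewrite E eqxx in xl.
have [s bs E] := tens_hw_supp vl.
have Ek k : upd J l c k = pos (s k) by rewrite E ffunE.
have cE : c = pos (s l) by rewrite -Ek updE.
have [l1 bl1 pl1] : exists2 l', blk l' = blk (s l) & pos l' = J l by apply: pos_init; rewrite -cE.
pose l2 := (s^-1)%g l1; have sl2 : s l2 = l1 by rewrite permKV.
have bl2 : blk l = blk l2 by rewrite -(blk_permP l2 bs) sl2 bl1 blk_permP.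
have ll2 : l != l2.
  by apply: contraTneq lt => ll2; rewrite cE ll2 sl2 pl1 -ll2 ltnn.
have Jl2 : J l2 = J l by rewrite -pl1 -sl2 -Ek updN // eq_sym.
have Jsw : swap l l2 J = J.
  by apply/ffunP => k; rewrite ffunE; case: tpermP => [->|->|].
have := tens_act_alt x (fun J => tens_hw_alt J bl2 ll2) J; rewrite Jsw => /eqP.
by rewrite -subr_eq0 opprK -mulr2n mulrn_eq0 /= (negPf nz).
Qed.

Definition slot_weight (h : M) : C := \sum_l h (pos l) (pos l).

Lemma tens_hw_cartan h : h \in cartan C n -> actT h tens_hw = slot_weight h *: tens_hw.
Proof.
case/sp_suppP => _ h0; apply/ffunP => J; rewrite [RHS]ffunE tens_actE.
have -> : \sum_l \sum_c h (J l) c * tens_hw (upd J l c) = (\sum_l h (J l) (J l)) * tens_hw J.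
  rewrite mulr_suml; apply: eq_bigr => l _; rewrite (bigD1 (J l)) //= upd_id big1 ?addr0 // => c cl.
  by rewrite h0 ?mul0r // eq_sym.
have [->|nz] := eqVneq (tens_hw J) 0; first by rewrite mulr0 scaler0.
have [s bs ->] := tens_hw_supp nz; congr (_ * _).
rewrite /slot_weight [RHS](reindex_inj (@perm_inj _ s)) /=.
by apply: eq_bigr => l _; rewrite ffunE.
Qed.

Section SL2.
Variables (e f : M) (k : nat).
Hypothesis e_sp : e \in sp C n.
Hypothesis f_sp : f \in sp C n.
Hypothesis e_nplus : e \in nplus C n.
Hypothesis dag_f : dag f = e.
Hypothesis h_cartan : lie_br e f \in cartan C n.
Hypothesis hf : lie_br (lie_br e f) f = - 2 *: f.
Hypothesis h_weight : slot_weight (lie_br e f) = k%:R.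
Local Notation fpow N := (iter N (actT f) tens_hw).

Let mT := @tens_is_sp_module C n Sl.

Lemma sl2_h N : actT (lie_br e f) (fpow N) = (k%:R - (N.*2)%:R) *: fpow N.
Proof.
elim: N => [|N IH]; first by rewrite /= tens_hw_cartan // h_weight subr0.
have := act_br mT (fpow N) (lie_br_sp e_sp f_sp) f_sp; rewrite hf (actZ mT) //.
rewrite IH linearZ => /eqP; rewrite eq_sym subr_eq => /eqP E; rewrite iterS E.
rewrite -scalerDl -[N.+1.*2]addnn -[N.*2]addnn !natrD -!natr1; congr (_ *: _); ring.
Qed.

Lemma sl2_e N : actT e (fpow N.+1) = (N.+1%:R * (k%:R - N%:R)) *: fpow N.
Proof.
elim: N => [|N IH].
  have e0 : actT e (fpow 0) = 0 by exact: tens_hw_nplus.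
  have := act_br mT (fpow 0) e_sp f_sp; rewrite sl2_h e0 (linear0 (actT f)).
  by move/eqP; rewrite eq_sym subr_eq addr0 => /eqP E; rewrite iterS E mul1r.
have := act_br mT (fpow N.+1) e_sp f_sp; rewrite sl2_h IH linearZ /= => /esym/eqP.
rewrite subr_eq => /eqP ->; rewrite -scalerDl; congr (_ *: _).
rewrite -addnn !natrD -!natr1; ring.
Qed.

(** The squared norm of f^(k+1) v pairs f^k v with e f^(k+1) v, and the factor k - N in [sl2_e]
    vanishes at N = k. Positive definiteness then kills the vector itself. *)
Lemma sl2_nilpotent : fpow k.+1 = 0.
Proof.
apply: herm_eq0; rewrite {1}iterS herm_act dag_f sl2_e subrr mulr0 scale0r.
by rewrite /herm big1 // => J _; rewrite ffunE rmorph0 mulr0.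
Qed.
End SL2.

End HighestWeightTensor.

(** * The cyclic submodule of the tensor product *)

Section Weights.
Variables (F : numFieldType) (n : nat) (V : lmodType F).
Local Notation I := 'I_(n + n).
Local Notation M := 'M[F]_(n + n).
Variable act : M -> {linear V -> V}.
Hypothesis mV : is_sp_module act.
Variables (v : V) (chi : F).

(** The diagonal is 2n - 1, 2n - 3, ..., 1 - 2n: this is twice the sum of the fundamental coweights,
    so every simple root takes the value 2 on it. *)
Definition height_mx : M := diag_mx (\row_(r < n + n) ((n + n)%:R - (r.*2.+1)%:R)).

Lemma height_mx_cartan : height_mx \in cartan F n.
Proof.
apply/sp_suppP; split=> [|i j ij]; last by rewrite mxE (negPf ij).
apply/spP; rewrite tr_diag_mx; apply/matrixP => i j; rewrite mxE mul_mx_diag mul_diag_mx !mxE.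
case: eqP => [->|_]; last by rewrite mul0r mulr0 addr0.
rewrite mulrC -mulrDr.
set a := (X in _ * X); suff -> : a = 0 by rewrite mulr0.
rewrite /a /=; have := ltn_ord i => lt.
have -> : ((n + n - i.+1).*2.+1)%:R = ((n + n).*2)%:R - (i.*2.+1)%:R :> F.
  by rewrite -natrB; [congr _%:R|]; lia.
by rewrite -[(n + n).*2]addnn [in LHS](natrD _ (n + n)); ring.
Qed.

Lemma lie_br_height (a b : I) : (n + n <= a + b)%N ->
  lie_br height_mx (zm F a b) = - ((a + b - (n + n)).*2.+2)%:R *: zm F a b.
Proof.
move=> ab; have hs : height_mx \in sp F n by have /sp_suppP[] := height_mx_cartan.
rewrite lie_br_zm // (bigD1 a) //= big1 => [|c ca]; last first.
  by rewrite mxE (negPf ca) mulr0n scale0r.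
rewrite (bigD1 b) //= big1 => [|c ca]; last by rewrite mxE (negPf ca) mulr0n scale0r.
rewrite !mxE !eqxx !mulr1n !addr0 -scalerDl; congr (_ *: _).
have -> : ((a + b - (n + n)).*2.+2)%:R = (a.*2.+1)%:R + (b.*2.+1)%:R - ((n + n)%:R + (n + n)%:R) :> F.
  by rewrite -!natrD -natrB; [congr _%:R|]; lia.
by ring.
Qed.

Local Notation H := (act height_mx).

Definition weight_lt (t : nat) (u : V) := exists2 s, (t <= s)%N & H u = (chi - s%:R) *: u.

Lemma weight_act x t u : x \in nminus F n ->
  u \in lin_span (weight_lt t) -> act x u \in lin_span (weight_lt t.+1).
Proof.
move=> xn /lin_spanP[k [c [w [Xw ->]]]]; rewrite linear_sum; apply: rpred_sum => j _.
rewrite linearZ; apply: rpredZ; have [s ts Hs] := Xw j.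
have [d ->] := sp_supp_expand xn.
have mem (a b : I) : (rev_ord b < a)%N -> (n + n <= a + b)%N by move=> /=; have := ltn_ord b; lia.
rewrite (act_sum mV) => [|a _]; last first.
  by apply: rpred_sum => b _; apply/rpredZ/zm_sp.
apply: rpred_sum => a _; rewrite (act_sum mV) => [|b _]; last by apply/rpredZ/zm_sp.
apply: rpred_sum => b ab; rewrite (actZ mV) ?zm_sp //; apply: rpredZ; apply: sub_lin_span.
have le := mem a b ab; exists (s + (a + b - (n + n)).*2.+2)%N; first lia.
have hs : height_mx \in sp F n by have /sp_suppP[] := height_mx_cartan.
have := act_br mV (w j) hs (zm_sp F a b); rewrite lie_br_height // (actZ mV) ?zm_sp // Hs.
rewrite linearZ => /eqP; rewrite eq_sym subr_eq => /eqP ->; rewrite -scalerDl natrD.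
by congr (_ *: _); ring.
Qed.

(** Annihilates the eigenvectors of eigenvalue chi - s with 1 <= s <= K and multiplies a
    chi-eigenvector by K!, which separates the top weight from the lower ones. *)
Definition weight_kill (K : nat) (u : V) : V :=
  foldr (fun k w => H w - (chi - k%:R) *: w) u (iota 1 K).

Lemma weight_killP K a u w : weight_kill K (a *: u + w) = a *: weight_kill K u + weight_kill K w.
Proof.
rewrite /weight_kill; elim: (iota 1 K) => //= k s ->.
rewrite linearP scalerBr scalerDr !scalerA -addrACA opprD; congr (_ + _).
by rewrite [_ * a]mulrC.
Qed.

Lemma weight_kill_eigen K s u : H u = (chi - s%:R) *: u ->
  weight_kill K u = (\prod_(k <- iota 1 K) (k%:R - s%:R)) *: u.
Proof.
move=> Hu; rewrite /weight_kill; elim: (iota 1 K) => [|k r IH].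
  by rewrite big_nil scale1r.
rewrite /= IH big_cons linearZ /= Hu !scalerA -scalerBl; congr (_ *: _); ring.
Qed.

Lemma weight_lt_indep u : H u = chi *: u -> u \in lin_span (weight_lt 1) -> u = 0.
Proof.
move=> Hu /lin_spanP[k [c [w [Xw uE]]]].
have [K Kw] : exists K, forall j, weight_kill K (w j) = 0.
  have /choice[s sP] : forall j, exists s, (0 < s)%N /\ H (w j) = (chi - s%:R) *: w j.
    by move=> j; have [s s0 Hs] := Xw j; exists s.
  exists (\max_j s j) => j; have [s0 Hs] := sP j.
  rewrite (weight_kill_eigen _ Hs) (big_rem (s j)) /= ?subrr ?mul0r ?scale0r //.
  by rewrite mem_iota s0 add1n ltnS (leq_bigmax j).
have : weight_kill K u = 0.
  rewrite uE; elim/big_rec: _ => [|j y _ E]; last by rewrite weight_killP Kw E scaler0 addr0.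
  have := weight_killP K (-1) 0 0; rewrite scaler0 addr0 scaleN1r addNr //.
have Hu0 : H u = (chi - 0%:R) *: u by rewrite subr0.
rewrite (weight_kill_eigen _ Hu0) => /eqP; rewrite scaler_eq0 => /orP[|/eqP //].
rewrite prodf_seq_eq0 => /hasP[j]; rewrite mem_iota subr0 pnatr_eq0 => /andP[j0 _] /=.
by rewrite -leqn0 leqNgt j0.
Qed.

Lemma weight_word xs : {subset xs <= nminus F n} -> H v = chi *: v ->
  foldr (fun x w => act x w) v xs \in lin_span (weight_lt (size xs)).
Proof.
move=> xsn Hv; elim: xs xsn => [|x xs IH] xsn.
  by apply: sub_lin_span; exists 0%N => //; rewrite subr0.
apply: weight_act; first by apply: xsn; rewrite inE eqxx.
by apply: IH => y ys; apply: xsn; rewrite inE ys orbT.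
Qed.

End Weights.

(** * Comparison of V(lambda) with the tensor model *)

Section Transfer.
Variables (C : numClosedFieldType) (n : nat) (Sl : finType) (B : eqType).
Local Notation I := 'I_(n + n).
Local Notation M := 'M[C]_(n + n).
Local Notation T := (tens C n Sl).
Local Notation actT := (@tens_act C n Sl).
Variables (blk : Sl -> B) (pos : Sl -> I).
Hypothesis pos_inj : forall l l', blk l = blk l' -> pos l = pos l' -> l = l'.
Hypothesis pos_init : forall l (p : I), (p < pos l)%N ->
  exists2 l', blk l' = blk l & pos l' = p.
Variables (V : lmodType C) (act : M -> {linear V -> V}).
Hypothesis mV : is_sp_module act.
Hypothesis irrV : irreducible_module act.
Variables (v : V).
Hypothesis v_neq0 : v <> 0.
Hypothesis v_nplus : forall x, x \in nplus C n -> act x v = 0.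
Hypothesis v_cartan : forall h, h \in cartan C n -> act h v = slot_weight pos h *: v.
Local Notation vT := (tens_hw C blk pos).
Local Notation W := (V * T)%type.

Definition pair_act_fun (x : M) (p : W) : W := (act x p.1, actT x p.2).
Lemma pair_act_linear x : linear (pair_act_fun x).
Proof. by move=> a p q; rewrite /pair_act_fun /= !linearP. Qed.
HB.instance Definition _ x := GRing.isLinear.Build C W W _ (pair_act_fun x) (pair_act_linear x).
Definition pair_act x : {linear W -> W} := pair_act_fun x.

Lemma pair_is_sp_module : is_sp_module pair_act.
Proof.
have [V1 V2] := mV; have [T1 T2] := @tens_is_sp_module C n Sl.
split=> [a x y u xs ys|x y u xs ys]; rewrite /= /pair_act_fun.
  by rewrite V1 // T1.
by rewrite V2 // T2.
Qed.

Local Notation w0 := ((v, vT) : W).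
Local Notation word xs := (foldr (fun x u => act x u) v xs).
Local Notation wordT xs := (foldr (fun x u => actT x u) vT xs).
Local Notation wordW xs := (foldr (fun x u => pair_act x u) w0 xs).

Lemma wordWE xs : wordW xs = (word xs, wordT xs).
Proof. by elim: xs => //= x xs ->. Qed.

(* The graph of the isomorphism from V to the submodule generated by vT. *)
Definition graph (p : W) : Prop := exists s, p \in fil (pbw pair_act w0) s.

Lemma graph_word xs : {subset xs <= nminus C n} -> graph (word xs, wordT xs).
Proof. by move=> xsn; rewrite -wordWE; exists (size xs); apply: word_fil. Qed.

Lemma graphP a p q : graph p -> graph q -> graph (a *: p + q).
Proof.
move=> [s ps] [t qt]; exists (s + t)%N; apply: rpredD; [apply: rpredZ|].
  exact: fil_le (leq_addr _ _) ps.
exact: fil_le (leq_addl _ _) qt.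
Qed.

Lemma graph_act x p : x \in sp C n -> graph p -> graph (pair_act x p).
Proof.
move=> xs [s ps]; exists s.+1; apply: (act_sp_fil pair_is_sp_module _ _ xs ps).
  by move=> e en; rewrite /= /pair_act_fun /= v_nplus // tens_hw_nplus.
by move=> h hc; rewrite /= /pair_act_fun /= v_cartan // tens_hw_cartan.
Qed.

Lemma herm0l (psi : T) : herm 0 psi = 0.
Proof. by rewrite /herm big1 // => J _; rewrite ffunE mul0r. Qed.
Lemma herm0r (psi : T) : herm psi 0 = 0.
Proof. by rewrite hermC herm0l rmorph0. Qed.

(** Write (0, y) through words in n^-. Nonempty words have lower weight, so the vanishing of the
    first component forces the coefficient of the empty word to be 0. Nonempty words in the tensor
    product are orthogonal to vT, since the adjoint of their first letter lies in n^+. *)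
Lemma graph_herm y : graph (0, y) -> herm y vT = 0.
Proof.
move=> [s /lin_spanP[k [c [u [Xu E]]]]].
have /choice[xs xsP] : forall i, exists xs, {subset xs <= nminus C n} /\ u i = (word xs, wordT xs).
  by move=> i; have [xs [xsn _ ->]] := Xu i; exists xs; rewrite wordWE.
have E1 : 0 = \sum_i c i *: word (xs i).
  rewrite -[LHS]/((0, y) : W).1 E raddf_sum; apply: eq_bigr => i _.
  by rewrite /= (xsP i).2.
have E2 : y = \sum_i c i *: wordT (xs i).
  rewrite -[LHS]/((0, y) : W).2 E raddf_sum; apply: eq_bigr => i _.
  by rewrite /= (xsP i).2.
pose a := \sum_(i | nilp (xs i)) c i.
have a0 : a = 0.
  have E1' : 0 = a *: v + \sum_(i | ~~ nilp (xs i)) c i *: word (xs i).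
    rewrite [LHS]E1 (bigID (fun i => nilp (xs i))) /=; congr (_ + _).
    by rewrite scaler_suml; apply: eq_bigr => i /nilP ->.
  have Hv := v_cartan (height_mx_cartan C n).
  have av : a *: v \in lin_span (weight_lt act (slot_weight pos (height_mx C n)) 1).
    move/eqP: E1'; rewrite eq_sym addr_eq0 => /eqP ->; rewrite rpredN.
    apply: rpred_sum => i ni; apply: rpredZ.
    have xsn := (xsP i).1; case: (xs i) ni xsn => // x r _ xsn.
    have := weight_word mV xsn Hv; apply: lin_span_min => w [s' ? ?].
    by apply: sub_lin_span; exists s' => //; apply: leq_trans _ _; last eassumption.
  have /weight_lt_indep : act (height_mx C n) (a *: v) = slot_weight pos (height_mx C n) *: (a *: v).
    by rewrite linearZ /= Hv !scalerA mulrC.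
  by move=> /(_ av) /eqP; rewrite scaler_eq0 => /orP[/eqP //|/eqP].
rewrite E2 herm_sum (bigID (fun i => nilp (xs i))) /=.
have -> : \sum_(i | nilp (xs i)) c i * herm (wordT (xs i)) vT = a * herm vT vT.
  by rewrite mulr_suml; apply: eq_bigr => i /nilP ->.
rewrite a0 mul0r add0r big1 // => i ni.
have xsn := (xsP i).1; case: (xs i) ni xsn => // x r _ xsn.
rewrite /= herm_act tens_hw_nplus ?herm0r ?mulr0 //.
by apply: dag_nminus; apply: xsn; rewrite inE eqxx.
Qed.

(** Moving adjoints of letters to the left argument keeps it among the elements (0, z) of the graph,
    so y is orthogonal to every word in vT, hence to itself. *)
Lemma graph_fst0 y : graph (0, y) -> y = 0.
Proof.
move=> Gy; apply: herm_eq0.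
have ortho xs : {subset xs <= nminus C n} -> forall z, graph (0, z) -> herm z (wordT xs) = 0.
  elim: xs => [|x xs IH] xsn z Gz; first exact: graph_herm.
  have xn : x \in nminus C n by apply: xsn; rewrite inE eqxx.
  rewrite /= -[x]dagK -herm_act; apply: IH => [t ts|].
    by apply: xsn; rewrite inE ts orbT.
  have -> : ((0, actT (dag x) z) : W) = pair_act (dag x) (0, z).
    by rewrite /= /pair_act_fun /= linear0.
  by apply: graph_act => //; apply/dag_sp/nminus_sp.
have [s /lin_spanP[k [c [u [Xu E]]]]] := Gy.
have E2 : y = \sum_i c i *: (u i).2.
  by rewrite -[LHS]/((0, y) : W).2 E raddf_sum; apply: eq_bigr.
rewrite {1}E2 herm_sum big1 // => i _; have [xs [xsn _ ->]] := Xu i.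
by rewrite wordWE /= hermC ortho // rmorph0 mulr0.
Qed.

(** The u with (u, 0) in the graph form a submodule of V. Were it all of V, subtracting (v, 0) from
    the generator would put (0, vT) in the graph, contradicting [graph_fst0]. *)
Lemma graph_snd0 y : graph (y, 0) -> y = 0.
Proof.
have [_ irr] := irrV; move=> Gy.
have [|||all0|allV] := irr (fun u => graph (u, 0)).
- by exists 0%N; apply: rpred0.
- move=> a u w Gu Gw; have := graphP a Gu Gw; congr graph.
  by rewrite [LHS]surjective_pairing; congr (_, _); rewrite -[LHS]/(a *: 0 + 0) scaler0 addr0.
- move=> x u xs Gu; have := graph_act xs Gu.
  by rewrite /= /pair_act_fun /= linear0.
- exact: all0.
have Gv : graph w0 by exists 0%N; apply: (@word_fil _ _ _ pair_act w0 [::]).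
have := graphP (-1) (allV v) Gv.
have -> : -1 *: ((v, 0) : W) + w0 = (0, vT).
  rewrite [LHS]surjective_pairing; congr (_, _).
    by rewrite -[LHS]/(-1 *: v + v) scaleN1r addNr.
  by rewrite -[LHS]/(-1 *: 0 + vT) scaler0 add0r.
by move=> /graph_fst0 E; case: (tens_hw_neq0 pos_inj E).
Qed.

Lemma graph_total d u : u \in fil_pred (pbw act v) d ->
  exists2 y, y \in fil_pred (pbw actT vT) d & graph (u, y).
Proof.
case: d => [|d] /=.
  rewrite inE => /eqP ->; exists 0; first by rewrite inE.
  by exists 0%N; apply: rpred0.
move=> /lin_spanP[k [c [w [Xw ->]]]].
have /choice[xs xsP] : forall i, exists xs, [/\ {subset xs <= nminus C n}, (size xs <= d)%N & w i = word xs].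
  by move=> i; have [xs [? ? ?]] := Xw i; exists xs.
exists (\sum_i c i *: wordT (xs i)).
  apply: rpred_sum => i _; apply: rpredZ; apply: sub_lin_span; exists (xs i).
  by have [? ? _] := xsP i.
have : graph (\sum_i c i *: ((word (xs i), wordT (xs i)) : W)).
  elim/big_rec: _ => [|i p _]; first by exists 0%N; apply: rpred0.
  by apply/graphP/graph_word; have [] := xsP i.
congr graph; rewrite [LHS]surjective_pairing !raddf_sum.
by congr (_, _); apply: eq_bigr => i _ //=; have [_ _ ->] := xsP i.
Qed.

Lemma transfer_to_tensor k (c : 'I_k -> C) (xs : 'I_k -> seq M) (P : pred 'I_k) d :
  (forall i, {subset xs i <= nminus C n}) ->
  \sum_(i | P i) c i *: word (xs i) \in fil_pred (pbw act v) d ->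
  \sum_(i | P i) c i *: wordT (xs i) \in fil_pred (pbw actT vT) d.
Proof.
move=> xsn /graph_total[y yF Gy].
have Gs : graph (\sum_(i | P i) c i *: ((word (xs i), wordT (xs i)) : W)).
  elim/big_rec: _ => [|i p _]; first by exists 0%N; apply: rpred0.
  by apply: graphP; apply: graph_word.
have := graphP (-1) Gy Gs; set S := _ + _.
have -> : S = (0, - y + \sum_(i | P i) c i *: wordT (xs i)).
  rewrite /S scaleN1r [LHS]surjective_pairing !raddfD /= !raddf_sum /=.
  by rewrite sumrN addNr.
by move=> /graph_fst0 /eqP; rewrite addrC subr_eq0 => /eqP ->.
Qed.

Lemma transfer_from_tensor xs : {subset xs <= nminus C n} -> wordT xs = 0 -> word xs = 0.
Proof. by move=> xsn E; apply: graph_snd0; rewrite -E; apply: graph_word. Qed.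

End Transfer.

(** * Coordinates detecting monomials *)

(** In the columns of index < n the signs of the symplectic form cancel and the entries are natural
    numbers; this is the source of positivity in [wordT_gt0]. *)
Lemma zm_low (F : numFieldType) n (a b r c : 'I_(n + n)) : (c < n)%N ->
  zm F a b r c = ((r == a) && (c == rev_ord b) + (r == b) && (c == rev_ord a))%:R.
Proof.
move=> cn; have JE x : sp_form F n x c = - (c == rev_ord x)%:R.
  rewrite mxE; case: eqP => [E|_]; last by rewrite oppr0.
  by rewrite ifN //; move: cn; rewrite E /=; have := ltn_ord x; lia.
rewrite zmE !JE !mulrN -opprD opprK natrD.
by case: (r == a); case: (r == b); rewrite ?mul0r ?mul1r.
Qed.

Lemma nrm_eqP K (x : 'I_K * 'I_K) a b :
  reflect ((x.1 = a /\ x.2 = b) \/ (x.1 = b /\ x.2 = a)) (nrm x == nrm (a, b)).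
Proof.
apply: (iffP eqP) => [|[[<- <-]|[<- <-]]]; last 2 first.
- by rewrite -surjective_pairing.
- by rewrite [RHS]nrmC -surjective_pairing.
by case: x => c d; rewrite /nrm /=; case: leqP => _; case: leqP => _ [-> ->]; auto.
Qed.

Lemma uncross_lt (u w p q k r : nat) : (w < u -> p < q -> q < k ->
  u * (k - q.+1) + (w * (k - p.+1) + r) < u * (k - p.+1) + (w * (k - q.+1) + r))%N.
Proof. nia. Qed.

Section Detection.
Variables (C : numClosedFieldType) (n : nat) (Sl : finType) (B : eqType).
Local Notation I := 'I_(n + n).
Local Notation M := 'M[C]_(n + n).
Local Notation ind := {ffun Sl -> I}.
Local Notation actT := (@tens_act C n Sl).
Variables (blk : Sl -> B) (pos : Sl -> I) (ty : Sl -> nat).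
Hypothesis pos_inj : forall l l', blk l = blk l' -> pos l = pos l' -> l = l'.
Hypothesis ty_blk : forall l l', blk l = blk l' -> ty l = ty l'.
Hypothesis pos_ty : forall l, (pos l < ty l)%N.
Hypothesis ty_n : forall l, (ty l <= n)%N.
Local Notation vT := (tens_hw C blk pos).
Local Notation wordT xs := (foldr (fun x u => actT x u) vT xs).
Local Notation zmw w := (map (fun x : I * I => zm C x.1 x.2) w).
Implicit Types (J K : ind) (l : Sl) (w : seq (I * I)).

Definition moved J := [pred l | (ty l <= J l)%N].
(** If the letters of a word carry the slots from their values K to their values J, these are the
    letters used: the entry (J l, K l) of a matrix [zm] belongs to the pair of J l and
    [rev_ord (K l)]. *)
Definition edges J K : seq (I * I) := [seq nrm (J l, rev_ord (K l)) | l <- enum (moved J)].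

Lemma tens_hw_moved J : vT J != 0 -> moved J =1 pred0.
Proof.
move=> /tens_hw_supp[s bs ->] l; rewrite /= ffunE; apply/negbTE; rewrite -ltnNge.
by rewrite -(ty_blk (blk_permP l bs)) pos_ty.
Qed.

Lemma moved_upd J l c l' : moved (upd J l c) l' = if l' == l then (ty l <= c)%N else moved J l'.
Proof. by rewrite /= ffunE; case: eqP => // ->. Qed.

Lemma perm_moved_upd J l (c : I) : moved J l -> (c < ty l)%N ->
  perm_eq (enum (moved J)) (l :: enum (moved (upd J l c))).
Proof.
move=> ml cl; apply: uniq_perm; rewrite ?enum_uniq //=.
  by rewrite mem_enum inE updE -ltnNge cl enum_uniq.
move=> l'; rewrite inE !mem_enum !inE ffunE.
by case: eqP => [->|//]; rewrite orTb; apply: ml.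
Qed.

Lemma card_moved_upd J l (c : I) : (#|moved J| <= #|moved (upd J l c)|.+1)%N.
Proof.
rewrite -add1n -(card1 l) -cardUI; apply: leq_trans (leq_addr _ _).
apply/subset_leq_card/subsetP => l'; rewrite !inE /= ffunE.
by case: eqP.
Qed.

Lemma card_moved_eq J l (c : I) : #|moved J| = #|moved (upd J l c)|.+1 ->
  moved J l /\ (c < ty l)%N.
Proof.
move=> E; have sub : (#|moved J| <= #|predU1 l (moved (upd J l c))|)%N.
  by apply/subset_leq_card/subsetP => l'; rewrite !inE /= ffunE; case: eqP.
move: (sub); rewrite cardU1 E; case: (boolP (l \in moved (upd J l c))); rewrite ?ltnn //.
rewrite inE /= updE -ltnNge => cl _; split=> //; apply: contraT => nml.
suff : (#|moved J| <= #|moved (upd J l c)|)%N by rewrite E ltnn.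
apply/subset_leq_card/subsetP => l'; rewrite !inE /= ffunE.
by case: eqP => // ->; rewrite (negPf nml).
Qed.

(** Each term of the action of a letter changes a single slot, and vT is supported on multi-indices
    with no moved slot. *)
Lemma wordT_low (xs : seq M) J : (size xs < #|moved J|)%N -> wordT xs J = 0.
Proof.
elim: xs J => [|x xs IH] J lt.
  apply/eqP; apply: contraTT lt => /tens_hw_moved E.
  by rewrite (eq_card E) card0.
rewrite /= -/(wordT xs) -[tens_act_fun x _]/(actT x _) tens_actE big1 // => l _; rewrite big1 // => c _.
by rewrite IH ?mulr0 //; have := card_moved_upd J l c; move: lt => /=; lia.
Qed.

Lemma edges_upd J K l (c : I) : moved J l -> (c < ty l)%N ->
  perm_eq (edges J K) (nrm (J l, rev_ord (K l)) :: edges (upd J l c) K).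
Proof.
move=> ml cl; rewrite /edges (permPl (perm_map _ (perm_moved_upd ml cl))) /= perm_cons.
rewrite (_ : map _ _ = edges (upd J l c) K) //; apply/eq_in_map => l'.
rewrite mem_enum inE ffunE; case: eqP => // ->.
by rewrite leqNgt cl.
Qed.

Lemma wordT_step w J l (c : I) : #|moved J| = (size w).+1 ->
  wordT (zmw w) (upd J l c) != 0 -> [/\ moved J l, (c < ty l)%N & #|moved (upd J l c)| = size w].
Proof.
move=> sz nz; have E : #|moved (upd J l c)| = size w.
  apply/eqP; rewrite eqn_leq; have := card_moved_upd J l c; rewrite sz ltnS => -> //.
  by rewrite andbT leqNgt; apply: contraNN nz => lt; rewrite wordT_low ?size_map.
have [] := @card_moved_eq J l c; rewrite ?E ?sz //.
Qed.

(** With as many letters as moved slots, each letter must move exactly one slot, directly from its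
    value in a support point of vT. Such a point is a block permutation s of the initial positions,
    and the word is determined by s up to reordering. *)
Lemma wordT_supp w J : #|moved J| = size w -> wordT (zmw w) J != 0 ->
  exists s, [/\ blk_perm blk s, forall l, ~~ moved J l -> pos (s l) = J l &
     perm_eq (map (@nrm _) w) (edges J (perm_pos pos s))].
Proof.
elim: w J => [|x w IH] J sz nz.
  have [s bs E] := tens_hw_supp nz; exists s; split=> // [l _|]; first by rewrite E ffunE.
  by rewrite /edges (_ : enum _ = [::]) //; apply/nilP; rewrite /nilp -cardE sz.
have [l [c [zl wl]]] : exists l c, zm C x.1 x.2 (J l) c != 0 /\ wordT (zmw w) (upd J l c) != 0.
  apply: contrapT => no; case/eqP: nz.
  rewrite /= -[tens_act_fun _ _]/(actT _ _) tens_actE big1 // => l _.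
  rewrite big1 // => c _; apply/eqP; rewrite mulf_eq0; apply: contraT.
  by rewrite negb_or => /andP[h1 h2]; case: no; exists l, c.
have [ml cl sz'] := wordT_step sz wl.
have [s [bs un pe]] := IH _ sz' wl; exists s.
have sl : pos (s l) = c by rewrite un ?updE //= updE -ltnNge.
split=> // [l' ml'|].
  have ll' : l' != l by apply: contraNneq ml' => ->.
  by rewrite un ?updN //= updN.
rewrite (permPr (edges_upd _ ml cl)) ffunE sl /=.
suff -> : nrm x = nrm (J l, rev_ord c) by rewrite perm_cons.
apply/eqP/nrm_eqP; case/zm_neq0/orP: zl => /andP[/eqP-> /eqP->]; rewrite rev_ordK; auto.
Qed.

(** Every contributing path ends at the identity permutation, where vT has value 1, and uses
    nonnegative matrix entries. No cancellation can occur, and at least one path contributes. *)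
Lemma wordT_gt0 w J : (forall l, ~~ moved J l -> J l = pos l) ->
  perm_eq (map (@nrm _) w) (edges J (perm_pos pos 1%g)) ->
  (forall s, blk_perm blk s -> (forall l, ~~ moved J l -> pos (s l) = J l) ->
     perm_eq (map (@nrm _) w) (edges J (perm_pos pos s)) -> s = 1%g) ->
  0 < wordT (zmw w) J.
Proof.
elim: w J => [|x w IH] J Jpos pe uni.
  have Jp : J = perm_pos pos 1%g.
    apply/ffunP => l; rewrite ffunE perm1; apply: Jpos.
    have := perm_size pe; rewrite /edges /= size_map -cardE => /esym/card0_eq/(_ l).
    by rewrite inE /= => ->.
  by rewrite /= Jp tens_hw_pos ?ltr01.
have sz : #|moved J| = (size w).+1.
  by have := perm_size pe; rewrite /edges !size_map -cardE => <-.
have stepP l : moved J l -> nrm x = nrm (J l, rev_ord (pos l)) ->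
    0 < zm C x.1 x.2 (J l) (pos l) * wordT (zmw w) (upd J l (pos l)).
  move=> ml nx; have cl := pos_ty l.
  have edgE s : blk_perm blk s -> pos (s l) = pos l ->
    perm_eq (map (@nrm _) (x :: w)) (edges J (perm_pos pos s)) =
    perm_eq (map (@nrm _) w) (edges (upd J l (pos l)) (perm_pos pos s)).
    by move=> bs sl; rewrite (permPr (edges_upd _ ml cl)) ffunE sl /= nx perm_cons.
  have b1 : blk_perm blk 1%g by apply/forallP => k; rewrite perm1.
  apply: mulr_gt0.
    rewrite zm_low; last exact: leq_trans cl (ty_n l).
    rewrite ltr0n addn_gt0 !lt0b.
    by have /eqP/nrm_eqP[[-> ->]|[-> ->]] := nx; rewrite rev_ordK !eqxx ?orbT.
  apply: IH => [k|| s bs un].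
  - rewrite moved_upd ffunE; case: eqP => [->//|_]; exact: Jpos.
  - by rewrite -edgE ?perm1.
  - have sl : pos (s l) = pos l by rewrite un ?updE // moved_upd eqxx -ltnNge.
    rewrite -edgE //; apply: uni => // k mk.
    have kl : k != l by apply: contraNneq mk => ->.
    by rewrite un ?updN // moved_upd (negPf kl).
have termP l c : 0 <= zm C x.1 x.2 (J l) c * wordT (zmw w) (upd J l c).
  have [->|zl] := eqVneq (zm C x.1 x.2 (J l) c) 0; first by rewrite mul0r.
  have [->|wl] := eqVneq (wordT (zmw w) (upd J l c)) 0; first by rewrite mulr0.
  have [ml cl sz'] := wordT_step sz wl.
  have [s [bs un pe']] := wordT_supp sz' wl.
  have sl : pos (s l) = c by rewrite un ?updE //= updE -ltnNge.
  have nx : nrm x = nrm (J l, rev_ord c).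
    apply/eqP/nrm_eqP; case/zm_neq0/orP: zl => /andP[/eqP-> /eqP->]; rewrite rev_ordK; auto.
  have s1 : s = 1%g.
    apply: uni => // [k mk|].
      have kl : k != l by apply: contraNneq mk => ->.
      by rewrite un ?updN //= updN.
    by rewrite (permPr (edges_upd _ ml cl)) ffunE sl /= nx perm_cons.
  have cE : c = pos l by rewrite -sl s1 perm1.
  by rewrite cE in nx *; apply/ltW/stepP.
have [l ml nx] : exists2 l, moved J l & nrm x = nrm (J l, rev_ord (pos l)).
  have : nrm x \in edges J (perm_pos pos 1%g) by rewrite -(perm_mem pe) /= inE eqxx.
  by case/mapP => l; rewrite mem_enum => ml ->; exists l => //; rewrite ffunE perm1.
rewrite /= -[tens_act_fun _ _]/(actT _ _) tens_actE (bigD1 l) //= (bigD1 (pos l)) //=.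
rewrite -addrA ltr_wpDr ?stepP // addr_ge0 // sumr_ge0 // => k _; rewrite ?termP //.
by apply: sumr_ge0 => c _; apply: termP.
Qed.

Section Rearrangement.
Variable J : ind.
Hypothesis J_fix : forall l, ~~ moved J l -> J l = pos l.
Hypothesis J_decr : forall l l', moved J l -> moved J l' -> blk l = blk l' ->
  (pos l < pos l')%N -> (J l' < J l)%N.

Lemma qval_edges s : qval (edges J (perm_pos pos s)) =
  (\sum_(l | moved J l) J l * rev_ord (pos (s l)))%N.
Proof.
have -> : edges J (perm_pos pos s) = map (@nrm _) [seq (J l, rev_ord (pos (s l))) | l <- enum (moved J)].
  by rewrite -map_comp; apply: eq_map => l; rewrite /= ffunE.
by rewrite qval_nrm /qval big_map big_enum.
Qed.

(** Rearrangement inequality: within a block, J and the reversed position decrease together, so the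
    identity matching maximises the sum of products. The induction swaps the image of the displaced
    slot of least position back into place, which fixes one more slot. *)
Lemma qval_edges_max s : blk_perm blk s -> (forall l, ~~ moved J l -> pos (s l) = J l) ->
  s != 1%g -> (qval (edges J (perm_pos pos s)) < qval (edges J (perm_pos pos 1%g)))%N.
Proof.
have [k] := ubnP #|[pred l | s l != l]|; elim: k s => // k IH s le_sk bs un s1.
have fixd l : ~~ moved J l -> s l = l.
  by move=> ml; apply: pos_inj; [apply: blk_permP | rewrite un // J_fix].
have [l0 sl0] : exists l, s l != l.
  apply/existsP; apply: contraNT s1 => /existsPn all1; apply/eqP/permP => l.
  by rewrite perm1; apply/eqP; have := all1 l; rewrite negbK.
pose l := [arg min_(l < l0 | s l != l) pos l].
have [sl lmin] : s l != l /\ forall k, s k != k -> (pos l <= pos k)%N.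
  by rewrite /l; case: arg_minnP.
pose l' := (s^-1)%g l; have sl' : s l' = l by rewrite permKV.
have nl' : l' != l by apply: contraNneq sl => E; rewrite -{1}E sl'.
have ml : moved J l by apply: contraT => /fixd E; rewrite E eqxx in sl.
have ml' : moved J l' by apply: contraT => /fixd E; rewrite sl' in E; rewrite E eqxx in nl'.
have bl : blk l' = blk l by rewrite -sl' blk_permP.
have lt1 : (pos l < pos l')%N.
  rewrite ltn_neqAle lmin ?andbT; last by rewrite sl' eq_sym.
  by apply: contraNneq nl' => /val_inj E; apply/eqP/pos_inj.
have lt2 : (pos l < pos (s l))%N.
  rewrite ltn_neqAle lmin ?andbT ?(inj_eq perm_inj) //.
  by apply: contraNneq sl => /val_inj E; apply/eqP/pos_inj; [apply: blk_permP | rewrite E].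
have Jlt := J_decr ml ml' (esym bl) lt1.
pose s' := (tperm l l' * s)%g.
have s'l : s' l = l by rewrite permM tpermL.
have s'l' : s' l' = s l by rewrite permM tpermR.
have s'N j : j != l -> j != l' -> s' j = s j by move=> *; rewrite permM tpermD // eq_sym.
have lt : (qval (edges J (perm_pos pos s)) < qval (edges J (perm_pos pos s')))%N.
  have D (f : Sl -> nat) : (\sum_(j | moved J j) f j =
      f l + (f l' + \sum_(j | moved J j && (j != l) && (j != l')) f j))%N.
    by rewrite (bigD1 l) // (bigD1 l') //= [X in X && _]ml' nl'.
  rewrite !qval_edges !D s'l s'l' sl'.
  rewrite [X in (_ < _ + (_ + X))%N](eq_bigr (fun j => J j * rev_ord (pos (s j)))%N).
    exact: uncross_lt Jlt lt2 (ltn_ord _).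
  by move=> j /andP[/andP[_ jl] jl']; rewrite s'N.
have [s'1|s'1] := eqVneq s' 1%g; first by rewrite -s'1.
apply: ltn_trans lt _; apply: IH => //.
- rewrite -ltnS; apply: leq_trans le_sk; rewrite ltnS; apply: proper_card.
  apply/properP; split; last by exists l; rewrite !inE ?s'l ?eqxx.
  apply/subsetP => j; rewrite !inE; case: (eqVneq j l) => [->|jl]; first by rewrite s'l eqxx.
  case: (eqVneq j l') => [-> _|jl']; last by rewrite s'N.
  by rewrite sl' eq_sym.
- apply/forallP => j; case: (eqVneq j l) => [->|jl]; first by rewrite s'l.
  case: (eqVneq j l') => [->|jl']; last by rewrite s'N // blk_permP.
  by rewrite s'l' blk_permP // bl.
move=> j mj; rewrite s'N ?un //; first by apply: contraNneq mj => ->.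
by apply: contraNneq mj => ->.
Qed.

Lemma wordT_detect w : #|moved J| = size w ->
  (qval (edges J (perm_pos pos 1%g)) <= qval w)%N ->
  wordT (zmw w) J != 0 -> perm_eq (map (@nrm _) w) (edges J (perm_pos pos 1%g)).
Proof.
move=> sz le nz; have [s [bs un pe]] := wordT_supp sz nz.
have [<-//|s1] := eqVneq s 1%g.
by have := qval_edges_max bs un s1; rewrite -(qval_perm pe) qval_nrm ltnNge le.
Qed.

Lemma wordT_detect_gt0 w : perm_eq (map (@nrm _) w) (edges J (perm_pos pos 1%g)) ->
  0 < wordT (zmw w) J.
Proof.
move=> pe; apply: wordT_gt0 => // s bs un pe'; apply/eqP; apply: contraT => s1.
have := qval_edges_max bs un s1.
by rewrite -(qval_perm pe') (qval_perm pe) ltnn.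
Qed.

End Rearrangement.

End Detection.

Local Close Scope ring_scope.

(** * Decomposition of admissible exponents *)

Lemma perm_uniq_subset (T : eqType) (t s : seq T) : uniq t -> {subset t <= s} ->
  exists r, perm_eq s (t ++ r).
Proof.
elim: t s => [|x t IH] s; first by exists s.
move=> /andP[xt ut] ts; have xs : x \in s by apply: ts; rewrite inE eqxx.
have [|r rP] := IH (rem x s) ut.
  move=> y yt; have yx : y != x by apply: contraNneq xt => <-.
  have : y \in s by apply: ts; rewrite inE yt orbT.
  by rewrite (perm_mem (perm_to_rem xs)) inE (negPf yx).
by exists r; rewrite (permPl (perm_to_rem xs)) perm_cons.
Qed.

Section Minkowski.
Variable n : nat.
Local Notation I := 'I_(n + n).
Implicit Types (m : 'I_n -> nat) (x y : I * I) (s t c r : seq (I * I)).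

(* The roots on which the fundamental weight of index i is nonzero. *)
Definition region (i : 'I_n) x := (n + n <= i.+1 + x.2) && (i < x.1).

Definition antichain (i : 'I_n) t :=
  [&& uniq t, all (@allowed n) t, all (region i) t
   & all (fun x : I * I => all (fun y : I * I => nested x y ==> (x == y)) t) t].

Lemma pairing_cons m (i j : 'I_n) : i <= j -> pairing m i j = m i + pairing m i.+1 j.
Proof.
move=> ij; rewrite /pairing (bigD1 i) ?leqnn //=; congr (_ + _).
apply: eq_bigl => a; rewrite -val_eqE /=; lia.
Qed.

Lemma pairing_low m (i k : 'I_n) j : (forall a : 'I_n, a < i -> m a = 0) -> k <= i ->
  pairing m k j = pairing m i j.
Proof.
move=> m0 ki; rewrite /pairing (bigID (fun a : 'I_n => a < i)) /= big1 ?add0n => [|a /andP[_ /m0] //].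
apply: eq_bigl => a; lia.
Qed.

Lemma pairing_dec m (i k j : 'I_n) : 0 < m i ->
  pairing m k j = (k <= i <= j) + pairing (fun a => m a - (a == i)) k j.
Proof.
move=> mi; rewrite /pairing; have [kij|kij] := boolP (k <= i <= j).
  rewrite (bigD1 i) //= [in RHS](bigD1 i) //= eqxx add1n -addSn subn1 prednK //; congr (_ + _).
  by apply: eq_bigr => a /andP[_ /negPf ->]; rewrite subn0.
by rewrite add0n; apply: eq_bigr => a; case: eqP => [->|_ _]; rewrite ?(negPf kij) ?subn0.
Qed.

Lemma nest_trans x y z : nest x y -> nest y z -> nest x z.
Proof.
rewrite /nest => /andP[h1 h2] /andP[h3 h4].
by rewrite (leq_trans h1 h3) (leq_trans h4 h2).
Qed.

Section Step.
Variables (m : 'I_n -> nat) (s : seq (I * I)) (i : 'I_n).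
Hypothesis s_adm : adm m s.
Hypothesis mi : 0 < m i.
Hypothesis m_low : forall a : 'I_n, a < i -> m a = 0.

(** Only one copy of each outermost element is taken; further copies remain in the exponent for
    later rounds. *)
Definition min_region := undup [seq x <- s |
  region i x && all (fun y : I * I => region i y && nest y x ==> (y == x)) s].

Lemma min_regionP x : x \in min_region -> [/\ x \in s, region i x &
  forall y : I * I, y \in s -> region i y -> nest y x -> y = x].
Proof.
rewrite mem_undup mem_filter => /andP[/andP[rx /allP al] xs]; split=> // y ys ry yx.
by apply/eqP; have := al y ys; rewrite ry yx.
Qed.

Lemma adm_allowed x : x \in s -> allowed x.
Proof. by have [al _] := s_adm => xs; apply: (allP al). Qed.

Lemma min_region_antichain : antichain i min_region.
Proof.
apply/and4P; split; first exact: undup_uniq.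
- by apply/allP => x /min_regionP[xs _ _]; apply: adm_allowed.
- by apply/allP => x /min_regionP[_ rx _].
apply/allP => x /min_regionP[xs rx mx]; apply/allP => y /min_regionP[ys ry my].
by apply/implyP => /orP[xy|yx]; [rewrite (my x) | rewrite (mx y)].
Qed.

Lemma min_region_below x : x \in s -> region i x -> exists2 g : I * I, g \in min_region & nest g x.
Proof.
have [k] := ubnP (x.1 + (n + n - x.2)); elim: k x => // k IH x le xs rx.
have [al|] := boolP (all (fun y : I * I => region i y && nest y x ==> (y == x)) s).
  by exists x; rewrite ?mem_undup ?mem_filter ?rx ?al // /nest !leqnn.
case/allPn => y ys; rewrite negb_imply => /andP[/andP[ry yx] ney].
have lt : y.1 + (n + n - y.2) < x.1 + (n + n - x.2).
  move: yx ney; rewrite /nest -(inj_eq (@inj_id _)); case: x {le xs rx} => a b; case: y {ys ry} => c d /=.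
  rewrite xpair_eqE -!val_eqE /=; have := ltn_ord b; have := ltn_ord d; lia.
have [|g gm gy] := IH y _ ys ry; first by apply: leq_trans lt _; rewrite -ltnS.
by exists g => //; apply: nest_trans gy yx.
Qed.

(** A root with x.1 <= i only involves simple roots of index below i, where m vanishes; its bound
    would be 0, and it is a nested family by itself. *)
Lemma adm_above x : x \in s -> i < x.1.
Proof.
move=> xs; have /andP[x12 xx] := adm_allowed xs; rewrite ltnNge; apply/negP => xi.
have [_ admP] := s_adm; have := ltn_ord i; have := ltn_ord x.2 => lt2 lti.
have kn : n + n - x.2.+1 < n by lia.
have jn : x.1.-1 < n by lia.
have := admP [:: x] (rem x s) (Ordinal kn) (Ordinal jn) (perm_to_rem xs).
have -> : all2rel (@nested _) [:: x].
  by apply/allrelP => a b; rewrite !inE => /eqP-> /eqP->; rewrite /nested /nest !leqnn.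
have -> : within (Ordinal kn) (Ordinal jn) [:: x].
  rewrite /within /= !andbT; apply/andP; split; first lia.
  by apply/implyP; lia.
move=> /(_ isT) H; have : (Ordinal kn <= Ordinal jn) by move=> /=; lia.
move=> /H /(_ isT); rewrite /pairing big1 // => a /=; move=> /andP[_ aj].
by apply: m_low; lia.
Qed.

(** Only intervals containing i lose one unit. For those, a nested family c in the remainder either
    avoids the region of i, and the smaller bound starting at i + 1 applies with m i > 0 to spare,
    or it can be enlarged by a removed element g enclosing all of it, and the old bound for g :: c
    gives the gain of one. *)
Lemma adm_sub r : perm_eq s (min_region ++ r) -> adm (fun a => m a - (a == i)) r.
Proof.
move=> sE; have rs : {subset r <= s} by move=> x xr; rewrite (perm_mem sE) mem_cat xr orbT.
split; first by apply/allP => x /rs; apply: adm_allowed.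
move=> c d k j rE cn kj wc; have [_ admP] := s_adm.
have cs x : x \in c -> x \in s by move=> xc; apply: rs; rewrite (perm_mem rE) mem_cat xc.
have sE2 : perm_eq s (c ++ (min_region ++ d)).
  rewrite (permPl sE) perm_sym perm_catCA perm_cat2l perm_sym //.
have := admP c _ k j sE2 cn kj wc; rewrite (pairing_dec k j mi).
have [/andP[ki ij]|//] := boolP (k <= i <= j); rewrite add1n => _.
suff : size c < pairing m i j by rewrite -(pairing_low j m_low ki) (pairing_dec k j mi) ki ij add1n ltnS.
have [/hasP[b0 b0c rb0]|/hasPn nor] := boolP (has (region i) c); last first.
  rewrite pairing_cons //; case: c cn wc nor cs sE2 {rE} => [|x c] cn wc nor cs sE2.
    by rewrite addn_gt0 mi.
  have xc : x \in x :: c by rewrite inE eqxx.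
  have above (y : I * I) : y \in x :: c -> i.+1 + y.2 < n + n.
    by move=> yc; have := nor y yc; rewrite /region adm_above ?cs // andbT ltnNge.
  have /andP[x12 xx] := adm_allowed (cs x xc); have xi := above x xc.
  have i1n : i.+1 < n by lia.
  have i1j : i.+1 <= j.
    have [jn|jn] := ltnP j.+1 n; last by have := ltn_ord j; lia.
    by have /andP[_ /implyP/(_ jn)/allP/(_ x xc) /= xj] := wc; lia.
  rewrite -add1n leq_add //.
  apply: (admP (x :: c) (min_region ++ d) (Ordinal i1n) j) => //.
  case/andP: wc => _ wc; apply/andP; split=> //.
  by apply/allP => y /above.
have fne : filter (region i) c != [::] by rewrite -has_filter; apply/hasP; exists b0.
have [|b] := nested_outermost fne.
  apply/allrelP => x y; rewrite !mem_filter => /andP[_ xc] /andP[_ yc]; exact: (allrelP cn).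
rewrite mem_filter => /andP[rb bc] bout.
have [g gm gb] := min_region_below (cs b bc) rb.
have gc y : y \in c -> nest g y.
  move=> yc; apply: nest_trans gb _; have [ry|] := boolP (region i y).
    by apply: bout; rewrite mem_filter ry yc.
  rewrite /region adm_above ?cs // andbT -ltnNge => yi.
  have /orP[//|/andP[_ by2]] := allrelP cn b y bc yc.
  by case/andP: rb => rb _; move: yi; rewrite ltnNge (leq_trans rb) // leq_add2l.
have [gs rg _] := min_regionP gm; have /andP[g12 gg] := adm_allowed gs.
(* The interval is extended to the left so that it also accommodates g. This leaves the bound
   unchanged, because m vanishes below i. *)
have gn : minn k (n + n - g.2.+1) < n by rewrite gtn_min ltn_ord.
have := admP (g :: c) (rem g min_region ++ d) (Ordinal gn) j.
rewrite (pairing_low (k := Ordinal gn) j m_low) ?geq_min ?ki //; apply.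
- rewrite (permPl sE) (permPl (perm_cat (perm_to_rem gm) rE)) /= perm_cons.
  by rewrite perm_catCA.
- apply/allrelP => x y; rewrite !inE => /predU1P[->|xc] /predU1P[->|yc].
  + by rewrite /nested /nest !leqnn.
  + by rewrite /nested gc.
  + by rewrite /nested orbC gc.
  + exact: (allrelP cn).
- by rewrite kj.
case/andP: wc => /allP w1 /implyP w2; apply/andP; split.
  apply/allP => y; rewrite inE => /predU1P[->|/w1] /=.
    by rewrite -[X in _ < X](subnK (ltn_ord g.2)) addnS ltnS leq_add2r geq_minr.
  by apply: leq_ltn_trans; rewrite leq_add2r geq_minl.
apply/implyP => jn; rewrite /= (w2 jn) andbT.
have /= := allP (w2 jn) b bc; apply: leq_trans.
by case/andP: gb.
Qed.

End Step.

(* For the least i with m i > 0, the outermost elements of s in the region of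
   omega_i form an antichain, and removing it lowers by one every bound that
   involves m i. *)
Lemma adm_decomposition m s : adm m s ->
  exists L : seq ('I_n * seq (I * I)), [/\ perm_eq s (flatten (unzip2 L)),
    forall i, count_mem i (unzip1 L) = m i & forall p, p \in L -> antichain p.1 p.2].
Proof.
have [k] := ubnP (\sum_i m i); elim: k m s => // k IH m s le_k s_adm.
have [i0 mi0|m0] := pickP (fun i => 0 < m i); last first.
  exists [::]; split=> // [|i]; last by have := m0 i; rewrite lt0n => /negbFE/eqP ->.
  case: s s_adm => // x s s_adm; have mz a : m a = 0 by apply/eqP; have := m0 a; rewrite lt0n => /negbFE.
  have [al admP] := s_adm; have /andP[x12 xx] := allP al x (mem_head _ _).
  have lt2 := ltn_ord x.2.
  have kn : n + n - x.2.+1 < n by lia.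
  have jn : n.-1 < n by lia.
  have := admP [:: x] s (Ordinal kn) (Ordinal jn) (perm_refl _).
  have -> : all2rel (@nested _) [:: x].
    by apply/allrelP => a b; rewrite !inE => /eqP-> /eqP->; rewrite /nested /nest !leqnn.
  have -> : within (Ordinal kn) (Ordinal jn) [:: x].
    by rewrite /within /= !andbT; apply/andP; split; [lia | apply/implyP; lia].
  rewrite /pairing big1 // => H; have := H isT _ isT; rewrite /= => /(_ ltac:(lia)) //.
pose i := [arg min_(i < i0 | 0 < m i) (i : nat)].
have [mi imin] : 0 < m i /\ forall j : 'I_n, 0 < m j -> i <= j by rewrite /i; case: arg_minnP.
have m_low (a : 'I_n) : a < i -> m a = 0.
  by move=> ai; apply/eqP; rewrite -leqn0 leqNgt; apply: contraL ai => /imin; rewrite leqNgt.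
have [r sE] : exists r, perm_eq s (min_region s i ++ r).
  by apply: perm_uniq_subset; [apply: undup_uniq | move=> x /min_regionP[]].
have r_adm := adm_sub s_adm mi m_low sE.
have [|L [rE cL aL]] := IH _ r _ r_adm.
  rewrite -ltnS; apply: leq_trans le_k; rewrite ltnS.
  rewrite [X in _ < X](bigD1 i) //= [X in X < _](bigD1 i) //= eqxx.
  rewrite -addSn subn1 prednK // leq_add2l; apply: leq_sum => a _; exact: leq_subr.
exists ((i, min_region s i) :: L); split.
- by rewrite (permPl sE) perm_cat2l.
- move=> a; rewrite /= cL; case: (eqVneq i a) => [<-|ia]; first by rewrite ?eqxx add1n subn1 prednK.
  by rewrite add0n subn0.
- by move=> p; rewrite inE => /predU1P[->|/aL //]; apply: min_region_antichain s_adm.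
Qed.

End Minkowski.

Local Open Scope ring_scope.

(** * The tensor coordinate attached to a family of antichains *)

Section Slots.
Variables (n N : nat) (kf : 'I_N -> 'I_n).
Local Notation I := 'I_(n + n).

(* The slots of the tensor product of the representations of highest weights
   omega_(kf b): block b has one slot for each position up to kf b. *)
Definition slot_pred : {pred 'I_N * 'I_n} := fun x => (x.2 <= kf x.1)%N.
Definition slot := {x : 'I_N * 'I_n | x \in slot_pred}.
Definition slot_blk (l : slot) : 'I_N := (val l).1.
Definition slot_pos (l : slot) : I := lshift n (val l).2.
Definition slot_ty (l : slot) : nat := (kf (slot_blk l)).+1.

Lemma slot_pos_inj l l' : slot_blk l = slot_blk l' -> slot_pos l = slot_pos l' -> l = l'.
Proof.
move=> bl /lshift_inj pl; apply: val_inj.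
by rewrite [LHS]surjective_pairing [RHS]surjective_pairing -/(slot_blk l) bl pl.
Qed.

Lemma slot_exists b (p : I) : (p <= kf b)%N -> exists l, slot_blk l = b /\ slot_pos l = p.
Proof.
move=> pb; have pn : (p < n)%N by apply: leq_ltn_trans pb _.
have mem : (b, Ordinal pn) \in slot_pred by [].
by exists (Sub (b, Ordinal pn) mem); split; rewrite /slot_blk /slot_pos SubK //; apply: val_inj.
Qed.

Lemma slot_pos_ty l : (slot_pos l < slot_ty l)%N.
Proof. exact: (valP l). Qed.

Lemma slot_pos_init l (p : I) : (p < slot_pos l)%N ->
  exists2 l', slot_blk l' = slot_blk l & slot_pos l' = p.
Proof.
move=> pl; have [|l' [? ?]] := @slot_exists (slot_blk l) p; last by exists l'.
by rewrite -ltnS; apply: ltnW; apply: leq_ltn_trans pl (slot_pos_ty l).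
Qed.

Lemma slot_ty_blk l l' : slot_blk l = slot_blk l' -> slot_ty l = slot_ty l'.
Proof. by rewrite /slot_ty => ->. Qed.

Lemma slot_ty_n l : (slot_ty l <= n)%N. Proof. exact: ltn_ord. Qed.

Lemma slot_weightE (C : numClosedFieldType) (m : 'I_n -> nat) (h : 'M[C]_(n + n)) :
  (forall i, #|[pred b | kf b == i]| = m i) ->
  slot_weight slot_pos h = wt (\sum_(i < n) fund_weight i *+ m i) h.
Proof.
move=> kfm; rewrite /slot_weight.
rewrite -(big_sub slot_pred (fun x => h (lshift n x.2) (lshift n x.2))) big_mkcond /=.
rewrite -(pair_bigA _ (fun b p => if (b, p) \in slot_pred then h (lshift n p) (lshift n p) else 0)) /=.
rewrite exchange_big /=; apply: eq_bigr => p _.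
rewrite -big_mkcond sumr_const -mulr_natl; congr (_ * _).
rewrite summxE rmorph_sum /=.
have cast i : ((fund_weight i *+ m i) 0 p)%:~R = ((p <= i) * #|[pred b | kf b == i]|)%N%:R :> C.
  by rewrite kfm mulmxnE mxE -mulrnA natz -pmulrn.
under [RHS]eq_bigr => i _ do rewrite cast.
rewrite -natr_sum; congr _%:R; rewrite -sum1_card (partition_big kf predT) //=.
apply: eq_bigr => i _.
case: (leqP p i) => pi; rewrite ?mul0n ?mul1n.
  rewrite -sum1_card; apply: eq_bigl => b; rewrite [RHS]inE.
  by case: eqP => E; rewrite ?andbF ?andbT //; apply: (introT idP); rewrite -E in pi.
rewrite big_pred0 // => b; case: eqP => E; rewrite ?andbF ?andbT //.
by apply/negbTE; rewrite -ltnNge E.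
Qed.

Section Coordinate.
Variable tb : 'I_N -> seq (I * I).
Hypothesis tb_anti : forall b, antichain (kf b) (tb b).

(** A pair (a, rev p) in the antichain sends the slot at position p to a. There is at most one such
    a, as two pairs sharing an end are nested. The region condition puts p inside the block and a
    beyond it, so the slot counts as moved. *)
Definition slot_target (l : slot) := [pick a | (a, rev_ord (slot_pos l)) \in tb (slot_blk l)].
Definition slot_coord : {ffun slot -> I} := [ffun l => odflt (slot_pos l) (slot_target l)].

Local Notation mv := (moved slot_ty slot_coord).

Lemma tb_props b (x : I * I) : x \in tb b -> [/\ (x.1 <= x.2)%N, (n + n <= x.1 + x.2)%N,
  (n + n <= (kf b).+1 + x.2)%N & (kf b < x.1)%N].
Proof.
by have /and4P[_ /allP al /allP re _] := tb_anti b => xb;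
   have /andP[? ?] := al x xb; have /andP[? ?] := re x xb.
Qed.

Lemma tb_nested b (x y : I * I) : x \in tb b -> y \in tb b -> nested x y -> x = y.
Proof.
have /and4P[_ _ _ /allP an] := tb_anti b => xb yb nxy.
by apply/eqP; have /allP/(_ y yb)/implyP := an x xb; apply.
Qed.

Lemma moved_slotP l : reflect ((slot_coord l, rev_ord (slot_pos l)) \in tb (slot_blk l)) (mv l).
Proof.
rewrite /moved /= ffunE /slot_target; case: pickP => [a al|no] /=.
  have [_ _ _ lt] := tb_props al.
  by rewrite /slot_ty (lt : (kf (slot_blk l)).+1 <= a)%N; apply: ReflectT.
by rewrite leqNgt slot_pos_ty no; apply: ReflectF.
Qed.

Lemma slot_coord_fix l : ~~ mv l -> slot_coord l = slot_pos l.
Proof.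
rewrite /moved /= ffunE /slot_target; case: pickP => [a al|no] //=.
have [_ _ _ lt] := tb_props al.
by rewrite /slot_ty (lt : (kf (slot_blk l)).+1 <= a)%N.
Qed.

(** If the targets did not decrease while the positions increase, the two pairs would be nested,
    against the antichain condition. *)
Lemma slot_coord_decr l l' : mv l -> mv l' -> slot_blk l = slot_blk l' ->
  (slot_pos l < slot_pos l')%N -> (slot_coord l' < slot_coord l)%N.
Proof.
move=> /moved_slotP ml /moved_slotP ml' bl lt; rewrite -bl in ml'.
rewrite ltnNge; apply/negP => le.
have /(tb_nested ml ml') : nested (slot_coord l, rev_ord (slot_pos l)) (slot_coord l', rev_ord (slot_pos l')).
  by rewrite /nested /nest le /= leq_sub2l // ltnS ltnW.
by move=> /(congr1 snd) /= /rev_ord_inj E; rewrite E ltnn in lt.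
Qed.

Local Notation edge l := (slot_coord l, rev_ord (slot_pos l)).

Lemma slot_edges : perm_eq (edges slot_ty slot_coord (perm_pos slot_pos 1%g))
  (flatten [seq tb b | b <- enum 'I_N]).
Proof.
have -> : edges slot_ty slot_coord (perm_pos slot_pos 1%g) = [seq edge l | l <- enum mv].
  apply/eq_in_map => l; rewrite mem_enum => /moved_slotP ml.
  rewrite [perm_pos _ _ _]ffunE perm1 /nrm ifT //.
  by have [] := tb_props ml.
apply/allP => x _ /=; apply/eqP; rewrite count_map -size_filter.
have -> : count_mem x (flatten [seq tb b | b <- enum 'I_N]) = #|[pred b | x \in tb b]|.
  rewrite count_flatten -map_comp sumnE big_map big_enum /= -sum1_card [RHS]big_mkcond /=.
  apply: eq_bigr => b _; rewrite inE count_uniq_mem; first by case: (x \in tb b).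
  by have /and4P[] := tb_anti b.
set fs := filter _ _; pose A := [set l | mv l && (edge l == x)].
have <- : #|fs| = size fs by apply/card_uniqP; rewrite filter_uniq ?enum_uniq.
have -> : #|fs| = #|A|.
  by apply: eq_card => l; rewrite /fs mem_filter mem_enum !inE andbC.
have inj : {in A &, injective slot_blk}.
  move=> l l'; rewrite !inE => /andP[_ /eqP lx] /andP[_ /eqP lx'] bl.
  apply: slot_pos_inj => //; apply: rev_ord_inj.
  by rewrite -[LHS]/((edge l).2) lx -lx'.
rewrite -(card_in_imset inj); apply: eq_card => b; rewrite inE.
apply/imsetP/idP => [[l]|xb].
  by rewrite inE => /andP[/moved_slotP ml /eqP <-] ->.
have [x12 xx xk kx] := tb_props xb.
have [l [lb lp]] : exists l, slot_blk l = b /\ slot_pos l = rev_ord x.2.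
  by apply: slot_exists => /=; have := ltn_ord x.2; lia.
have xE : slot_coord l = x.1.
  rewrite ffunE /slot_target; case: pickP => [a|/(_ x.1)]; rewrite lb lp rev_ordK.
    move=> ab /=; have /tb_nested : (a, x.2) \in tb b by [].
    move=> /(_ x xb); rewrite /nested /nest /= leqnn !andbT => /(_ (leq_total _ _)).
    by case: (x) => c d /= [].
  by rewrite -surjective_pairing xb.
have eE : edge l = x by rewrite xE lp rev_ordK -surjective_pairing.
exists l => //; rewrite inE eE eqxx andbT; apply/moved_slotP.
by rewrite eE lb.
Qed.

End Coordinate.
End Slots.

(** * Root vectors *)

Section Roots.
Variables (F : numFieldType) (n : nat).
Local Notation I := 'I_(n + n).
Local Notation M := 'M[F]_(n + n).
Local Notation li := (@lshift n n).

Lemma sp_entry0 (x : M) (r c : I) : x \in sp F n -> x r c = 0 -> x (rev_ord c) (rev_ord r) = 0.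
Proof.
move=> /sp_mulJ /matrixP /(_ c (rev_ord r)).
have -> : (sp_form F n *m x) c (rev_ord r) = sp_form F n c (rev_ord c) * x (rev_ord c) (rev_ord r).
  rewrite mxE (bigD1 (rev_ord c)) //= big1 ?addr0 // => k kc.
  by rewrite sp_formN ?mul0r.
have -> : (- (x^T *m sp_form F n)) c (rev_ord r) = - (x r c * sp_form F n r (rev_ord r)).
  rewrite mxE mxE (bigD1 r) //= big1 ?addr0 ?mxE // => k kr.
  by rewrite sp_formN ?mulr0 // (inj_eq rev_ord_inj) eq_sym.
move=> E r0; move: E; rewrite r0 mul0r oppr0 => /eqP; rewrite mulf_eq0 => /orP[|/eqP //].
by rewrite mxE eqxx; case: ifP => _; rewrite ?oppr_eq0 oner_eq0.
Qed.

(* The coordinate matrix of the cartan subalgebra dual to epsilon_i. *)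
Definition cart (i : 'I_n) : M := zm F (li i) (rev_ord (li i)).

Lemma lt_rev (i : 'I_n) : (rev_ord (li i) < n)%N = false.
Proof. by apply/negbTE; rewrite -leqNgt /=; have := ltn_ord i; lia. Qed.

Lemma cartE i (r c : I) : cart i r c =
  ((r == li i) && (c == li i))%:R - ((r == rev_ord (li i)) && (c == rev_ord (li i)))%:R.
Proof.
rewrite /cart zmE !mxE rev_ordK lt_rev /= ltn_ord opprD.
by case: (r == _); case: (c == li i); case: (r == rev_ord _); case: (c == rev_ord _);
  rewrite /= ?(mul1r, mul0r, mulr1, mulr0, opprK, oppr0, addr0, add0r, subr0).
Qed.

Lemma cart_cartan i : cart i \in cartan F n.
Proof. by apply: zm_supp; rewrite ?rev_ordK. Qed.

Lemma lie_br_diag (h f : M) r c : h \in cartan F n ->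
  lie_br h f r c = (h r r - h c c) * f r c.
Proof.
case/sp_suppP => _ h0; rewrite /lie_br mxE [X in _ + X]mxE mulrBl; congr (_ - _).
  by rewrite mxE (bigD1 r) //= big1 ?addr0 // => k kr; rewrite h0 ?mul0r // eq_sym.
by rewrite mxE (bigD1 c) //= big1 ?addr0 1?mulrC // => k kr; rewrite h0 ?mulr0.
Qed.

Lemma lshift_rev (i j : 'I_n) : (li i == rev_ord (li j)) = false.
Proof. by apply/negbTE; rewrite -val_eqE /=; have := ltn_ord i; have := ltn_ord j; lia. Qed.

Lemma wt_cart (a : 'rV[int]_n) i : wt a (cart i) = (a 0 i)%:~R.
Proof.
rewrite /wt (bigD1 i) //= big1 => [|j ji].
  by rewrite cartE !eqxx lshift_rev subr0 mulr1 addr0.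
by rewrite cartE (inj_eq (@lshift_inj _ _)) (negPf ji) lshift_rev subr0 mulr0.
Qed.

Lemma simple_rootE (k p : 'I_n) : simple_root k 0 p =
  (p == k)%:R - (p == k.+1 :> nat)%:R + ((k.+1 == n) && (p == k))%:R.
Proof.
rewrite mxE; case: eqP => [kn|_] /=; last by rewrite addr0.
have -> : (p == k.+1 :> nat) = false by apply/negbTE; rewrite kn neq_ltn ltn_ord.
by rewrite subr0 mulr2n.
Qed.

Lemma sum_pick (P : pred 'I_n) (p : 'I_n) : \sum_(k < n | P k) (p == k)%:R = (P p)%:R :> int.
Proof.
rewrite big_mkcond (bigD1 p) //= eqxx big1 ?addr0; first by case: (P p).
by move=> k; rewrite eq_sym => /negPf->; case: (P k).
Qed.

Lemma sum_pickS (P : pred nat) (p : 'I_n) :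
  \sum_(k < n | P k) (p == k.+1 :> nat)%:R = ((0 < p)%N && P p.-1)%:R :> int.
Proof.
case: (posnP p) => [p0|p0].
  by rewrite big1 // => k _; rewrite p0.
have p1n : (p.-1 < n)%N by have := ltn_ord p; lia.
rewrite -(sum_pick P (Ordinal p1n)); apply: eq_bigr => k _.
by congr (nat_of_bool _)%:R; rewrite -val_eqE /=; lia.
Qed.

Lemma alphaE (i j p : 'I_n) : (i <= j)%N -> (j.+1 < n)%N ->
  alpha n i j 0 p = (p == i)%:R - (p == j.+1 :> nat)%:R.
Proof.
move=> ij jn; rewrite /alpha summxE.
under eq_bigr => k kij.
  rewrite simple_rootE (_ : (k.+1 == n) = false) ?addr0; last by apply/negbTE; lia.
  over.
rewrite sumrB sum_pick (sum_pickS (fun k => i <= k <= j)%N) -val_eqE /=.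
move: (nat_of_ord p) (nat_of_ord i) (nat_of_ord j) ij {jn} => {}p {}i {}j ij.
by case: (boolP (i <= p <= j)%N) => h1; case: (boolP ((0 < p) && (i <= p.-1 <= j))%N) => h2;
  case: (p =P i) => h3; case: (p =P j.+1) => h4 //; lia.
Qed.

Lemma alpha_barE (i p : 'I_n) : alpha_bar n i i 0 p = (p == i)%:R *+ 2.
Proof.
have lp := ltn_ord p; have lti := ltn_ord i.
rewrite /alpha_bar mxE !summxE.
under eq_bigr => k _ do rewrite simple_rootE.
rewrite big_split sumrB /= sum_pick (sum_pickS (fun k => i <= k)%N).
have -> : \sum_(k < n | (i <= k)%N) ((k.+1 == n) && (p == k))%:R = (p.+1 == n)%:R :> int.
  rewrite (eq_bigr (fun k => (p.+1 == n)%:R * (p == k)%:R)) => [|k _]; last first.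
    by rewrite -natrM; case: (p =P k) => [<-|_]; rewrite ?andbF ?andbT ?muln0 ?muln1.
  rewrite -mulr_sumr sum_pick -natrM; congr _%:R.
  by case: eqP => pn; rewrite ?mul0n // mul1n; have -> : (i <= p)%N by lia.
under eq_bigr => k kij.
  rewrite simple_rootE (_ : (k.+1 == n) = false) ?addr0; last by apply/negbTE; lia.
  over.
rewrite sumrB sum_pick (sum_pickS (fun k => (i <= k) && (k.+1 < n))%N) -val_eqE /=.
move: (nat_of_ord p) (nat_of_ord i) lp lti => {}p {}i lp lti.
by case: (boolP (i <= p)%N) => h1; case: (boolP ((0 < p) && (i <= p.-1))%N) => h2;
  case: (boolP ((i <= p) && (p.+1 < n))%N) => h5;
  case: (boolP [&& (0 < p)%N, (i <= p.-1)%N & (p.-1.+1 < n)%N]) => h6;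
  case: (p =P i) => h3; case: (p.+1 =P n) => h4 //; lia.
Qed.

(** Bracketing with a diagonal matrix scales each entry separately, so every nonzero position of a
    root vector has the weight of the root; characteristic zero turns this into an equality of
    integers. *)
Lemma root_entry (a : 'rV[int]_n) (f : M) r c i : neg_root_vector a f -> f r c != 0 ->
  ((r == li i)%:R - (r == rev_ord (li i))%:R) - ((c == li i)%:R - (c == rev_ord (li i))%:R)
    = - a 0 i.
Proof.
move=> [_ /(_ _ (cart_cartan i)) E] nz; have : (cart i r r - cart i c c) * f r c = - (a 0 i)%:~R * f r c.
  by rewrite -lie_br_diag ?cart_cartan // E wt_cart mxE.
move=> /(mulIf nz) {}E; rewrite !cartE !andbb in E.
apply: (@intr_inj F); rewrite rmorphN /= -E !rmorphB /=.
by rewrite !rmorph_nat.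
Qed.

Lemma zm_scale_eq (x : M) (a b : I) : x \in sp F n ->
  (forall r c, x r c != 0 -> (r == a) && (c == rev_ord b) || (r == b) && (c == rev_ord a)) ->
  exists k, x = k *: zm F a b.
Proof.
move=> xsp supp; have nzab : zm F a b a (rev_ord b) != 0.
  have nz1 : sp_form F n b (rev_ord b) != 0.
    by rewrite mxE eqxx; case: ifP => _; rewrite ?oppr_eq0 oner_eq0.
  rewrite zmE eqxx oppr_eq0; case: (eqVneq a b) => [->|_]; last by rewrite mul0r addr0 mul1r.
  by rewrite !mul1r -mulr2n mulrn_eq0.
pose k := x a (rev_ord b) / zm F a b a (rev_ord b).
exists k; pose y := x - k *: zm F a b.
have ysp : y \in sp F n by rewrite rpredB // rpredZ // zm_sp.
have y1 : y a (rev_ord b) = 0 by rewrite /y mxE [X in _ + X]mxE mxE /k divfK ?subrr.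
have y2 : y b (rev_ord a) = 0 by have := sp_entry0 ysp y1; rewrite rev_ordK.
suff : y = 0 by move/eqP; rewrite subr_eq0 => /eqP.
apply/matrixP => r c; rewrite [RHS]mxE.
have [/orP[]/andP[/eqP-> /eqP->] //|no] :=
  boolP ((r == a) && (c == rev_ord b) || (r == b) && (c == rev_ord a)).
have x0 : x r c = 0 by apply/eqP; apply: contraNT no => /supp.
have z0 : zm F a b r c = 0 by apply/eqP; apply: contraNT no => /zm_neq0.
by rewrite /y mxE [X in _ + X]mxE mxE x0 z0 mulr0 subr0.
Qed.

Lemma short_root_vector (i j : 'I_n) (l : I) (f : M) : (i <= j)%N -> (j.+1 < n)%N ->
  l = j.+1 :> nat -> neg_root_vector (alpha n i j) f -> f <> 0 ->
  exists2 k, k != 0 & f = k *: zm F l (rev_ord (li i)).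
Proof.
move=> ij jn lE fr fn0; have lti := ltn_ord i.
have ln : (l < n)%N by rewrite lE.
pose l' := Ordinal ln; have l'E : li l' = l by apply: val_inj.
have fsp : f \in sp F n by have [/nminus_sp] := fr.
have [|k fE] := @zm_scale_eq f l (rev_ord (li i)) fsp.
- move=> r c nz; have := root_entry i fr nz; have := root_entry l' fr nz.
  rewrite !alphaE // !l'E rev_ordK.
  have -> : (i == j.+1 :> nat) = false by lia.
  have -> : (l' == i) = false by rewrite -val_eqE /= lE; lia.
  have -> : (l' == j.+1 :> nat) by rewrite /= lE.
  rewrite eqxx -!val_eqE /= lE.
  have := ltn_ord r; have := ltn_ord c; move: (nat_of_ord r) (nat_of_ord c) => {nz}r {}c.
  do 8!case: eqP => //=; lia.
by exists k => //; apply: contra_not_neq fn0 => k0; rewrite fE k0 scale0r.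
Qed.

Lemma long_root_vector (i : 'I_n) (f : M) : neg_root_vector (alpha_bar n i i) f -> f <> 0 ->
  exists2 k, k != 0 & f = k *: zm F (rev_ord (li i)) (rev_ord (li i)).
Proof.
move=> fr fn0; have lti := ltn_ord i.
have fsp : f \in sp F n by have [/nminus_sp] := fr.
have [|k fE] := @zm_scale_eq f (rev_ord (li i)) (rev_ord (li i)) fsp.
- move=> r c nz; have := root_entry i fr nz.
  rewrite alpha_barE rev_ordK eqxx orbb -!val_eqE /=.
  have := ltn_ord r; have := ltn_ord c; move: (nat_of_ord r) (nat_of_ord c) => {nz}r {}c.
  do 4!case: eqP => //=; lia.
by exists k => //; apply: contra_not_neq fn0 => k0; rewrite fE k0 scale0r.
Qed.

Lemma zm_mixedE (i j : 'I_n) (r c : I) : zm F (li i) (rev_ord (li j)) r c =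
  ((r == li i) && (c == li j))%:R - ((r == rev_ord (li j)) && (c == rev_ord (li i)))%:R.
Proof.
rewrite zmE !mxE rev_ordK lt_rev /= ltn_ord opprD.
by case: (r == _); case: (c == li j); case: (r == rev_ord _); case: (c == rev_ord _);
  rewrite /= ?(mul1r, mul0r, mulr1, mulr0, opprK, oppr0, addr0, add0r, subr0).
Qed.

Lemma zm_topE (i : 'I_n) (r c : I) : zm F (rev_ord (li i)) (rev_ord (li i)) r c =
  ((r == rev_ord (li i)) && (c == li i))%:R *+ 2.
Proof.
rewrite zmE !mxE rev_ordK lt_rev -mulr2n.
by case: (r == _); case: (c == _); 
  rewrite /= ?(mul1r, mul0r, mulr1, mulr0, mulrN1, mulNrn, opprK, oppr0, mul0rn).
Qed.

Lemma zm_bottomE (i : 'I_n) (r c : I) : zm F (li i) (li i) r c =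
  - ((r == li i) && (c == rev_ord (li i)))%:R *+ 2.
Proof.
rewrite zmE !mxE /= ltn_ord -mulr2n -mulNrn.
by case: (r == _); case: (c == _); rewrite /= ?(mul1r, mul0r, mulr1, mulr0).
Qed.

Lemma lie_br_cartan_zm h a b : h \in cartan F n ->
  lie_br h (zm F a b) = (h a a + h b b) *: zm F a b.
Proof.
case/sp_suppP => hsp h0; rewrite lie_br_zm // (bigD1 a) //= big1 ?addr0 => [|c ca]; last first.
  by rewrite h0 ?scale0r.
rewrite (bigD1 b) //= big1 ?addr0 => [|c cb]; last first.
  by rewrite h0 ?scale0r.
by rewrite scalerDl.
Qed.

Lemma lie_br_short (i j : 'I_n) :
  lie_br (zm F (li i) (rev_ord (li j))) (zm F (li j) (rev_ord (li i))) = cart i - cart j.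
Proof.
rewrite lie_br_zm ?zm_sp //; congr (_ + _).
  rewrite (bigD1 (li i)) //= big1 ?addr0 => [|c ci].
    by rewrite zm_mixedE !eqxx !lshift_rev subr0 scale1r.
  by rewrite zm_mixedE (negPf ci) lshift_rev andbF subr0 scale0r.
rewrite (bigD1 (rev_ord (li j))) //= big1 ?addr0 => [|c ci].
  rewrite zm_mixedE !eqxx [_ == li i]eq_sym lshift_rev /= sub0r scaleN1r.
  by [].
by rewrite zm_mixedE (negPf ci) [_ == li j]eq_sym lshift_rev andbF subr0 scale0r.
Qed.

Lemma lie_brZ k (x y : M) : lie_br x (k *: y) = k *: lie_br x y.
Proof. by rewrite /lie_br -scalemxAr -scalemxAl scalerBr. Qed.

(** The diagonal [zm] matrices are 2 or -2 times a matrix unit. The halves and the sign normalise e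
    and f to two matrix units that are transposes of each other, as the sl2 argument requires. *)
Lemma lie_br_long (i : 'I_n) :
  lie_br (- 2^-1 *: zm F (li i) (li i)) (2^-1 *: zm F (rev_ord (li i)) (rev_ord (li i))) = cart i.
Proof.
rewrite lie_brZ lie_br_zm ?rpredZ ?zm_sp //.
have S (g : I -> M) : \sum_c (- 2^-1 *: zm F (li i) (li i)) c (rev_ord (li i)) *: g c = g (li i).
  rewrite (bigD1 (li i)) //= big1 ?addr0 => [|c ci]; rewrite mxE zm_bottomE ?(negPf ci).
    by rewrite !eqxx mulNrn mulrNN mulVf ?pnatr_eq0 // scale1r.
  by rewrite oppr0 mul0rn mulr0 scale0r.
rewrite !S [zm F (rev_ord _) _]zmC -mulr2n -scaler_nat scalerA mulVf ?pnatr_eq0 // scale1r.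
by [].
Qed.

End Roots.

(** * The annihilator *)

Lemma foldr_nseq (A B : Type) (g : A -> B -> B) (x : A) u k :
  foldr g u (nseq k x) = iter k (g x) u.
Proof. by elim: k => //= k ->. Qed.

Lemma undup_combination (A : eqType) (F : fieldType) (V : lmodType F) (g : A -> V)
    k (c : 'I_k -> F) (s : 'I_k -> A) :
  exists (X : seq A) (d : A -> F), [/\ uniq X, (forall x, x \in X -> exists i, x = s i)
    & \sum_i c i *: g (s i) = \sum_(x <- X) d x *: g x].
Proof.
pose X := undup [seq s i | i <- enum 'I_k]; pose d x := \sum_(i | s i == x) c i.
exists X, d; split=> [|x|]; first exact: undup_uniq.
  by rewrite mem_undup => /mapP[i _ ->]; exists i.
have -> : \sum_(x <- X) d x *: g x = \sum_(x <- X) \sum_(i | s i == x) c i *: g (s i).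
  by apply: eq_bigr => x _; rewrite scaler_suml; apply: eq_bigr => i /eqP ->.
rewrite (exchange_big_dep predT) //=; apply: eq_bigr => i _.
rewrite -big_filter (_ : [seq x <- X | s i == x] = [:: s i]) ?big_seq1 //.
rewrite (@eq_filter _ _ (pred1 (s i))) => [|x]; last by rewrite /= eq_sym.
apply: filter_pred1_uniq; first exact: undup_uniq.
by rewrite mem_undup; apply/mapP; exists i; rewrite ?mem_enum.
Qed.

Section Canonical.
Variable K : nat.
Local Notation T := ('I_K * 'I_K)%type.

(** An arbitrary total order, used to choose one sequence for each multiset of pairs. *)
Definition edge_le (x y : T) := (enum_rank x <= enum_rank y)%N.

Lemma edge_sort_perm (s t : seq T) : perm_eq s t -> sort edge_le s = sort edge_le t.
Proof.
apply/perm_sortP => [x y|y x z|x y].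
- exact: leq_total.
- exact: leq_trans.
by rewrite /edge_le -eqn_leq => /eqP/val_inj/enum_rank_inj.
Qed.
End Canonical.

(** * Vanishing and independence in gr V(lambda) *)

Section Main.
Variables (C : numClosedFieldType) (n : nat) (m : 'I_n -> nat).
Local Notation I := 'I_(n + n).
Local Notation M := 'M[C]_(n + n).
Local Notation li := (@lshift n n).
Variables (V : lmodType C) (act : M -> {linear V -> V}).
Hypothesis mV : is_sp_module act.
Hypothesis irrV : irreducible_module act.
Variable v : V.
Local Notation lam := (\sum_(i < n) fund_weight i *+ m i).
Hypothesis v_neq0 : v <> 0.
Hypothesis v_nplus : forall x, x \in nplus C n -> act x v = 0.
Hypothesis v_cartan : forall h, h \in cartan C n -> act h v = wt lam h *: v.
Local Notation Snm := (Sym (nminus C n)).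
Local Notation Z := (@Zg C n).
Local Notation zmw w := (map (fun x : I * I => zm C x.1 x.2) w).
Local Notation Ann p := (annihilator act v p).

Section Blocks.
Variable L : seq ('I_n * seq (I * I)).
Hypothesis L_count : forall i, count_mem i (unzip1 L) = m i.

Definition block_index (b : 'I_(size L)) : 'I_n := (tnth (in_tuple L) b).1.

Lemma block_index_count i : #|[pred b | block_index b == i]| = m i.
Proof.
rewrite -L_count -sum1_card -sum1_count big_map [RHS]big_tnth /=.
by apply: eq_bigl => b; rewrite inE.
Qed.

Lemma v_slot_weight h : h \in cartan C n ->
  act h v = slot_weight (slot_pos (kf := block_index)) h *: v.
Proof. by move=> hc; rewrite v_cartan // (slot_weightE _ block_index_count). Qed.

End Blocks.

Lemma wt_lam_cart i : wt lam (cart C i) = (\sum_(k < n | (i <= k)%N) m k)%:R.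
Proof.
rewrite wt_cart summxE.
rewrite (eq_bigr (fun k : 'I_n => ((i <= k)%N * m k)%N%:R)) => [|k _]; last first.
  by rewrite mulmxnE mxE -mulrnA.
rewrite -natr_sum natz -pmulrn; congr _%:R; rewrite [RHS]big_mkcond.
by apply: eq_bigr => k _; case: ifP; rewrite ?mul1n ?mul0n.
Qed.

Lemma wtB (a : 'rV[int]_n) (x y : M) : wt a (x - y) = wt a x - wt a y.
Proof. by rewrite /wt -sumrB; apply: eq_bigr => k _; rewrite mxE [X in _ + X]mxE mulrBr. Qed.

Lemma adm_nil : adm m [::].
Proof.
split=> // c r k j /perm_size /=; rewrite size_cat => /esym/eqP.
by rewrite addn_eq0 => /andP[/eqP -> _].
Qed.

Lemma root_nilpotent e f N : e \in nplus C n -> f \in nminus C n -> dag f = e ->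
  lie_br e f \in cartan C n -> lie_br (lie_br e f) f = - 2 *: f ->
  wt lam (lie_br e f) = N%:R -> iter N.+1 (act f) v = 0.
Proof.
(* Decomposing the empty exponent supplies a list of blocks in which each index i occurs m i times,
   so the tensor product has highest weight lambda. *)
move=> en fn df hc hf hw; have [L [_ Lc _]] := adm_decomposition adm_nil.
rewrite -(foldr_nseq (fun x u => act x u)).
have xsn : {subset nseq N.+1 f <= nminus C n} by move=> x; rewrite mem_nseq => /andP[_ /eqP ->].
apply: (transfer_from_tensor (@slot_pos_inj _ _ (block_index (L:=L))) (@slot_pos_init _ _ _)
   mV irrV v_neq0 v_nplus (v_slot_weight Lc) xsn).
rewrite (foldr_nseq (fun x u => tens_act _ x u)).
apply: (sl2_nilpotent (@slot_pos_init _ _ _) _ _ en df hc hf).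
- exact: nplus_sp.
- exact: nminus_sp.
- by rewrite (slot_weightE _ (block_index_count Lc)).
Qed.

Lemma short_nilpotent (i j : 'I_n) (l : I) : (i <= j)%N -> (j.+1 < n)%N -> l = j.+1 :> nat ->
  iter (pairing m i j).+1 (act (zm C l (rev_ord (li i)))) v = 0.
Proof.
move=> ij jn lE; pose l' := Ordinal jn; have -> : l = li l' by apply: val_inj.
have lti := ltn_ord i; have il : l' != i by rewrite -val_eqE /=; lia.
apply: (@root_nilpotent (zm C (li i) (rev_ord (li l')))).
- by apply: zm_nplus => /=; lia.
- by apply: zm_nminus => /=; lia.
- apply/matrixP => r c; rewrite mxE [_^T _ _]mxE !zm_mixedE rmorphB /= !rmorph_nat.
  by rewrite andbC; congr (_ - _); rewrite andbC.
- by rewrite lie_br_short rpredB ?cart_cartan.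
- rewrite lie_br_short lie_br_cartan_zm ?rpredB ?cart_cartan //.
  have cB a : (cart C i - cart C l') a a = cart C i a a - cart C l' a a by rewrite mxE [X in _ + X]mxE.
  rewrite !cB !cartE !eqxx !(inj_eq rev_ord_inj) !(inj_eq (@lshift_inj _ _)).
  have rl (a b : 'I_n) : (rev_ord (li a) == li b) = false by rewrite eq_sym lshift_rev.
  have il' : (i == l') = false by rewrite eq_sym (negPf il).
  rewrite !lshift_rev !rl (negPf il) il' /=.
  by congr (_ *: _); ring.
rewrite lie_br_short wtB !wt_lam_cart.
have -> : (\sum_(k < n | (i <= k)%N) m k = pairing m i j + \sum_(k < n | (l' <= k)%N) m k)%N.
  rewrite (bigID (fun k : 'I_n => (k <= j)%N)) /= /pairing; congr (_ + _)%N.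
  by apply: eq_bigl => k /=; lia.
by rewrite natrD addrK.
Qed.

Lemma long_nilpotent (i : 'I_n) :
  iter (pairing m i n.-1).+1 (act (2^-1 *: zm C (rev_ord (li i)) (rev_ord (li i)))) v = 0.
Proof.
have lti := ltn_ord i.
apply: (@root_nilpotent (- 2^-1 *: zm C (li i) (li i))).
- by apply/rpredZ/zm_nplus => /=; lia.
- by apply/rpredZ/zm_nminus => /=; lia.
- apply/matrixP => r c; rewrite mxE [_^T _ _]mxE mxE [RHS]mxE zm_topE zm_bottomE.
  rewrite rmorphM rmorphMn fmorphV /= !rmorph_nat andbC.
  by rewrite mulNrn mulrNN.
- by rewrite lie_br_long cart_cartan.
- rewrite lie_br_long lie_brZ lie_br_cartan_zm ?cart_cartan // !cartE !eqxx.
  rewrite [rev_ord _ == li _]eq_sym lshift_rev /= scalerA [RHS]scalerA; congr (_ *: _); ring.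
rewrite lie_br_long wt_lam_cart /pairing; congr _%:R.
by apply: eq_bigl => k; have := ltn_ord k; lia.
Qed.

Lemma annihilator_genX f N : f \in nminus C n -> iter N (act f) v = 0 ->
  Ann (sym_gen (nminus C n) f ^+ N).
Proof.
move=> fn fN; rewrite /annihilator.
have -> : sym_gen (nminus C n) f ^+ N = \prod_(x <- nseq N f) sym_gen (nminus C n) x.
  by rewrite big_nseq -Monoid.iteropE; elim: N {fN} => // N IH; rewrite exprS IH.
have xsn : {subset nseq N f <= nminus C n} by move=> x; rewrite mem_nseq => /andP[_ /eqP ->].
rewrite (gr_act_word mV v_nplus v_cartan xsn) (foldr_nseq (fun x u => act x u)) fN.
exact: gr_hom0.
Qed.

Lemma mono_zmw w : all (@allowed n) w -> mono Z w = \prod_(x <- zmw w) sym_gen (nminus C n) x.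
Proof.
move=> /allP al; rewrite /mono big_map big_seq [RHS]big_seq; apply: eq_bigr => x /al /andP[_ xx].
by rewrite /Zg xx.
Qed.

Lemma zmw_nminus w : all (@allowed n) w -> {subset zmw w <= nminus C n}.
Proof. by move=> /allP al y /mapP[x /al /andP[_ xx] ->]; apply: zm_nminus. Qed.

Lemma map_nrm_allowed (w : seq (I * I)) : all (@allowed n) w -> map (@nrm _) w = w.
Proof.
move=> al; rewrite -[RHS]map_id; apply/eq_in_map => x /(allP al) /andP[x12 _].
by rewrite /nrm x12.
Qed.

(* The functional picking a suitable coordinate of the tensor product detects
   the monomial of minimal qval among those of a given degree. *)
Lemma adm_independent (X : seq (seq (I * I))) (d : seq (I * I) -> C) :
  uniq X -> {in X &, forall s t, perm_eq s t -> s = t} -> {in X, forall s, adm m s} ->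
  Ann (\sum_(s <- X) d s *: mono Z s) -> {in X, forall s, d s = 0}.
Proof.
move=> uX cX aX; have aXn s : s \in X -> all (@allowed n) s by move=> /aX[].
rewrite (big_nth [::]) big_mkord => A s sX.
apply/eqP; apply: contraT => ds.
have [s0 [s0X ds0 s0size s0min]] : exists s0, [/\ s0 \in X, d s0 != 0, size s0 = size s &
    forall t, t \in X -> d t != 0 -> size t = size s -> (qval s0 <= qval t)%N].
  suff min k s1 : s1 \in X -> d s1 != 0 -> size s1 = size s -> (qval s1 < k)%N -> exists s0,
      [/\ s0 \in X, d s0 != 0, size s0 = size s &
      forall t, t \in X -> d t != 0 -> size t = size s -> (qval s0 <= qval t)%N].
    exact: (min (qval s).+1 s).
  elim: k s1 => // k IH s1 s1X ds1 sz1 le.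
  have [/hasP[t tX /and3P[dt /eqP st lt]]|/hasPn no] :=
    boolP (has (fun t => [&& d t != 0, size t == size s & (qval t < qval s1)%N]) X).
    by apply: (IH t tX dt st); apply: leq_trans lt _; rewrite -ltnS.
  exists s1; split=> // t tX dt st; rewrite leqNgt; apply/negP => lt.
  by have := no t tX; rewrite dt st eqxx lt.
have [L [s0E Lc La]] := adm_decomposition (aX _ s0X).
pose kf := block_index (L:=L); pose tb b := (tnth (in_tuple L) b).2.
have tba b : antichain (kf b) (tb b) by apply: La; apply: mem_tnth.
pose J := slot_coord kf tb; pose E := edges (slot_ty (kf:=kf)) J (perm_pos (slot_pos (kf:=kf)) 1%g).
have EE : perm_eq E s0.
  apply: (perm_trans (slot_edges tba)); rewrite perm_sym; apply: (perm_trans s0E).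
  rewrite /tb (map_comp snd) enumT -enumT.
  rewrite (_ : [seq tnth (in_tuple L) i | i <- enum 'I_(size L)] = L) //.
  exact: (map_tnth_enum (in_tuple L)).
pose wordT w := foldr (fun x u => tens_act _ x u)
  (tens_hw C (slot_blk (kf:=kf)) (slot_pos (kf:=kf))) (zmw w).
have mJ : #|moved (slot_ty (kf:=kf)) J| = size s.
  by rewrite -s0size -(perm_size EE) size_map -cardE.
set Xn := fun i : 'I_(size X) => nth [::] X i.
have XnX i : Xn i \in X by apply: mem_nth.
have A' : Ann (\sum_(i < size X) d (Xn i) *: \prod_(x <- zmw (Xn i)) sym_gen (nminus C n) x).
  rewrite (eq_bigr (fun i => d (Xn i) *: mono Z (Xn i))) // => i _.
  by rewrite mono_zmw // aXn.
have xsn i : {subset zmw (Xn i) <= nminus C n} by apply/zmw_nminus/aXn.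
have rel := annihilator_relation mV v_nplus v_cartan (size s) xsn A'.
have := transfer_to_tensor (blk := slot_blk (kf:=kf)) (@slot_pos_init _ _ kf)
   mV v_neq0 v_nplus (v_slot_weight Lc) xsn rel.
set y := \sum_(i | _) _ => yF.
(* Membership in the previous filtration step means words with fewer letters than J has moved slots;
   in degree 0 that step is zero. *)
have y0 : y J = 0.
  case: (size s) mJ yF => [|k] mJ /=; first by rewrite inE => /eqP ->; rewrite ffunE.
  move=> /lin_spanP[r [c [u [Xu ->]]]]; rewrite sum_ffunE big1 // => i _.
  have [xs [_ szx ->]] := Xu i; rewrite ffunE (wordT_low _ (ty := slot_ty (kf:=kf))) ?scaler0 //.
  - exact: slot_ty_blk.
  - exact: slot_pos_ty.
  by rewrite mJ ltnS.
have det w : size w = size s -> (qval s0 <= qval w)%N ->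
    wordT w J != 0 -> perm_eq (map (@nrm _) w) s0.
  move=> szw le nz; apply: perm_trans (EE).
  apply: (wordT_detect (@slot_pos_inj _ _ kf) (@slot_ty_blk _ _ kf) (@slot_pos_ty _ _ kf)
    (slot_coord_fix tba) (slot_coord_decr tba)) nz.
  - by rewrite mJ.
  - by rewrite -/E (qval_perm EE).
have pos0 : 0 < wordT s0 J.
  refine (@wordT_detect_gt0 C _ _ _ _ _ _ (@slot_pos_inj _ _ kf) (@slot_ty_blk _ _ kf)
    (@slot_pos_ty _ _ kf) (@slot_ty_n _ _ kf) J (slot_coord_fix tba) (slot_coord_decr tba) s0 _).
  by rewrite map_nrm_allowed ?aXn // perm_sym.
have i0n : (index s0 X < size X)%N by rewrite index_mem.
pose i0 := Ordinal i0n; have Xi0 : Xn i0 = s0 by apply: nth_index.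
move: y0; rewrite /y sum_ffunE (bigD1 i0) /=; last by rewrite size_map Xi0 s0size.
rewrite big1 ?addr0 => [|i /andP[/eqP szi ii0]].
  by rewrite ffunE Xi0 => /eqP; rewrite mulf_eq0 (negPf ds0) (gt_eqF pos0).
rewrite size_map in szi; rewrite ffunE.
have [->|di] := eqVneq (d (Xn i)) 0; first by rewrite scale0r.
have [->|nz] := eqVneq (wordT (Xn i) J) 0.
  by rewrite scaler0.
have := det _ szi (s0min _ (XnX i) di szi) nz; rewrite map_nrm_allowed ?aXn // => /(cX _ _ (XnX i) s0X).
move=> Ei; case/eqP: ii0; apply: val_inj; apply/eqP.
by rewrite /= -(nth_uniq [::] _ i0n uX) // nth_index // -/(Xn i) Ei.
Qed.

(** Different sequences may give the same monomial, so the exponents are first sorted and equal ones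
    merged; independence then applies to pairwise distinct multisets. *)
Lemma spanned_annihilator (q : Snm) :
  q \in lin_span (fun q : Snm => exists2 s, adm m s & q = mono Z s) -> Ann q -> q = 0.
Proof.
move=> /lin_spanP[k [c [u [Xu ->]]]].
have /choice[s sP] : forall i, exists s, [/\ adm m s, u i = mono Z s & sort (@edge_le _) s = s].
  move=> i; have [s sadm ->] := Xu i; exists (sort (@edge_le _) s).
  have sE : perm_eq (sort (@edge_le _) s) s by rewrite perm_sort.
  have ss := edge_sort_perm sE; split=> //; last first.
    by rewrite (mono_perm C sE).
  have [al admP] := sadm; split=> [|c' r k' j' cE]; first by rewrite (perm_all _ sE).
  by apply: (admP c' r); rewrite perm_sym in sE; apply: (perm_trans sE).
rewrite (eq_bigr (fun i => c i *: mono Z (s i))) => [|i _]; last by have [_ -> _] := sP i.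
have [X [d [uX Xs ->]]] := undup_combination (mono Z) c s.
move=> A; rewrite big_seq big1 // => x xX.
suff -> : d x = 0 by rewrite scale0r.
apply: (adm_independent uX _ _ A) => // [y z yX zX|y yX].
  have [i ->] := Xs _ yX; have [j ->] := Xs _ zX.
  by move=> /edge_sort_perm; have [_ _ ->] := sP i; have [_ _ ->] := sP j.
by have [i ->] := Xs _ yX; have [] := sP i.
Qed.

End Main.

Theorem theoremA (R : realType) (n : nat) (n_gt0 : (0 < n)%N)
    (m : 'I_n -> nat)
    (f : 'rV[int]_n -> 'M[R[i]]_(n + n))
    (f_root : forall a, pos_root a -> neg_root_vector a (f a) /\ f a <> 0)
    (V : lmodType R[i]) (act : 'M[R[i]]_(n + n) -> {linear V -> V})
    (V_module : is_sp_module act) (V_irr : irreducible_module act)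
    (v : V)
    (v_hw : highest_weight_vector act (\sum_(i < n) fund_weight i *+ m i) v) :
  forall p : Sym (nminus R[i] n),
    annihilator act v p <->
    ideal_gen (U_circ (fun g : Sym (nminus R[i] n) => g \in lin_span (fun q : Sym (nminus R[i] n) =>
      (exists i j : 'I_n, [/\ (i <= j)%N, (j.+1 < n)%N &
         q = sym_gen (nminus R[i] n) (f (alpha n i j)) ^+ (pairing m i j).+1]) \/
      (exists i : 'I_n,
         q = sym_gen (nminus R[i] n) (f (alpha_bar n i i))
               ^+ (pairing m i n.-1).+1)))) p.
Proof.
have [v_neq0 v_nplus v_cartan] := v_hw.
set X := fun q => _ \/ _; set G := fun g => g \in lin_span X.
have short (i j : 'I_n) (l : 'I_(n + n)) : (i <= j)%N -> (j.+1 < n)%N -> l = j.+1 :> nat ->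
    exists2 k, k != 0 & f (alpha n i j) = k *: zm R[i] l (rev_ord (lshift n i)).
  move=> ij jn lE; have [|fr f0] := f_root (alpha n i j); first by exists i, j; split=> //; left.
  exact: short_root_vector fr f0.
have long (i : 'I_n) : exists2 k, k != 0 &
    f (alpha_bar n i i) = k *: zm R[i] (rev_ord (lshift n i)) (rev_ord (lshift n i)).
  have [|fr f0] := f_root (alpha_bar n i i); first by exists i, i; split=> //; right.
  exact: long_root_vector fr f0.
have AX q : X q -> annihilator act v q.
  have scale k x N : x \in nminus R[i] n -> iter N (act x) v = 0 ->
      annihilator act v (sym_gen (nminus R[i] n) (k *: x) ^+ N).
    move=> xn x0; rewrite sym_genZ exprZn -mulr_algl.
    apply: (annihilatorM V_module v_nplus v_cartan).
    exact: (annihilator_genX V_module v_nplus v_cartan xn x0).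
  case=> [[i [j [ij jn ->]]]|[i ->]].
    have jn' : (j.+1 < n + n)%N by rewrite ltn_addr.
    have [k _ ->] := short i j (Ordinal jn') ij jn erefl.
    apply: scale; first by apply: zm_nminus => /=; have := ltn_ord i; lia.
    exact: (short_nilpotent V_module V_irr v_neq0 v_nplus v_cartan ij jn).
  have [k _ ->] := long i.
  (* Rescaling to the matrix unit for which [long_nilpotent] is stated. *)
  rewrite -[zm _ _ _](@scalerK _ _ 2^-1) ?invr_eq0 ?pnatr_eq0 // scalerA.
  apply: scale; first by apply/rpredZ/zm_nminus => /=; have := ltn_ord i; lia.
  exact: (long_nilpotent V_module V_irr v_neq0 v_nplus v_cartan).
have AG p : ideal_gen (U_circ G) p -> annihilator act v p.
  apply: (annihilator_ideal V_module v_nplus v_cartan) => q /lin_spanP[k [c [u [Xu ->]]]].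
  apply: annihilator_sum => i _.
  rewrite -mulr_algl; apply: (annihilatorM V_module v_nplus v_cartan).
  exact: AX.
(* The chosen root vectors agree with the Z's only up to nonzero scalars; these are absorbed because
   the generating set is a linear span. *)
have gen k q : k != 0 -> X (k *: q) -> q \in lin_span (circ_word G).
  move=> k0 Xq; rewrite -[q](scalerK k0); apply: sub_lin_span; apply: CircNil.
  by apply: rpredZ; apply: sub_lin_span.
move=> p; split=> [Ap|]; last exact: AG.
have [|i t tE|i Ii pi] := @spanned_all _ _ m G _ _ p.
- move=> i j l t ij jn lE tE; have [k k0 fE] := short i j l ij jn lE.
  have -> : t = rev_ord (lshift n i) by apply: val_inj.
  rewrite /Zg ifT; last by rewrite lE /=; have := ltn_ord i; lia.
  apply: (gen (k ^+ (pairing m i j).+1)); first by rewrite expf_neq0.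
  by left; exists i, j; rewrite fE sym_genZ exprZn.
- have [k k0 fE] := long i.
  have -> : t = rev_ord (lshift n i) by apply: val_inj.
  rewrite /Zg ifT; last by rewrite /=; have := ltn_ord i; lia.
  apply: (gen (k ^+ (pairing m i n.-1).+1)); first by rewrite expf_neq0.
  by right; exists i; rewrite fE sym_genZ exprZn.
(* The remainder is a combination of admissible monomials, and it annihilates the highest weight
   vector because both p and i do. *)
have pi0 : p - i = 0.
  apply: (spanned_annihilator V_module v_neq0 v_nplus v_cartan pi).
  by rewrite addrC -[- i]scaleN1r; exact: annihilatorP (AG i Ii) Ap.
by move/eqP: pi0; rewrite subr_eq0 => /eqP ->.
Qed.
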